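(* Let $C$ be the Cesàro operator on $H^2(\mathbb{C}_+)$, $(Cf)(z)=\frac{1}{z}\int_0^z f(\zeta)\,d\zeta$ for $f\in H^2(\mathbb{C}_+)$, $z\in\mathbb{C}_+$. Then $C=I+U$, where $I$ is the identity operator on $H^2(\mathbb{C}_+)$ and $U$ is a unitary operator on $H^2(\mathbb{C}_+)$. In particular, $C$ is a normal operator on $H^2(\mathbb{C}_+)$.
   Context: $\mathbb{C}_+=\{z=x+iy: x\in\mathbb{R},\,y>0\}$ is the upper half-plane. $H^2(\mathbb{C}_+)$ is the space of functions $f$ holomorphic in $\mathbb{C}_+$ with $\|f\|_2=\left[\sup_{y>0}\int_{-\infty}^{\infty}|f(x+iy)|^2\,dx\right]^{1/2}<\infty$. Each such $f$ has non-tangential boundary values $f(x)$ for almost every $x\in\mathbb{R}$, the boundary function belongs to $L^2(\mathbb{R})$, and $H^2(\mathbb{C}_+)$ is a Hilbert space with inner product $\langle f,g\rangle=\int_{-\infty}^{\infty}f(x)\overline{g(x)}\,dx$. The integral $\int_0^z f(\zeta)\,d\zeta$ is taken along the segment from $0$ to $z$, so that $(Cf)(z)=\int_0^1 f(zs)\,ds$; the operator $C$ is bounded on $H^2(\mathbb{C}_+)$. *)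

(* Defs.v *)
From HB Require Import structures.
From mathcomp Require Import all_boot all_order all_algebra.
From mathcomp Require Import ring lra complex.
From mathcomp Require Import all_classical all_reals all_analysis.
From mathcomp Require Import measurable_realfun.

Set Implicit Arguments.
Unset Strict Implicit.
Unset Printing Implicit Defensive.

Import Order.TTheory GRing.Theory Num.Theory.
Import numFieldNormedType.Exports.
Import ComplexField.Normc.

Local Open Scope classical_set_scope.
Local Open Scope ring_scope.
Local Open Scope complex_scope.

(* The generic instances making a numeric field a normed module over itself do
   not apply to the concrete type R[i]. *)
HB.instance Definition _ (R : rcfType) := NormedModule.copy R[i] R[i]^o.

Section HardySpace.
Variable R : realType.
Local Notation C := R[i].
Local Notation mu := (@lebesgue_measure R).
Local Notation Re := (@complex.Re R).
Local Notation Im := (@complex.Im R).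
Implicit Types f g : C -> C.

Definition upper_half_plane : set C := [set z | 0 < Im z].

(* The scalar field of derivable is R[i] here, hence this is complex
   differentiability. *)
Definition holomorphic f := forall z, upper_half_plane z -> derivable f z 1.

Definition horizontal_energy f (y : R) : \bar R :=
  (\int[mu]_x (normc (f (x +i* y)) ^+ 2)%:E)%E.

Definition H2_energy f : \bar R :=
  ereal_sup [set horizontal_energy f y | y in [set y : R | 0 < y]].

(* A function on the open upper half-plane is encoded by its extension by 0 to
   the whole complex plane, so that Leibniz equality of elements of H2 is
   equality on the upper half-plane. *)
Definition H2_set : set (C -> C) := [set f |
  [/\ holomorphic f,
      forall z, ~ upper_half_plane z -> f z = 0 &
      (H2_energy f < +oo)%E ] ].

Lemma normc_sqr (z : C) : normc z ^+ 2 = Re z ^+ 2 + Im z ^+ 2.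
Proof. by case: z => a b /=; rewrite sqr_sqrtr// addr_ge0 ?sqr_ge0. Qed.

Lemma normr_normc (z : C) : `|z| = (normc z)%:C.
Proof. by []. Qed.

Lemma ltr_normc (z : C) (e : R) : (`|z| < e%:C) = (normc z < e).
Proof. by rewrite normr_normc ltcR. Qed.

Lemma continuous_normc_line f (y : R) :
  (forall x : R, {for x +i* y, continuous f}) ->
  continuous (fun x : R => normc (f (x +i* y))).
Proof.
move=> cf x; apply/cvgrPdist_lt => e e0.
have e0C : 0 < e%:C by rewrite ltcR.
have /cvgrPdist_lt/(_ _ e0C) := cf x.
rewrite near_simpl => /nbhs_ballP[d /= d0 H].
have dE : d = (Re d)%:C.
  by apply/eqP; rewrite eq_complex/= eqxx/=; move: d0; rewrite ltcE/= => /andP[].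
have d'0 : 0 < Re d by rewrite -ltcR -dE.
apply/nbhs_ballP; exists (Re d) => //= t xt.
have : ball (x +i* y) d (t +i* y).
  rewrite -ball_normE /ball_/= dE.
  have -> : x +i* y - (t +i* y) = (x - t)%:C.
    by apply/eqP; rewrite eq_complex/= subrr !eqxx.
  rewrite normr_normc ltcR /= expr0n addr0 sqrtr_sqr.
  exact: xt.
move=> /H; rewrite /= ltr_normc; apply: le_lt_trans.
rewrite -lecR.
have H2 : `|(normc (f (x +i* y)) - normc (f (t +i* y)))%:C| <=
   `|f (x +i* y) - f (t +i* y)|.
  by rewrite rmorphB/=; exact: (ler_dist_dist (f (x +i* y)) (f (t +i* y))).
by rewrite -normr_normc (le_trans _ H2)// normr_normc lecR /= expr0n addr0 sqrtr_sqr.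
Qed.

Lemma measurable_energy f (y : R) : holomorphic f -> 0 < y ->
  measurable_fun setT (EFin \o (fun x : R => normc (f (x +i* y)) ^+ 2 : R)).
Proof.
move=> df y0.
have cf : continuous (fun x : R => normc (f (x +i* y)) : R).
  apply: continuous_normc_line => x; apply: differentiable_continuous.
  exact/derivable1_diffP/df.
apply/measurable_EFinP; apply: measurable_funX.
exact: continuous_measurable_fun.
Qed.

Lemma H2_submod_closed : submod_closed [in H2_set].
Proof.
split.
  rewrite inE; split=> //.
  apply: (@le_lt_trans _ _ 0%E) => //.
  apply: ge_ereal_sup => _ [y _ <-]; rewrite /horizontal_energy.
  rewrite integral0_eq// => x _.
  by rewrite normc0 expr0n.
move=> a f g; rewrite !inE => -[df f0 Ef] [dg g0 Eg].
have dh : holomorphic (a *: f + g).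
  by move=> z zU; apply: derivableD; [apply: derivableZ; exact: df|exact: dg].
split=> //.
  by move=> z zU; rewrite !fctE f0// g0// scaler0 addr0.
set k : R := 2 * normc a ^+ 2.
have k0 : 0 <= k by rewrite mulr_ge0// sqr_ge0.
apply: (@le_lt_trans _ _ (k%:E * H2_energy f + 2%:E * H2_energy g)%E); last first.
  by rewrite lte_add_pinfty// lte_mul_pinfty// ?lee_fin.
apply: ge_ereal_sup => _ [y /= y0 <-].
pose F x : \bar R := (normc (f (x +i* y)) ^+ 2)%:E.
pose G x : \bar R := (normc (g (x +i* y)) ^+ 2)%:E.
have F0 x : (0 <= F x)%E by rewrite lee_fin sqr_ge0.
have G0 x : (0 <= G x)%E by rewrite lee_fin sqr_ge0.
have mF : measurable_fun setT F by exact: measurable_energy.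
have mG : measurable_fun setT G by exact: measurable_energy.
have mkF : measurable_fun setT (fun x => k%:E * F x)%E by exact: measurable_funeM.
have mkG : measurable_fun setT (fun x => 2%:E * G x)%E by exact: measurable_funeM.
apply: (@le_trans _ _ (k%:E * (\int[mu]_x F x) + 2%:E * (\int[mu]_x G x))%E);
    last first.
  by apply: leeD; apply: lee_wpmul2l; rewrite ?lee_fin//;
    apply: ereal_sup_ubound; exists y.
rewrite -!ge0_integralZl// -ge0_integralD//; last 2 first.
- by move=> x _; rewrite mule_ge0.
- by move=> x _; rewrite mule_ge0.
apply: ge0_le_integral => //.
- by move=> x _; rewrite lee_fin sqr_ge0.
- exact: (@measurable_energy (a *: f + g)).
- exact: emeasurable_funD.
move=> x _; rewrite -!EFinM -EFinD lee_fin !fctE /k -mulrA -exprMn -normcM.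
move: (f _) (g _) => u v; rewrite -[a *: u]/(a * u) !normc_sqr.
case: (a * u) v => [b c] [d e] /=.
have := sqr_ge0 (b - d); have := sqr_ge0 (c - e); nra.
Qed.

Definition H2_pred : {pred C -> C} := [in H2_set].

HB.instance Definition _ :=
  GRing.isSubmodClosed.Build _ _ H2_pred H2_submod_closed.

Record H2 := MkH2 { H2_val :> C -> C; _ : H2_val \in H2_pred }.

HB.instance Definition _ := [isSub for H2_val].
HB.instance Definition _ := [Choice of H2 by <:].
HB.instance Definition _ := [SubChoice_isSubLmodule of H2 by <:].

Definition H2_norm (f : H2) : R := Num.sqrt (fine (H2_energy f)).

Definition cintegral (D : set R) (h : R -> C) : C :=
  (\int[mu]_(t in D) Re (h t)) +i* (\int[mu]_(t in D) Im (h t)).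

Definition cone (a x : R) : set C := [set z | `|Re z - x| < a * Im z].

(* The non-tangential limit at x is the common limit along all the cones with
   vertex x; the intersection of the corresponding filters captures it. *)
Definition nontangential (x : R) : set_system C :=
  \bigcap_(a in [set a : R | 0 < a]) within (cone a x) (nbhs x%:C).

Definition boundary_value f (x : R) : C := lim (f @ nontangential x).

Definition inner (f g : H2) : C :=
  cintegral setT (fun x => boundary_value f x * (boundary_value g x)^* ).

Definition bounded_operator (T : H2 -> H2) :=
  linear T /\ exists M : R, forall f : H2, H2_norm (T f) <= M * H2_norm f.

Definition is_adjoint (T S : H2 -> H2) :=
  bounded_operator S /\ forall f g : H2, inner (T f) g = inner f (S g).

Definition unitary_operator (T : H2 -> H2) :=
  bounded_operator T /\
  exists S, [/\ is_adjoint T S, S \o T = id & T \o S = id].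

Definition normal_operator (T : H2 -> H2) :=
  bounded_operator T /\ exists2 S, is_adjoint T S & S \o T = T \o S.

Definition segment_integral f (a b : C) : C :=
  cintegral `[0, 1] (fun t => f (a + (b - a) * t%:C) * (b - a)).

(* The value is set to 0 off the upper half-plane, as for elements of H2. *)
Definition cesaro_average f : C -> C :=
  (fun z => z^-1 * segment_integral f 0 z) \_ upper_half_plane.

End HardySpace.

(* Main.v *)
From HB Require Import structures.
From mathcomp Require Import all_boot all_order all_algebra.
From mathcomp Require Import ring lra complex.
From mathcomp Require Import all_classical all_reals all_analysis.
From mathcomp Require Import measurable_realfun.
Require Import Defs.

Set Implicit Arguments.
Unset Strict Implicit.
Unset Printing Implicit Defensive.

Import Order.TTheory GRing.Theory Num.Theory.
Import numFieldNormedType.Exports.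
Import ComplexField.Normc.

Local Open Scope classical_set_scope.
Local Open Scope ring_scope.
Local Open Scope complex_scope.

(** * Complex differentiability in epsilon-delta form *)

Section ComplexDifferentiability.
Variable R : realType.
Local Notation C := R[i].
Local Notation Re := (@complex.Re R).
Local Notation Im := (@complex.Im R).
Implicit Types (z w h l : C) (f g : C -> C).

Lemma complexeqP z w : Re z = Re w -> Im z = Im w -> z = w.
Proof. by case: z w => [a b] [c d] /= -> ->. Qed.

Lemma ReD z w : Re (z + w) = Re z + Re w. Proof. by case: z w => [a b] []. Qed.
Lemma ImD z w : Im (z + w) = Im z + Im w. Proof. by case: z w => [a b] []. Qed.
Lemma ReN z : Re (- z) = - Re z. Proof. by case: z. Qed.
Lemma ImN z : Im (- z) = - Im z. Proof. by case: z. Qed.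
Lemma ReM z w : Re (z * w) = Re z * Re w - Im z * Im w.
Proof. by case: z w => [a b] []. Qed.
Lemma ImM z w : Im (z * w) = Re z * Im w + Im z * Re w.
Proof. by case: z w => [a b] []. Qed.
Lemma ReJ z : Re z^*%C = Re z. Proof. by case: z. Qed.
Lemma ImJ z : Im z^*%C = - Im z. Proof. by case: z. Qed.

Lemma conjcD z w : (z + w)^*%C = z^*%C + w^*%C.
Proof. by apply: complexeqP; rewrite !(ReD, ImD, ReJ, ImJ) // opprD. Qed.

Definition ReImE := (ReD, ImD, ReN, ImN, ReM, ImM, ReJ, ImJ).

Lemma normc_ge0 z : 0 <= normc z.
Proof. by case: z => a b /=; rewrite sqrtr_ge0. Qed.

Lemma normcN z : normc (- z) = normc z.
Proof. by case: z => a b /=; rewrite !sqrrN. Qed.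

Lemma normcB z w : normc (z - w) = normc (w - z).
Proof. by rewrite -normcN opprB. Qed.

Lemma normcJ z : normc z^*%C = normc z.
Proof. by case: z => a b /=; rewrite !sqrrN. Qed.

Lemma normc_le_add z w : normc (z + w) <= normc z + normc w.
Proof. by rewrite -lecR rmorphD /= -!normr_normc; exact: ler_normD. Qed.

Lemma normc_gt0 z : (0 < normc z) = (z != 0).
Proof.
rewrite lt_neqAle normc_ge0 andbT; congr (~~ _); apply/eqP/eqP.
  by move=> /esym/eq0_normc.
by move=> ->; rewrite normc0.
Qed.

Lemma normc_real (r : R) : normc r%:C = `|r|.
Proof. by rewrite /= expr0n addr0 sqrtr_sqr. Qed.

Lemma Re_le_normc z : `|Re z| <= normc z.
Proof.
case: z => a b /=; rewrite -sqrtr_sqr ler_wsqrtr// lerDl sqr_ge0//.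
Qed.

Lemma Im_le_normc z : `|Im z| <= normc z.
Proof.
case: z => a b /=; rewrite -sqrtr_sqr ler_wsqrtr// lerDr sqr_ge0//.
Qed.

Lemma normc_le_ReIm z : normc z <= `|Re z| + `|Im z|.
Proof.
rewrite -(@ler_pXn2r _ 2)// ?nnegrE ?normc_ge0 ?addr_ge0//.
rewrite normc_sqr sqrrD -!normrX !(ger0_norm (sqr_ge0 _)) -addrA.
by rewrite lerD2l lerDr mulrn_wge0// mulr_ge0.
Qed.

Lemma normc_lt_ReIm z (e : R) : `|Re z| < e / 2 -> `|Im z| < e / 2 -> normc z < e.
Proof. by move=> h1 h2; have := normc_le_ReIm z; lra. Qed.

Definition cderiv f z l := forall e : R, 0 < e -> exists2 d : R, 0 < d &
  forall h, normc h < d -> normc (f (z + h) - f z - l * h) <= e * normc h.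

Definition ccont f z := forall e : R, 0 < e -> exists2 d : R, 0 < d &
  forall w, normc (w - z) < d -> normc (f w - f z) < e.

Lemma nbhs_normc z (A : set C) : nbhs z A <->
  exists2 d : R, 0 < d & forall w, normc (w - z) < d -> A w.
Proof.
split=> [/nbhs_ballP[d /= d0 H]|[d d0 H]].
  have dE : d = (Re d)%:C.
    by apply: complexeqP => //=; move: d0; rewrite ltcE/= => /andP[/eqP].
  exists (Re d); first by rewrite -ltcR -dE.
  move=> w wz; apply: H; rewrite -ball_normE /ball_/= dE normr_normc ltcR.
  by rewrite normcB.
apply/nbhs_ballP; exists d%:C; first by rewrite /= ltcR.
move=> w; rewrite -ball_normE /ball_/= normr_normc ltcR => wz.
by apply: H; rewrite normcB.
Qed.

Lemma ccontP f z : ccont f z <-> {for z, continuous f}.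
Proof.
split=> [H|H e e0].
  move=> A /nbhs_normc[e e0 HA]; apply/nbhs_normc; have [d d0 Hd] := H e e0.
  by exists d => // w /Hd; exact: HA.
have /H/nbhs_normc[d d0 Hd] : nbhs (f z) [set w | normc (w - f z) < e].
  by apply/nbhs_normc; exists e.
by exists d.
Qed.

Lemma cderivP f z l : cderiv f z l <-> is_derive z 1 f l.
Proof.
have E (h : C) : h != 0 ->
    normc (h^-1 *: ((f \o shift z) (h *: 1) - f z) - l) =
    normc (f (z + h) - f z - l * h) / normc h.
  move=> h0; rewrite -normcV -normcM; congr normc => /=.
  rewrite -[h *: 1]/(h * 1) mulr1 [h + z]addrC -[_ *: _]/(h^-1 * _).
  by rewrite [RHS]mulrBl -mulrA mulfV// mulr1 mulrC.
have -> : is_derive z 1 f l <->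
    (h^-1 *: ((f \o shift z) (h *: 1) - f z) @[h --> 0^'] --> l).
  split=> [[cf <-]|H]; first exact: cf.
  split; first by apply/cvg_ex; exists l.
  by apply/cvg_lim.
split=> [H|H e e0].
  move=> A /nbhs_normc[e e0 HA].
  have e20 : 0 < e / 2 by rewrite divr_gt0.
  have [d d0 Hd] := H _ e20.
  apply/nbhs_normc; exists d => // h; rewrite subr0 => /Hd hd h0.
  apply: HA; rewrite E//; have nh0 : 0 < normc h by rewrite normc_gt0.
  rewrite ltr_pdivrMr// (le_lt_trans hd)// ltr_pM2r//; lra.
have /H/nbhs_normc[d d0 Hd] : nbhs l [set w | normc (w - l) < e].
  by apply/nbhs_normc; exists e.
exists d => // h hd; have [->|h0] := eqVneq h 0.
  by rewrite addr0 subrr mulr0 subr0 normc0 mulr0.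
have := Hd h; rewrite subr0 => /(_ hd h0) /=.
have nh0 : 0 < normc h by rewrite normc_gt0.
by move: (E _ h0) => /= ->; rewrite ltr_pdivrMr// => /ltW.
Qed.

Lemma derivable_cderivP f z : derivable f z 1 <-> exists l, cderiv f z l.
Proof.
split=> [/derivableP H|[l /cderivP[]]//].
by exists ('D_1 f z); apply/cderivP.
Qed.

Lemma cderiv_ccont f z l : cderiv f z l -> ccont f z.
Proof.
move=> H; apply/ccontP; apply: differentiable_continuous.
by apply/derivable1_diffP/derivable_cderivP; exists l.
Qed.

Lemma cderiv_eq f z l l' : cderiv f z l -> l = l' -> cderiv f z l'.
Proof. by move=> ? <-. Qed.

Lemma cderiv_near f g z l (d : R) : 0 < d ->
  (forall w, normc (w - z) < d -> f w = g w) -> cderiv f z l -> cderiv g z l.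
Proof.
move=> d0 fg H e e0; have [d1 d10 H1] := H e e0.
exists (Num.min d1 d); first by rewrite lt_min d10.
move=> h; rewrite lt_min => /andP[hd1 hd].
rewrite -!fg ?H1//; first by rewrite subrr normc0.
by rewrite addrAC subrr add0r.
Qed.

Lemma cderiv_cst (c : C) z : cderiv (fun=> c) z 0.
Proof. by apply/cderivP; exact: is_derive_cst. Qed.

Lemma cderiv_id z : cderiv id z 1.
Proof. by apply/cderivP; exact: is_derive_id. Qed.

Lemma cderivD f g z l m : cderiv f z l -> cderiv g z m ->
  cderiv (fun w => f w + g w) z (l + m).
Proof. by move=> /cderivP ? /cderivP ?; apply/cderivP; exact: is_deriveD. Qed.

Lemma cderivB f g z l m : cderiv f z l -> cderiv g z m ->
  cderiv (fun w => f w - g w) z (l - m).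
Proof. by move=> /cderivP ? /cderivP ?; apply/cderivP; exact: is_deriveB. Qed.

Lemma cderivM f g z l m : cderiv f z l -> cderiv g z m ->
  cderiv (fun w => f w * g w) z (f z * m + g z * l).
Proof. by move=> /cderivP ? /cderivP ?; apply/cderivP; exact: is_deriveM. Qed.

Lemma cderivZ f c z l : cderiv f z l -> cderiv (fun w => c * f w) z (c * l).
Proof.
by move=> H; apply: cderiv_eq (cderivM (cderiv_cst c z) H) _; rewrite mulr0 addr0.
Qed.

Lemma cderivV z : z != 0 -> cderiv (fun w => w^-1) z (- z^-1 ^+ 2).
Proof.
move=> z0 e e0; have nz : 0 < normc z by rewrite normc_gt0.
exists (Num.min (normc z / 2) (e * normc z ^+ 3 / 2)).
  by rewrite lt_min !divr_gt0// mulr_gt0// exprn_gt0.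
move=> h; rewrite lt_min => /andP[h1 h2].
have zh : normc z / 2 < normc (z + h).
  have := normc_le_add (z + h) (- h); rewrite addrK normcN; lra.
have zh0 : z + h != 0 by rewrite -normc_gt0; lra.
have -> : (z + h)^-1 - z^-1 - - z^-1 ^+ 2 * h = h * h * (z + h)^-1 * z^-1 ^+ 2.
  by field; rewrite z0 zh0.
rewrite expr2 !normcM !normcV -!mulrA [leRHS]mulrC ler_wpM2l ?normc_ge0//.
rewrite -!invfM ler_pdivrMr ?mulr_gt0//; last lra.
apply: (le_trans (ltW h2)); rewrite -mulrA ler_wpM2l ?(ltW e0)//.
by have := mulr_gt0 nz nz; nra.
Qed.

Lemma cderivV_shift p z : z != p -> cderiv (fun w => (w - p)^-1) z (- (z - p)^-1 ^+ 2).
Proof.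
rewrite -subr_eq0 => zp e e0; have [d d0 H] := cderivV zp e0.
by exists d => // h /H; rewrite -!addrA [h - p]addrC.
Qed.

Lemma cderiv_scale f (c : C) z l : cderiv f (c * z) l ->
  cderiv (fun w => f (c * w)) z (c * l).
Proof.
move=> H e e0; have nc := normc_ge0 c; have c1 : 0 < 1 + normc c by lra.
have [d d0 Hd] := H (e / (1 + normc c)) (divr_gt0 e0 c1).
exists (d / (1 + normc c)); first exact: divr_gt0.
move=> h hd; have := Hd (c * h).
have hn := normc_ge0 h.
rewrite normcM => Hh; have /Hh : normc c * normc h < d.
  move: hd; rewrite ltr_pdivlMr// mulrDr mulr1 => hd; rewrite mulrC; lra.
rewrite mulrDr mulrA [l * c]mulrC => /le_trans; apply.
rewrite mulrA ler_wpM2r// -mulrA ler_piMr ?(ltW e0)// mulrC ler_pdivrMr//; lra.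
Qed.

(** Reflection in a horizontal line: [w |-> conj (f (conj w + c))] is again
    holomorphic, which makes [|f|^2] on a line the restriction of a holomorphic
    function. *)
Lemma cderiv_conj f (c : C) z l : cderiv f (z^*%C + c) l ->
  cderiv (fun w => (f (w^*%C + c))^*%C) z l^*%C.
Proof.
move=> H e e0; have [d d0 Hd] := H e e0; exists d => // h.
rewrite -normcJ => /Hd; congr (_ <= _); rewrite -normcJ; congr normc.
rewrite [LHS]rmorphB [X in X - _]rmorphB rmorphM /= conjcK.
by rewrite conjcD [z^*%C + _ + c]addrAC.
Qed.

Lemma is_derive_eps (u : R -> R) (t l : R) :
  (forall e : R, 0 < e -> exists2 d : R, 0 < d &
    forall h : R, `|h| < d -> `|u (t + h) - u t - l * h| <= e * `|h|) ->
  is_derive t 1 u l.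
Proof.
move=> H.
have cv : h^-1 *: ((u \o shift t) (h *: 1) - u t) @[h --> 0^'] --> l.
  apply/cvgrPdist_le => e e0; have [d d0 Hd] := H e e0.
  near=> h; have h0 : h != 0 by near: h; exact: nbhs_dnbhs_neq.
  have hd : `|h| < d by near: h; exact: dnbhs0_lt.
  rewrite /= -[h *: 1]/(h * 1) mulr1 [h + t]addrC -[_ *: _]/(h^-1 * _).
  rewrite distrC -(ler_pM2r (_ : 0 < `|h|)) ?normr_gt0// -normrM.
  by rewrite mulrBl mulrAC mulVf// mul1r Hd.
split; first by apply/cvg_ex; exists l.
exact/cvg_lim.
Unshelve. all: by end_near. Qed.

Lemma is_derive_Re_line f (a b l : C) (t : R) : cderiv f (a + b * t%:C) l ->
  is_derive t 1 (fun s : R => Re (f (a + b * s%:C))) (Re (l * b)).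
Proof.
move=> H; apply: is_derive_eps => e e0.
have nb := normc_ge0 b; have b1 : 0 < 1 + normc b by lra.
have [d d0 Hd] := H (e / (1 + normc b)) (divr_gt0 e0 b1).
exists (d / (1 + normc b)); first exact: divr_gt0.
move=> h hd; have := Hd (b * h%:C).
have hn := normr_ge0 h.
rewrite normcM normc_real => Hh; have /Hh : normc b * `|h| < d.
  by move: hd; rewrite ltr_pdivlMr// mulrDr mulr1 => hd; rewrite mulrC; lra.
have cE : a + b * t%:C + b * h%:C = a + b * (t + h)%:C.
  by rewrite rmorphD mulrDr addrA.
rewrite cE => Hl.
have -> : Re (f (a + b * (t + h)%:C)) - Re (f (a + b * t%:C)) - Re (l * b) * h =
    Re (f (a + b * (t + h)%:C) - f (a + b * t%:C) - l * (b * h%:C)).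
  by rewrite mulrA !ReImE /= mulr0 subr0.
apply: (le_trans (Re_le_normc _)); apply: (le_trans Hl).
rewrite mulrA ler_wpM2r// -mulrA ler_piMr ?(ltW e0)// mulrC ler_pdivrMr//; lra.
Qed.

Lemma continuous_Re_line f (a b : C) (t : R) : ccont f (a + b * t%:C) ->
  {for t, continuous (fun s : R => Re (f (a + b * s%:C)))}.
Proof.
move=> H; apply/cvgrPdist_lt => e e0.
have nb := normc_ge0 b; have b1 : 0 < 1 + normc b by lra.
have [d d0 Hd] := H e e0.
have d'0 : 0 < d / (1 + normc b) by exact: divr_gt0.
apply/nbhs_ballP; exists (d / (1 + normc b)) => // s; rewrite /ball/= => st.
rewrite distrC; have := Re_le_normc (f (a + b * s%:C) - f (a + b * t%:C)).
rewrite !ReImE => /le_lt_trans; apply; apply: Hd.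
rewrite opprD addrACA subrr add0r -mulrBr -rmorphB normcM normc_real distrC.
move: st; rewrite ltr_pdivlMr// mulrDr mulr1 => st; rewrite mulrC.
by have := normr_ge0 (t - s); lra.
Qed.

End ComplexDifferentiability.

(** * Integrals of continuous functions over compact intervals *)

Section IntervalIntegral.
Variable R : realType.
Local Notation mu := (@lebesgue_measure R).
Implicit Types (g u v : R -> R) (a b : R).

Definition continuous_on a b g :=
  forall t, a <= t <= b -> {for t, continuous g}.

Lemma continuous_on_within a b g :
  continuous_on a b g -> {within `[a, b], continuous g}.
Proof.
move=> cg; apply: continuous_in_subspaceT => t; rewrite inE/= in_itv/=.
exact: cg.
Qed.

Lemma continuous_on_integrable a b g : continuous_on a b g ->
  mu.-integrable `[a, b] (EFin \o g).
Proof.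
move=> cg; apply: continuous_compact_integrable; first exact: segment_compact.
exact: continuous_on_within.
Qed.

Lemma is_derive_continuous u (t l : R) : is_derive t 1 u l -> {for t, continuous u}.
Proof. by case=> du _; exact/differentiable_continuous/derivable1_diffP. Qed.

Lemma Rintegral_derivative a b u v : a <= b ->
  (forall t, a <= t <= b -> is_derive t 1 u (v t)) -> continuous_on a b v ->
  (\int[mu]_(t in `[a, b]) v t)%R = u b - u a.
Proof.
rewrite le_eqVlt => /predU1P[<- _ _|ab du cv].
  by rewrite set_itv1 Rintegral_set1 subrr.
have cu t : a <= t <= b -> {for t, continuous u}.
  by move=> /du; exact: is_derive_continuous.
rewrite /Rintegral (@continuous_FTC2 _ v u a b)//.
- exact: continuous_on_within.
- split=> [t /[!in_itv]/= /andP[ta tb]||].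
  + by have [] := du t (introT andP (conj (ltW ta) (ltW tb))).
  + by apply: cvg_at_right_filter; apply: cu; rewrite lexx ltW.
  + by apply: cvg_at_left_filter; apply: cu; rewrite lexx ltW.
- move=> t /[!in_itv]/= /andP[ta tb]; rewrite derive1E.
  by have [_ ->] := du t (introT andP (conj (ltW ta) (ltW tb))).
Qed.

Lemma Rintegral_affine (c k : R) g : 0 < k -> continuous_on c (c + k) g ->
  (\int[mu]_(t in `[0, 1]) (k * g (c + k * t)) = \int[mu]_(t in `[c, c + k]) g t)%R.
Proof.
move=> k0 cg; have ck : c < c + k by rewrite ltrDl.
pose F (t : R) := c + k * t.
have dF (t : R) : is_derive t 1 F k.
  apply: is_derive_eps => e e0; exists 1 => // h _; rewrite /F.
  rewrite (_ : _ - _ = 0) ?normr0 ?mulr_ge0 ?(ltW e0)//; ring.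
have dF1 : derive1 F = cst k.
  by apply/funext => t; rewrite derive1E; have [_ ->] := dF t.
have F0 : F 0 = c by rewrite /F mulr0 addr0.
have F1 : F 1 = c + k by rewrite /F mulr1.
have cF t : {for t, continuous F} by apply: is_derive_continuous (dF t).
have := @integration_by_substitution_increasing R F g 0 1.
rewrite /Rintegral F0 F1 => -> //.
- by congr fine; apply: eq_integral => t _; rewrite dF1 /= !fctE mulrC.
- by move=> x y _ _ xy; rewrite /F ltrD2l ltr_pM2l.
- by rewrite dF1 => ? _; exact: cvg_cst.
- by rewrite dF1; exact: is_cvg_cst.
- by rewrite dF1; exact: is_cvg_cst.
- split=> [t _||]; first by have [] := dF t.
  + by apply: cvg_at_right_filter; apply: cF.
  + by apply: cvg_at_left_filter; apply: cF.
- exact: continuous_on_within.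
Qed.

Lemma Rintegral_reverse g : continuous_on 0 1 g ->
  (\int[mu]_(t in `[0, 1]) g (1 - t) = \int[mu]_(t in `[0, 1]) g t)%R.
Proof.
move=> cg; rewrite [RHS]Rintegration_by_substitution_onem ?lexx ?ler01//.
  by rewrite unstable.onem1.
exact: continuous_on_within.
Qed.

Lemma Rintegral_split a b (c : R) g : a <= c -> c <= b -> continuous_on a b g ->
  (\int[mu]_(t in `[a, b]) g t =
   \int[mu]_(t in `[a, c]) g t + \int[mu]_(t in `[c, b]) g t)%R.
Proof.
move=> ac cb /continuous_on_integrable ig.
have := Rintegral_itvB ig (_ : (BLeft a <= BRight c)%O) (_ : (BRight c <= BRight b)%O).
rewrite !bnd_simp => /(_ ac cb) /eqP; rewrite subr_eq addrC => /eqP ->.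
congr +%R; rewrite Rintegral_itv_obnd_cbnd//.
apply: (integrableS _ _ _ ig) => //.
by apply: subset_itv; rewrite bnd_simp.
Qed.

Lemma ler_Rintegral_cst (M : R) g : continuous_on 0 1 g ->
  (forall t, 0 <= t <= 1 -> `|g t| <= M) ->
  `|(\int[mu]_(t in `[0, 1]) g t)%R| <= M.
Proof.
move=> cg gM; have ig := continuous_on_integrable cg.
apply: (le_trans (le_normr_Rintegral _ ig)) => //.
apply: (@le_trans _ _ (\int[mu]_(t in `[0, 1]) M)%R).
  apply: le_Rintegral => //.
  - by apply: continuous_on_integrable => t t01; apply: cvg_norm; exact: cg.
  - by apply: continuous_on_integrable => t t01; exact: cvg_cst.
rewrite Rintegral_cst//= lebesgue_measure_itv/= lte_fin ltr01 oppr0 addr0.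
by rewrite mulr1.
Qed.

End IntervalIntegral.

(** * Cauchy's theorem for triangles, and primitives *)

Section Goursat.
Variable R : realType.
Local Notation C := R[i].
Local Notation mu := (@lebesgue_measure R).
Local Notation Re := (@complex.Re R).
Local Notation Im := (@complex.Im R).
Implicit Types (f : C -> C) (a b e z w : C).

Lemma ccontMr f z (k : C) : ccont f z -> ccont (fun w => f w * k) z.
Proof.
move=> cf e e0; have nk := normc_ge0 k; have k1 : 0 < 1 + normc k by lra.
have [d d0 Hd] := cf (e / (1 + normc k)) (divr_gt0 e0 k1).
exists d => // w /Hd; rewrite -mulrBl normcM ltr_pdivlMr// mulrDr mulr1.
by have := normc_ge0 (f w - f z); lra.
Qed.

Definition segRe f a b : R :=
  (\int[mu]_(t in `[0, 1]) Re (f (a + (b - a) * t%:C) * (b - a)))%R.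

Lemma Re_segment_integral f a b : Re (segment_integral f a b) = segRe f a b.
Proof. by []. Qed.

Lemma Im_segment_integral f a b :
  Im (segment_integral f a b) = segRe (fun w => - 'i * f w) a b.
Proof.
apply: eq_Rintegral => t _; rewrite -mulrA; move: (f _ * _) => w.
by rewrite !ReImE /= oppr0 mul0r mulN1r sub0r opprK.
Qed.

Definition ccont_seg f a b :=
  forall t : R, 0 <= t <= 1 -> ccont f (a + (b - a) * t%:C).

Lemma continuous_on_seg f a b : ccont_seg f a b ->
  continuous_on 0 1 (fun t : R => Re (f (a + (b - a) * t%:C) * (b - a))).
Proof.
move=> cf t t01.
exact: (continuous_Re_line (ccontMr (b - a) (cf t t01))).
Qed.

Lemma segRe_rev f a b : ccont_seg f b a -> segRe f a b = - segRe f b a.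
Proof.
move=> cf; have cg := continuous_on_seg cf.
rewrite /segRe -(Rintegral_reverse cg).
rewrite -[RHS]mulN1r -RintegralZl//; last first.
  apply: (@continuous_on_integrable _ 0 1
    (fun t : R => Re (f (b + (a - b) * (1 - t)%:C) * (a - b)))) => t t01.
  apply: (@continuous_comp _ _ _ (fun t : R => 1 - t)
    (fun t : R => Re (f (b + (a - b) * t%:C) * (a - b)))).
    by apply: cvgB; [exact: cvg_cst|exact: cvg_id].
  by apply: cg; lra.
apply: eq_Rintegral => t _; rewrite mulN1r -ReN -mulrN opprB.
by congr (Re (f _ * _)); rewrite rmorphB /=; ring.
Qed.

Lemma segRe_mid f a b (m : C) : m = a + (b - a) * (2^-1)%:C ->
  ccont_seg f a b -> segRe f a b = segRe f a m + segRe f m b.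
Proof.
move=> mE cf; have cg := continuous_on_seg cf.
set g := fun t : R => Re (f (a + (b - a) * t%:C) * (b - a)) in cg.
have h0 : 0 < 2^-1 :> R by rewrite invr_gt0.
have h1 : 2^-1 + 2^-1 = 1 :> R by field.
rewrite /segRe -/g (@Rintegral_split _ 0 1 2^-1)//; [|lra..].
have hC : (2^-1)%:C + (2^-1)%:C = 1 :> C by rewrite -rmorphD h1.
have ReZ (k : R) w : k * Re w = Re (w * k%:C) by rewrite !ReImE /= mulr0 subr0 mulrC.
congr (_ + _).
  have := @Rintegral_affine R 0 2^-1 g h0; rewrite add0r => <-; last first.
    by move=> t t01; apply: cg; lra.
  apply: eq_Rintegral => t _; rewrite /g ReZ add0r mE rmorphM.
  by congr (Re _); rewrite [a + _ - a]addrC addKr -mulrA; congr (f _ * _); ring.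
have := @Rintegral_affine R 2^-1 2^-1 g h0; rewrite h1 => <-; last first.
  by move=> t t01; apply: cg; lra.
apply: eq_Rintegral => t _; rewrite /g ReZ rmorphD rmorphM.
have bm : b - m = (b - a) * (2^-1)%:C.
  rewrite mE -[X in X - _](_ : a + (b - a) * ((2^-1)%:C + (2^-1)%:C) = b); first ring.
  by rewrite hC mulr1 addrC subrK.
by rewrite bm mE; congr (Re _); rewrite -mulrA; congr (f _ * _); ring.
Qed.

Lemma segRe_primitive f (P : C -> C) a b :
  (forall t : R, 0 <= t <= 1 -> cderiv P (a + (b - a) * t%:C) (f (a + (b - a) * t%:C))) ->
  ccont_seg f a b -> segRe f a b = Re (P b) - Re (P a).
Proof.
move=> dP cf.
have := @Rintegral_derivative R 0 1 (fun t : R => Re (P (a + (b - a) * t%:C)))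
  (fun t : R => Re (f (a + (b - a) * t%:C) * (b - a))) ler01.
rewrite /= mulr0 addr0 mulr1 [a + _]addrC subrK; apply.
  by move=> t t01; exact: is_derive_Re_line (dP t t01).
exact: continuous_on_seg.
Qed.

Lemma segReD f g a b : ccont_seg f a b -> ccont_seg g a b ->
  segRe (fun w => f w + g w) a b = segRe f a b + segRe g a b.
Proof.
move=> cf cg; rewrite /segRe -RintegralD//; first last.
- exact/continuous_on_integrable/continuous_on_seg.
- exact/continuous_on_integrable/continuous_on_seg.
by apply: eq_Rintegral => t _; rewrite mulrDl ReD.
Qed.

Lemma segRe_le f a b (M : R) : ccont_seg f a b ->
  (forall t : R, 0 <= t <= 1 -> normc (f (a + (b - a) * t%:C)) <= M) ->
  `|segRe f a b| <= M * normc (b - a).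
Proof.
move=> cf fM; apply: ler_Rintegral_cst; first exact: continuous_on_seg.
move=> t t01; apply: (le_trans (Re_le_normc _)); rewrite normcM.
by rewrite ler_wpM2r ?normc_ge0// fM.
Qed.

Definition strip (c d : R) : set C := [set z | c < Im z < d].

Lemma Im_seg a b (t : R) : Im (a + (b - a) * t%:C) = (1 - t) * Im a + t * Im b.
Proof. rewrite !ReImE /= mulr0 add0r; ring. Qed.

Lemma strip_seg c d a b (t : R) : strip c d a -> strip c d b -> 0 <= t <= 1 ->
  strip c d (a + (b - a) * t%:C).
Proof.
rewrite /strip /= Im_seg => /andP[ca ad] /andP[cb bd] /andP[t0 t1].
by have [t2|t2] := lerP t 2^-1; apply/andP; split; nra.
Qed.

Lemma strip_open c d z : strip c d z ->
  exists2 r : R, 0 < r & forall w, normc (w - z) < r -> strip c d w.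
Proof.
rewrite /strip /= => /andP[cz zd]; exists (Num.min (Im z - c) (d - Im z)).
  by rewrite lt_min !subr_gt0 cz zd.
move=> w; rewrite lt_min => /andP[h1 h2]; have := Im_le_normc (w - z).
by rewrite !ReImE; rewrite ler_norml => /andP[] *; lra.
Qed.

Lemma geometric_limit (u : nat -> R) (L : R) :
  (forall n, `|u n.+1 - u n| <= L / 2 ^+ n) ->
  exists l, forall n, `|l - u n| <= 2 * L / 2 ^+ n.
Proof.
move=> H; pose d n := 2 * L / 2 ^+ n : R.
have dS n : d n.+1 = L / 2 ^+ n.
  by rewrite /d exprS invfM mulrACA mulfV ?mul1r.
have dE n : d n = 2 * (L / 2 ^+ n) by rewrite /d mulrA.
have d0 n : 0 <= d n by have := H n; have := normr_ge0 (u n.+1 - u n); rewrite dE; lra.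
have up n m : u (n + m)%N + d (n + m)%N <= u n + d n.
  elim: m => [|m IH]; rewrite ?addn0// addnS.
  have := H (n + m)%N; rewrite ler_norml dS => /andP[_ h]; move: IH.
  by rewrite (dE (n + m)%N); lra.
have dn n m : u n - d n <= u (n + m)%N - d (n + m)%N.
  elim: m => [|m IH]; rewrite ?addn0// addnS.
  have := H (n + m)%N; rewrite ler_norml dS => /andP[h _]; move: IH.
  by rewrite (dE (n + m)%N); lra.
have ud n m : u n - d n <= u m + d m.
  have := dn n m; have := up m n; rewrite addnC.
  by have := d0 (n + m)%N; lra.
pose A := range (fun n => u n - d n).
have A0 : A !=set0 by exists (u 0%N - d 0%N); exists 0%N.
exists (sup A) => n.
have h1 : u n - d n <= sup A.
  by apply: ub_le_sup; [exists (u n + d n) => _ [m _ <-]; exact: ud|exists n].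
have h2 : sup A <= u n + d n.
  by apply: ge_sup => // _ [m _ <-]; exact: ud.
by rewrite ler_norml -/(d n); lra.
Qed.

Lemma exp2_small (L e : R) : 0 < e -> exists n : nat, L / 2 ^+ n < e.
Proof.
move=> e0; exists (Num.bound (L / e)).
rewrite ltr_pdivrMr ?exprn_gt0// mulrC -ltr_pdivrMr//.
exact: upper_nthrootP.
Qed.

(** Classical bisection: if the integral around a triangle were nonzero, one
    of its four halves would carry at least a quarter of it, again and again;
    at the point to which these triangles shrink [f] is affine up to an error
    [e * diameter], and an affine function integrates to zero, so that the
    integrals decay faster than the quarters allow. *)
Lemma goursat f (c d : R) :
  (forall z, strip c d z -> exists l, cderiv f z l) ->
  forall a b e, strip c d a -> strip c d b -> strip c d e ->
  segRe f a b + segRe f b e + segRe f e a = 0.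
Proof.
move=> df a0 b0 e0 sa0 sb0 se0.
have cseg a b : strip c d a -> strip c d b -> ccont_seg f a b.
  move=> sa sb t t01; have [l] := df _ (strip_seg sa sb t01).
  exact: cderiv_ccont.
pose T := (C * C * C)%type.
pose J (S : T) := segRe f S.1.1 S.1.2 + segRe f S.1.2 S.2 + segRe f S.2 S.1.1.
pose per (S : T) :=
  normc (S.1.2 - S.1.1) + normc (S.2 - S.1.2) + normc (S.1.1 - S.2).
pose mid a b : C := a + (b - a) * (2^-1)%:C.
pose m0 := Num.min (Im a0) (Num.min (Im b0) (Im e0)).
pose M0 := Num.max (Im a0) (Num.max (Im b0) (Im e0)).
pose ok z := m0 <= Im z <= M0.
have okS z : ok z -> strip c d z.
  rewrite /ok /strip /= le_max !ge_min !le_max => /andP[].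
  move: sa0 sb0 se0 => /andP[? ?] /andP[? ?] /andP[? ?].
  by move=> /or3P[h1|h1|h1] /or3P[h2|h2|h2]; apply/andP; split; lra.
pose okT (S : T) := [/\ ok S.1.1, ok S.1.2 & ok S.2].
have okm a b : ok a -> ok b -> ok (mid a b).
  rewrite /ok /mid Im_seg => /andP[? ?] /andP[? ?]; apply/andP; split; lra.
pose half (i : 'I_4) (S : T) : T :=
  let p := mid S.1.1 S.1.2 in let q := mid S.1.2 S.2 in let r := mid S.2 S.1.1 in
  nth S [:: (S.1.1, p, r); (p, S.1.2, q); (r, q, S.2); (q, r, p)] i.
have okhalf i S : okT S -> okT (half i S).
  move=> [? ? ?]; rewrite /half; case: i => -[|[|[|[|//]]]] i4 /=;
  by split; rewrite //=; apply: okm.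
have normc_half z : normc (z * (2^-1)%:C) = normc z / 2.
  by rewrite normcM normc_real gtr0_norm.
have kE : (2^-1)%:C = 2^-1 :> C by rewrite fmorphV rmorph_nat.
have perhalf i S : per (half i S) = per S / 2.
  case: S => -[a b] e; rewrite /per /half; case: i => -[|[|[|[|//]]]] i4 /=;
  [| | |rewrite (normcB b a) (normcB e b) (normcB a e)];
  rewrite !mulrDl -!normc_half /mid kE;
  by congr (_ + _ + _); congr normc; field.
have perge0 S : 0 <= per S by rewrite /per !addr_ge0 ?normc_ge0.
have Jhalf S : okT S -> J S = \sum_i J (half i S).
  case: S => -[a b] e [/= oa ob oe].
  rewrite 4!big_ord_recl big_ord0 /J /half /= addr0.
  set p := mid a b; set q := mid b e; set r := mid e a.
  have op : ok p by apply: okm.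
  have oq : ok q by apply: okm.
  have or : ok r by apply: okm.
  have cs x y : ok x -> ok y -> ccont_seg f x y.
    by move=> /okS ? /okS ?; exact: cseg.
  rewrite (@segRe_mid f a b p)// ?(@segRe_mid f b e q)// ?(@segRe_mid f e a r)//;
    try exact: cs.
  rewrite (@segRe_rev f r p) ?(@segRe_rev f q p) ?(@segRe_rev f r q); try exact: cs.
  ring.
have Jbig S : okT S -> exists i, `|J S| / 4 <= `|J (half i S)|.
  move=> oS; apply: contrapT => /forallNP H.
  have : `|J S| < `|J S|.
    rewrite {1}Jhalf// (le_lt_trans (ler_norm_sum _ _ _))//.
    have <- : \sum_(i < 4) (`|J S| / 4) = `|J S|.
      by rewrite sumr_const card_ord -[LHS]mulr_natr mulfVK.
    apply: ltr_sum; first by apply/hasP; exists ord0; rewrite ?mem_index_enum.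
    by move=> i _; rewrite ltNge; apply/negP/H.
  by rewrite ltxx.
pose pick S := xget ord0 [set i | `|J S| / 4 <= `|J (half i S)|].
have pickP S : okT S -> `|J S| / 4 <= `|J (half (pick S) S)|.
  by move=> /Jbig[i iS]; rewrite /pick; case: xgetP => [j -> //|/(_ i)].
pose Tn n := iter n (fun S => half (pick S) S) (a0, b0, e0).
have okT0 : okT (a0, b0, e0).
  by split; rewrite /ok ?le_max ?ge_min ?lexx ?orbT.
have okTn n : okT (Tn n) by elim: n => // n IH /=; exact: okhalf.
have perTn n : per (Tn n) = per (Tn 0%N) / 2 ^+ n.
  elim: n => [|n IH]; first by rewrite expr0 divr1.
  by rewrite /= perhalf IH exprSr invfM mulrA.
have JTn n : `|J (Tn 0%N)| / 4 ^+ n <= `|J (Tn n)|.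
  elim: n => [|n IH]; first by rewrite expr0 divr1.
  apply: le_trans (pickP _ (okTn n)); rewrite exprSr invfM mulrA.
  by rewrite ler_pM2r.
set L := per (Tn 0%N) in perTn.
have L0 : 0 <= L by exact: perge0.
clearbody L.
have step S i : normc ((half i S).1.1 - S.1.1) <= per S.
  case: S => -[a b] e; rewrite /per /half /=.
  have h (w : C) : normc (w / 2) <= normc w.
    by rewrite -kE normc_half; have := normc_ge0 w; lra.
  have n1 := normc_ge0 (b - a); have n2 := normc_ge0 (e - b).
  have n3 := normc_ge0 (a - e).
  case: i => -[|[|[|[|//]]]] i4 /=; rewrite /mid ?kE.
  - by rewrite subrr normc0; lra.
  - by rewrite addrC addKr; have := h (b - a); lra.
  - have -> : e + (a - e) / 2 - a = - ((a - e) / 2) by field.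
    by rewrite normcN; have := h (a - e); lra.
  - have -> : b + (e - b) / 2 - a = (b - a) + (e - b) / 2 by ring.
    by apply: (le_trans (normc_le_add _ _)); have := h (e - b); lra.
have ReB (z w : C) : Re (z - w) = Re z - Re w by rewrite !ReImE.
have ImB (z w : C) : Im (z - w) = Im z - Im w by rewrite !ReImE.
have [x xP] : exists x, forall n, `|x - Re (Tn n).1.1| <= 2 * L / 2 ^+ n.
  apply: geometric_limit => n; rewrite -ReB (le_trans (Re_le_normc _))//.
  by rewrite -perTn step.
have [y yP] : exists y, forall n, `|y - Im (Tn n).1.1| <= 2 * L / 2 ^+ n.
  apply: geometric_limit => n; rewrite -ImB (le_trans (Im_le_normc _))//.
  by rewrite -perTn step.
have okp : ok (x +i* y).
  rewrite /ok /=; apply/andP; split.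
    have [//|h] := leP m0 y; have my : 0 < m0 - y by rewrite subr_gt0.
    have [n hn] := exp2_small (2 * L) my.
    by have := yP n; have [/andP[? ?] _ _] := okTn n; rewrite ler_norml; lra.
  have [//|h] := leP y M0; have yM : 0 < y - M0 by rewrite subr_gt0.
  have [n hn] := exp2_small (2 * L) yM.
  by have := yP n; have [/andP[? ?] _ _] := okTn n; rewrite ler_norml; lra.
set p := x +i* y in okp.
have pn n : normc ((Tn n).1.1 - p) <= 4 * L / 2 ^+ n.
  rewrite normcB (le_trans (normc_le_ReIm _))// ReB ImB /=.
  by have := xP n; have := yP n; rewrite -!mulrA; lra.
apply: contrapT => J0.
have eta0 : 0 < `|J (Tn 0%N)| by rewrite normr_gt0; apply/eqP.
have [l dl] := df p (okS _ okp).
have LL : 0 < 5 * L ^+ 2 + 1 by have := sqr_ge0 L; lra.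
pose eps := `|J (Tn 0%N)| / (5 * L ^+ 2 + 1).
have eps0 : 0 < eps by exact: divr_gt0.
have [del del0 Hdel] := dl eps eps0.
have [n hn] := exp2_small (5 * L) del0.
have [oa ob oe] := okTn n.
have pern := perTn n; have pnn := pn n; have JTnn := JTn n.
move: (Tn n) oa ob oe pern pnn JTnn => [[a b] e] /= oa ob oe pern pnn JTnn.
pose aff w := f p + l * (w - p).
pose err w := f w - aff w.
pose P w := f p * w + l * (2^-1 * (w * w) - p * w).
have dP w : cderiv P w (aff w).
  have did := @cderiv_id R w.
  apply: (cderiv_eq (cderivD (cderivZ (f p) did)
    (cderivZ l (cderivB (cderivZ 2^-1 (cderivM did did)) (cderivZ p did))))).
  by rewrite /aff; field.
have daff w : cderiv aff w l.
  have := cderivD (cderiv_cst (f p) w)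
    (cderivZ l (cderivB (@cderiv_id R w) (cderiv_cst p w))).
  by rewrite subr0 mulr1 add0r.
have caff u v : ccont_seg aff u v by move=> t _; exact: cderiv_ccont (daff _).
have cerr u v : ok u -> ok v -> ccont_seg err u v.
  move=> /okS su /okS sv t t01; have [m dm] := df _ (strip_seg su sv t01).
  exact: cderiv_ccont (cderivB dm (daff _)).
have fE u v : ok u -> ok v -> segRe f u v = segRe err u v + (Re (P v) - Re (P u)).
  move=> ou ov; rewrite -(@segRe_primitive aff); [|by move=> *; exact: dP|exact: caff].
  rewrite -segReD; [|exact: cerr|exact: caff].
  by congr segRe; apply/funext => w; rewrite /err subrK.
have near_p u v (t : R) : normc (u - a) + normc (v - u) <= L / 2 ^+ n ->
    0 <= t <= 1 -> normc (err (u + (v - u) * t%:C)) <= eps * (5 * L / 2 ^+ n).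
  move=> uv /andP[t0 t1]; set w := u + _.
  have wp : normc (w - p) <= 5 * L / 2 ^+ n.
    have -> : w - p = (u - a) + ((v - u) * t%:C) + (a - p) by rewrite /w; ring.
    apply: (le_trans (normc_le_add _ _)).
    have := normc_le_add (u - a) ((v - u) * t%:C).
    rewrite normcM normc_real ger0_norm//.
    have : normc (v - u) * t <= normc (v - u) by rewrite ler_piMr// normc_ge0.
    by move: pnn; rewrite -!mulrA; lra.
  have := Hdel (w - p) (le_lt_trans wp hn); rewrite [p + _]addrC subrK.
  have -> : f w - f p - l * (w - p) = err w by rewrite /err /aff; ring.
  by move=> /le_trans; apply; rewrite ler_pM2l.
have n1 := normc_ge0 (b - a); have n2 := normc_ge0 (e - b).
have n3 := normc_ge0 (a - e).
move: pern; rewrite /per /= => pern.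
have bound u v : ok u -> ok v -> normc (u - a) + normc (v - u) <= L / 2 ^+ n ->
    `|segRe err u v| <= eps * (5 * L / 2 ^+ n) * normc (v - u).
  by move=> ou ov uv; apply: segRe_le; [exact: cerr|move=> t; exact: near_p].
have : `|J ((a, b), e)| <= eps * (5 * L / 2 ^+ n) * (L / 2 ^+ n).
  rewrite /J /= !fE//.
  have -> : forall A B D X Y Z : R,
    A + (X - Y) + (B + (Z - X)) + (D + (Y - Z)) = A + B + D by move=> *; ring.
  rewrite -pern !mulrDr.
  apply: (le_trans (ler_normD _ _)); apply: lerD; last first.
    apply: bound => //; have := normcB e a; have := normc_le_add (e - b) (b - a);
    by rewrite addrA subrK; lra.
  apply: (le_trans (ler_normD _ _)); apply: lerD.
    by apply: bound => //; rewrite subrr normc0; lra.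
  by apply: bound => //; lra.
apply/negP; rewrite -ltNge; apply: lt_le_trans JTnn.
have -> : eps * (5 * L / 2 ^+ n) * (L / 2 ^+ n) = eps * (5 * L ^+ 2) / 4 ^+ n.
  have -> : 4 ^+ n = 2 ^+ n * 2 ^+ n :> R by rewrite -exprMn; congr (_ ^+ n); ring.
  by rewrite invfM; ring.
rewrite ltr_pM2r ?invr_gt0 ?exprn_gt0// /eps mulrAC ltr_pdivrMr//.
by rewrite ltr_pM2l//; lra.
Qed.

End Goursat.

Section Primitive.
Variable R : realType.
Local Notation C := R[i].
Local Notation Re := (@complex.Re R).
Local Notation Im := (@complex.Im R).
Implicit Types (f g : C -> C) (z w : C).

Lemma segRe_cst (k : C) z w : segRe (fun=> k) z w = Re (k * (w - z)).
Proof.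
rewrite (@segRe_primitive _ _ (fun u => k * u)).
- by rewrite mulrBr -ReN -ReD.
- by move=> t _; apply: cderiv_eq (cderivZ k (cderiv_id _)) _; rewrite mulr1.
- by move=> t _; apply: cderiv_ccont (cderiv_cst k _).
Qed.

Lemma segRe_increment f (c d : R) z0 z (e : R) :
  (forall z, strip c d z -> exists l, cderiv f z l) ->
  strip c d z0 -> strip c d z -> 0 < e -> exists2 r : R, 0 < r &
    forall h, normc h < r ->
    `|segRe f z0 (z + h) - segRe f z0 z - Re (f z * h)| <= e * normc h.
Proof.
move=> df s0 sz e0; have [l dl] := df _ sz.
have [r1 r10 H1] := cderiv_ccont dl e0.
have [r2 r20 H2] := strip_open sz.
exists (Num.min r1 r2); first by rewrite lt_min r10.
move=> h; rewrite lt_min => /andP[hr1 hr2].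
have sh : strip c d (z + h) by apply: H2; rewrite addrC addKr.
have cf u v : strip c d u -> strip c d v -> ccont_seg f u v.
  by move=> su sv t /(strip_seg su sv)/df[m]; exact: cderiv_ccont.
have := goursat df s0 sz sh; rewrite (segRe_rev (cf _ _ s0 sh)) => G.
have -> : segRe f z0 (z + h) - segRe f z0 z - Re (f z * h) =
    segRe (fun w => f w + - f z) z (z + h).
  rewrite segReD; [|exact: cf|by move=> t _; exact: cderiv_ccont (cderiv_cst _ _)].
  by rewrite segRe_cst [z + h - z]addrC addKr mulNr ReN; move: G; lra.
rewrite -{2}[h](addKr z) [- z + _]addrC; apply: segRe_le.
  move=> t t01; have [m dm] := df _ (strip_seg sz sh t01).
  exact: cderiv_ccont (cderivD dm (cderiv_cst _ _)).
move=> t /andP[t0 t1]; apply/ltW/H1; rewrite [z + _]addrC addrK [z + h]addrC addrK.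
rewrite normcM normc_real ger0_norm// (le_lt_trans _ hr1)//.
by rewrite ler_piMr// normc_ge0.
Qed.

Lemma cderiv_segment_integral f (c d : R) z0 z :
  (forall z, strip c d z -> exists l, cderiv f z l) ->
  strip c d z0 -> strip c d z -> cderiv (segment_integral f z0) z (f z).
Proof.
move=> df s0 sz e e0.
have e20 : 0 < e / 2 by rewrite divr_gt0.
have df' w : strip c d w -> exists l, cderiv (fun w => - 'i * f w) w l.
  by move=> /df[l dl]; exists (- 'i * l); exact: cderivZ.
have [r1 r10 H1] := segRe_increment df s0 sz e20.
have [r2 r20 H2] := segRe_increment df' s0 sz e20.
exists (Num.min r1 r2); first by rewrite lt_min r10.
move=> h; rewrite lt_min => /andP[/H1 h1 /H2 h2].
apply: (le_trans (normc_le_ReIm _)).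
have -> : Im (segment_integral f z0 (z + h) - segment_integral f z0 z - f z * h) =
    segRe (fun w => - 'i * f w) z0 (z + h) - segRe (fun w => - 'i * f w) z0 z -
    Re (- 'i * f z * h).
  rewrite !ImD !ImN !Im_segment_integral -[in RHS]mulrA; congr (_ - _).
  by move: (f z * h) => w; rewrite !ReImE /= oppr0 mul0r mulN1r sub0r opprK.
have -> : Re (segment_integral f z0 (z + h) - segment_integral f z0 z - f z * h) =
    segRe f z0 (z + h) - segRe f z0 z - Re (f z * h).
  by rewrite !ReD !ReN !Re_segment_integral.
lra.
Qed.

End Primitive.

(** * Measurability and Tonelli's theorem for functions continuous on an open set *)

Section Boxes.
Variable R : realType.
Local Notation mu := (@lebesgue_measure R).
Implicit Types (A U : set (R * R)) (h : R * R -> R).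

Definition box_open A := forall p, A p -> exists2 d : R, 0 < d &
  forall q, `|q.1 - p.1| < d -> `|q.2 - p.2| < d -> A q.

Definition box_continuous A h := forall p, A p -> forall e : R, 0 < e ->
  exists2 d : R, 0 < d &
  forall q, `|q.1 - p.1| < d -> `|q.2 - p.2| < d -> `|h q - h p| < e.

Lemma box_open_measurable A : box_open A -> measurable A.
Proof.
move=> oA; pose B (i : rat * rat * (rat * rat)) : set (R * R) :=
  `]ratr i.1.1, ratr i.1.2[ `*` `]ratr i.2.1, ratr i.2.2[.
pose F i := if `[< B i `<=` A >] then B i else set0.
have -> : A = \bigcup_i F i.
  apply/seteqP; split=> [[x y] Axy|p [i _]]; last first.
    by rewrite /F; case: ifPn => // /asboolP; exact.
  have [d d0 dA] := oA _ Axy.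
  have lt1 z : z - d < z by rewrite gtrBl.
  have lt2 z : z < z + d by rewrite ltrDl.
  have [a /[!in_itv]/= /andP[a1 a2]] := rat_in_itvoo (lt1 x).
  have [b /[!in_itv]/= /andP[b1 b2]] := rat_in_itvoo (lt2 x).
  have [a' /[!in_itv]/= /andP[a'1 a'2]] := rat_in_itvoo (lt1 y).
  have [b' /[!in_itv]/= /andP[b'1 b'2]] := rat_in_itvoo (lt2 y).
  exists ((a, b), (a', b')) => //; rewrite /F; case: ifPn => [_|/asboolPn[]].
    by split; rewrite /= in_itv/=; apply/andP.
  move=> [s t] [] /=; rewrite !in_itv/= => /andP[? ?] /andP[? ?].
  by apply: dA => /=; rewrite ltr_norml; lra.
apply: countable_bigcupT_measurable => // i; rewrite /F; case: ifPn => // _.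
by apply: measurableX.
Qed.

Lemma box_continuous_measurable A h : box_open A -> box_continuous A h ->
  measurable_fun A h.
Proof.
move=> oA ch; apply: (measurability _ (RGenOpens.measurableE R)).
move=> _ [_ [a [b ->] <-]]; apply: box_open_measurable => p [Ap] /=.
rewrite in_itv/= => /andP[ap pb].
have [d1 d10 H1] := oA _ Ap.
have e0 : 0 < Num.min (h p - a) (b - h p) by rewrite lt_min !subr_gt0 ap.
have [d2 d20 H2] := ch _ Ap _ e0.
exists (Num.min d1 d2); first by rewrite lt_min d10.
move=> q; rewrite !lt_min => /andP[q1 q2] /andP[q3 q4]; split; first exact: H1.
move: (H2 _ q2 q4); rewrite /= in_itv/= lt_min !ltr_norml => /andP[/andP[? ?]] /andP[? ?].
by apply/andP; split; lra.
Qed.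

Section Tonelli.
Variables (U : set (R * R)) (h : R * R -> R) (A B : set R).
Hypotheses (oU : box_open U) (ch : box_continuous U h).
Hypotheses (mA : measurable A) (mB : measurable B).
Hypothesis ABU : A `*` B `<=` U.
Hypothesis h0 : forall p, 0 <= h p.

Let F := (EFin \o h) \_ (A `*` B).

Let mF : measurable_fun setT F.
Proof.
have mAB : measurable (A `*` B) by exact: measurableX.
apply/(measurable_restrictT _ mAB).
apply/measurable_EFinP; apply: measurable_funS ABU _.
  exact: box_open_measurable.
exact: box_continuous_measurable.
Qed.

Let F0 p : (0 <= F p)%E.
Proof. by rewrite /F patchE; case: ifPn => //= _; rewrite lee_fin. Qed.

Let F1E x : (\int[mu]_y F (x, y) =
  ((fun x => \int[mu]_(y in B) (h (x, y))%:E) \_ A) x)%E.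
Proof.
rewrite patchE; case: ifPn => xA; last first.
  by rewrite integral0_eq// => y _; rewrite /F patchE in_setX/= (negbTE xA).
rewrite [RHS]integral_mkcond; apply: eq_integral => y _.
by rewrite /F !patchE in_setX/= xA.
Qed.

Let F2E y : (\int[mu]_x F (x, y) =
  ((fun y => \int[mu]_(x in A) (h (x, y))%:E) \_ B) y)%E.
Proof.
rewrite patchE; case: ifPn => yB; last first.
  by rewrite integral0_eq// => x _; rewrite /F patchE in_setX/= (negbTE yB) andbF.
rewrite [RHS]integral_mkcond; apply: eq_integral => x _.
by rewrite /F !patchE in_setX/= yB andbT.
Qed.

Lemma measurable_integral1 :
  measurable_fun A (fun x => \int[mu]_(y in B) (h (x, y))%:E)%E.
Proof.
have mG := @measurable_fun_fubini_tonelli_F _ _ _ _ R mu F mF F0.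
apply/(measurable_restrictT _ mA).
by move: mG; congr (measurable_fun _ _); exact/funext/F1E.
Qed.

Lemma tonelli_box : (\int[mu]_(x in A) \int[mu]_(y in B) (h (x, y))%:E =
  \int[mu]_(y in B) \int[mu]_(x in A) (h (x, y))%:E)%E.
Proof.
rewrite integral_mkcond [RHS]integral_mkcond.
transitivity (\int[mu]_x \int[mu]_y F (x, y))%E.
  by apply: eq_integral => x _; rewrite F1E.
transitivity (\int[mu]_y \int[mu]_x F (x, y))%E; last first.
  by apply: eq_integral => x _; rewrite F2E.
exact: fubini_tonelli.
Qed.

End Tonelli.

Section Fubini.
Variables (U : set (R * R)) (h : R * R -> R) (A B : set R).
Hypotheses (oU : box_open U) (ch : box_continuous U h).
Hypotheses (mA : measurable A) (mB : measurable B).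
Hypothesis ABU : A `*` B `<=` U.
Hypothesis hoo : (\int[mu]_(x in A) \int[mu]_(y in B) `|h (x, y)|%:E < +oo)%E.

Let F := (EFin \o h) \_ (A `*` B).

Let mF : measurable_fun setT F.
Proof.
have mAB : measurable (A `*` B) by exact: measurableX.
apply/(measurable_restrictT _ mAB).
apply/measurable_EFinP; apply: measurable_funS ABU _.
  exact: box_open_measurable.
exact: box_continuous_measurable.
Qed.

Let iF : (mu \x mu)%E.-integrable setT F.
Proof.
apply/(@integrable12ltyP _ _ _ _ R mu mu F mF).
move: hoo; rewrite integral_mkcond; congr (_ < _)%E; apply: eq_integral => x _.
rewrite patchE; case: ifPn => xA; last first.
  by rewrite integral0_eq// => y _; rewrite /F patchE in_setX/= (negbTE xA) abse0.
rewrite [LHS]integral_mkcond; apply: eq_integral => y _.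
by rewrite /F !patchE in_setX/= xA /=; case: ifP => // _; rewrite abse0.
Qed.

Let F1E x : (\int[mu]_y F (x, y) =
  ((fun x => \int[mu]_(y in B) (h (x, y))%:E) \_ A) x)%E.
Proof.
rewrite patchE; case: ifPn => xA; last first.
  by rewrite integral0_eq// => y _; rewrite /F patchE in_setX/= (negbTE xA).
rewrite [RHS]integral_mkcond; apply: eq_integral => y _.
by rewrite /F !patchE in_setX/= xA.
Qed.

Let F2E y : (\int[mu]_x F (x, y) =
  ((fun y => \int[mu]_(x in A) (h (x, y))%:E) \_ B) y)%E.
Proof.
rewrite patchE; case: ifPn => yB; last first.
  by rewrite integral0_eq// => x _; rewrite /F patchE in_setX/= (negbTE yB) andbF.
rewrite [RHS]integral_mkcond; apply: eq_integral => x _.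
by rewrite /F !patchE in_setX/= yB andbT.
Qed.

Lemma measurable_integral2 :
  measurable_fun B (fun y => \int[mu]_(x in A) (h (x, y))%:E)%E.
Proof.
have mG := @measurable_fubini_G _ _ _ _ R mu mu F iF.
apply/(measurable_restrictT _ mB).
by move: mG; congr (measurable_fun _ _); exact/funext/F2E.
Qed.

Lemma fubini_box : (\int[mu]_(x in A) \int[mu]_(y in B) (h (x, y))%:E =
  \int[mu]_(y in B) \int[mu]_(x in A) (h (x, y))%:E)%E.
Proof.
rewrite integral_mkcond [RHS]integral_mkcond.
transitivity (\int[mu]_x \int[mu]_y F (x, y))%E.
  by apply: eq_integral => x _; rewrite F1E.
transitivity (\int[mu]_y \int[mu]_x F (x, y))%E; last first.
  by apply: eq_integral => x _; rewrite F2E.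
exact: (@Fubini _ _ _ _ R mu mu F iF).
Qed.

End Fubini.

(** An integrable function takes small values arbitrarily far out, on both
    sides: this selects vertical lines on which a holomorphic function of
    finite energy is negligible. *)
Lemma integrable_small_far (V : R -> \bar R) (N e : R) :
  measurable_fun setT V -> (forall x, 0 <= V x)%E ->
  (\int[mu]_x V x < +oo)%E -> 0 < e ->
  (exists2 x, N <= x & (V x < e%:E)%E) /\ (exists2 x, x <= N & (V x < e%:E)%E).
Proof.
move=> mV V0 Voo e0.
suff H (I : interval R) : mu [set` I] = +oo%E ->
    exists2 x, x \in I & (V x < e%:E)%E.
  split; [have [] := H `[N, +oo[|have [] := H `]-oo, N]].
  - by rewrite lebesgue_measure_itv/= ltry.
  - by move=> x; rewrite in_itv/= andbT => ? ?; exists x.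
  - by rewrite lebesgue_measure_itv/= ltNyr.
  - by move=> x; rewrite in_itv/= => ? ?; exists x.
move=> muI; apply: contrapT => /forall2NP H.
suff : (\int[mu]_(x in [set` I]) e%:E <= \int[mu]_x V x)%E.
  rewrite integral_cst// [X in (_ * X)%E]muI gt0_muley ?lte_fin//.
  by move=> /(lt_le_trans Voo); rewrite ltxx.
apply: (@le_trans _ _ (\int[mu]_(x in [set` I]) V x)%E).
  apply: ge0_le_integral => //.
  - by move=> ? _; rewrite lee_fin ltW.
  - exact: measurable_funTS.
  - by move=> x Ix; have [//|/negP] := H x; rewrite -leNgt.
by apply: ge0_subset_integral.
Qed.

End Boxes.

(** * Shifting the line of integration inside a strip *)

Section Continuity.
Variable R : realType.
Local Notation C := R[i].
Local Notation Re := (@complex.Re R).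
Local Notation Im := (@complex.Im R).

Lemma cvg_complex (T : Type) (F : set_system T) (FF : Filter F) (u v : T -> R) (a b : R) :
  u @ F --> a -> v @ F --> b -> (fun x => u x +i* v x : C) @ F --> (a +i* b : C).
Proof.
move=> ua vb A /nbhs_normc[e e0 HA].
have e20 : 0 < e / 2 by rewrite divr_gt0.
move/cvgrPdist_lt : ua => /(_ _ e20) ua; move/cvgrPdist_lt : vb => /(_ _ e20) vb.
near=> x; apply: HA; apply: normc_lt_ReIm; rewrite !ReImE /= distrC.
  by near: x; exact: ua.
by near: x; exact: vb.
Unshelve. all: by end_near. Qed.

Lemma continuous_lipschitz1 (Phi : C -> R) :
  (forall a b, `|Phi a - Phi b| <= normc (a - b)) -> continuous Phi.
Proof.
move=> HPhi z A /nbhs_ballP[e /= e0 HA]; apply/nbhs_normc; exists e => // w wz.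
by apply: HA; rewrite /ball/= distrC (le_lt_trans (HPhi _ _)).
Qed.

Lemma continuous_Re : continuous Re.
Proof.
by apply: continuous_lipschitz1 => a b; have := Re_le_normc (a - b); rewrite !ReImE.
Qed.

Lemma continuous_Im : continuous Im.
Proof.
by apply: continuous_lipschitz1 => a b; have := Im_le_normc (a - b); rewrite !ReImE.
Qed.

Lemma normc_dist (a b : C) : `|normc a - normc b| <= normc (a - b).
Proof.
rewrite ler_norml; have := normc_le_add (a - b) b; rewrite subrK => ?.
have := normc_le_add (b - a) a; rewrite subrK normcB => ?.
by apply/andP; split; lra.
Qed.

Lemma continuous_normc : continuous (@normc R).
Proof. exact: continuous_lipschitz1 normc_dist. Qed.

Section Composition.
Context (T : Type) (F : set_system T) (FF : Filter F).
Implicit Types (u : T -> C) (f : C -> C) (z : C).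

Lemma cvg_ccont u f z : ccont f z -> u @ F --> z -> (fun x => f (u x)) @ F --> f z.
Proof. by move=> /ccontP cf uz; exact: (cvg_comp _ _ uz cf). Qed.

Lemma cvg_Re u z : u @ F --> z -> (fun x => Re (u x)) @ F --> Re z.
Proof. by move=> uz; exact: (cvg_comp _ _ uz (@continuous_Re z)). Qed.

Lemma cvg_Im u z : u @ F --> z -> (fun x => Im (u x)) @ F --> Im z.
Proof. by move=> uz; exact: (cvg_comp _ _ uz (@continuous_Im z)). Qed.

Lemma cvg_normc u z : u @ F --> z -> (fun x => normc (u x)) @ F --> normc z.
Proof. by move=> uz; exact: (cvg_comp _ _ uz (@continuous_normc z)). Qed.

End Composition.

Lemma continuous_box (A : set (R * R)) (h : R * R -> R) :
  (forall p, A p -> {for p, continuous h}) -> box_continuous A h.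
Proof.
move=> ch p Ap e e0; have /cvgrPdist_lt/(_ _ e0)/nbhs_ballP[d /= d0 H] := ch _ Ap.
exists d => // q q1 q2; rewrite distrC; apply: H.
by split; rewrite /= /ball/= distrC.
Qed.

End Continuity.

Section StripShift.
Variable R : realType.
Local Notation C := R[i].
Local Notation mu := (@lebesgue_measure R).
Local Notation Re := (@complex.Re R).
Local Notation Im := (@complex.Im R).
Implicit Types (G : C -> C) (z w : C).

Lemma Rintegral_itv_cvg (g : R -> R) (x y : nat -> R) :
  mu.-integrable setT (EFin \o g) ->
  (forall n, n%:R <= x n) -> (forall n, y n <= - n%:R) ->
  (\int[mu]_(t in `[y n, x n]) g t)%R @[n --> \oo] --> (\int[mu]_t g t)%R.
Proof.
move=> ig xn yn.
have [mg _] := integrableP _ _ _ ig.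
pose gn n := (EFin \o g) \_ `[y n, x n].
have mgn n : measurable_fun setT (gn n).
  by apply/(measurable_restrictT _ (measurable_itv _)); exact: measurable_funTS.
have cgn : {ae mu, forall t, setT t -> gn ^~ t @ \oo --> (EFin \o g) t}.
  apply: aeW => t _; apply: cvg_near_cst.
  have [N tN] : exists N : nat, `|t| < N%:R.
    by exists (Num.bound t); exact: unstable.ltr_norm_bound.
  exists N => // n /= Nn; rewrite /gn patchE mem_set//= in_itv/=.
  have : (N%:R : R) <= n%:R by rewrite ler_nat.
  by have := xn n; have := yn n; move: tN; rewrite ltr_norml; lra.
have ign := integrable_abse ig.
have dgn : {ae mu, forall t n, setT t -> (`|gn n t| <= `|(EFin \o g) t|)%E}.
  by apply: aeW => t n _; rewrite /gn patchE; case: ifP => _ //=; rewrite normr0 lee_fin.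
have [_ _ H] := @dominated_convergence _ _ R mu setT measurableT
  gn _ _ mgn mg cgn ign dgn.
have -> : (fun n => (\int[mu]_(t in `[y n, x n]) g t)%R) =
    fine \o (fun n => (\int[mu]_t gn n t)%E).
  by apply/funext => n; rewrite /Rintegral /= [in LHS]integral_mkcond.
apply: fine_cvg; rewrite fineK//.
by apply: integrable_fin_num.
Qed.

Lemma horizontalE (x y : R) : x +i* y = 0 +i* y + 1 * x%:C :> C.
Proof. by apply: complexeqP; rewrite !ReImE /=; ring. Qed.

Lemma verticalE (x y : R) : x +i* y = x%:C + 'i * y%:C :> C.
Proof. by apply: complexeqP; rewrite !ReImE /=; ring. Qed.

Lemma continuous_at_horizontal G (x y : R) : ccont G (x +i* y) ->
  G (t +i* y) @[t --> x] --> G (x +i* y).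
Proof. by move=> cG; apply: cvg_ccont cG _; apply: cvg_complex; [|exact: cvg_cst]. Qed.

Lemma continuous_at_vertical G (x y : R) : ccont G (x +i* y) ->
  G (x +i* t) @[t --> y] --> G (x +i* y).
Proof. by move=> cG; apply: cvg_ccont cG _; apply: cvg_complex; [exact: cvg_cst|]. Qed.

(** Cauchy's theorem for the rectangle with corners [X + i eta] and
    [- Y + i H], in terms of a primitive of [G]; by Tonelli's theorem the
    integral of [|G|] over the whole strip is finite, so that [X] and [Y] can
    be chosen to make the vertical sides as small as desired. *)
Lemma strip_shift G (c d eta H M : R) :
  (forall z, strip c d z -> exists l, cderiv G z l) ->
  c < eta -> eta <= H -> H < d ->
  (forall s : R, eta <= s <= H -> (\int[mu]_x (normc (G (x +i* s)))%:E <= M%:E)%E) ->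
  (\int[mu]_x Re (G (x +i* eta)) = \int[mu]_x Re (G (x +i* H)))%R.
Proof.
move=> dG ceta etaH Hd GM.
have cG z : strip c d z -> ccont G z by move=> /dG[l]; exact: cderiv_ccont.
have sE (x s : R) : eta <= s <= H -> strip c d (x +i* s).
  by move=> ?; rewrite /strip/=; lra.
have M0 : 0 <= M.
  rewrite -lee_fin; apply: le_trans (GM eta _); last by rewrite lexx.
  by apply: integral_ge0 => x _; rewrite lee_fin normc_ge0.
have mG s : eta <= s <= H -> measurable_fun setT (fun x : R => normc (G (x +i* s))).
  move=> sH; apply: continuous_measurable_fun => x.
  by apply: cvg_normc; apply: continuous_at_horizontal; apply/cG/sE.
have iG s : eta <= s <= H -> mu.-integrable setT (fun x => (Re (G (x +i* s)))%:E).
  move=> sH; apply: (@le_integrable _ _ _ mu setT measurableT _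
      (fun x => (normc (G (x +i* s)))%:E)) => //.
  - apply/measurable_EFinP; apply: continuous_measurable_fun => x.
    by apply: cvg_Re; apply: continuous_at_horizontal; apply/cG/sE.
  - by move=> x _ /=; rewrite lee_fin (ger0_norm (normc_ge0 _)) Re_le_normc.
  - apply/integrableP; split; first by apply/measurable_EFinP; exact: mG.
    apply: le_lt_trans (le_lt_trans (GM _ sH) (ltry _)).
    apply: ge0_le_integral => //.
    + by apply: measurableT_comp => //; apply/measurable_EFinP; exact: mG.
    + by apply/measurable_EFinP; exact: mG.
    + by move=> x _; rewrite /= lee_fin (ger0_norm (normc_ge0 _)).
pose V x := (\int[mu]_(s in `[eta, H]) (normc (G (x +i* s)))%:E)%E.
pose h (p : R * R) := normc (G (p.1 +i* p.2)).
pose U : set (R * R) := [set p | c < p.2 < d].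
have oU : box_open U.
  move=> p /andP[cp pd]; exists (Num.min (p.2 - c) (d - p.2)).
    by rewrite lt_min !subr_gt0 cp.
  by move=> q _; rewrite lt_min !ltr_norml /U /= => ?; lra.
have ch : box_continuous U h.
  apply: continuous_box => p Up; apply: cvg_normc.
  have cGp : ccont G (p.1 +i* p.2) by exact: cG.
  apply: cvg_ccont cGp _.
  by apply: cvg_complex; [exact: cvg_fst|exact: cvg_snd].
have TU : [set: R] `*` `[eta, H] `<=` U.
  by move=> [x s] [_] /=; rewrite in_itv/= /U/= => ?; lra.
have h0 p : 0 <= h p by exact: normc_ge0.
have mV : measurable_fun setT V.
  exact: (@measurable_integral1 _ U h setT `[eta, H]).
have Voo : (\int[mu]_x V x < +oo)%E.
  have -> : (\int[mu]_x V x = \int[mu]_(s in `[eta, H]) \int[mu]_x (h (x, s))%:E)%E.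
    exact: (@tonelli_box _ U h setT `[eta, H]).
  apply: (@le_lt_trans _ _ (\int[mu]_(s in `[eta, H]) M%:E)%E).
    apply: ge0_le_integral => //.
    - by move=> s _; apply: integral_ge0 => x _; rewrite lee_fin.
    - pose U' : set (R * R) := [set p | U (p.2, p.1)].
      apply: (@measurable_integral1 _ U' (fun p => h (p.2, p.1)) `[eta, H] setT) => //.
      + by move=> [x y] /oU[e e0 He]; exists e => // q q1 q2; exact: He.
      + by move=> [x y] /ch cxy e /cxy[r r0 Hr]; exists r => // q q1 q2; exact: Hr.
      + by move=> [x y] [xH _]; exact: (TU (y, x)).
  rewrite integral_cst//= lebesgue_measure_itv/=.
  by case: ifP => _; rewrite ?mule0 -?EFinB -?EFinM ?ltry.
have V0 x : (0 <= V x)%E.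
  by apply: integral_ge0 => s _; rewrite lee_fin normc_ge0.
have en (n : nat) : 0 < n.+1%:R^-1 :> R by rewrite invr_gt0.
have /choice[X XP] (n : nat) : exists x : R, n%:R <= x /\ (V x < n.+1%:R^-1%:E)%E.
  by have [[x]] := integrable_small_far n%:R mV V0 Voo (en n); exists x.
have /choice[Y YP] (n : nat) : exists x : R, x <= - n%:R /\ (V x < n.+1%:R^-1%:E)%E.
  by have [_ [x]] := integrable_small_far (- n%:R) mV V0 Voo (en n); exists x.
pose z0 : C := 0 +i* eta.
have sz0 : strip c d z0 by apply: sE; rewrite lexx.
pose P := segment_integral G z0.
have dP z : strip c d z -> cderiv P z (G z) by exact: cderiv_segment_integral.
have hor s x y : eta <= s <= H -> y <= x ->
    (\int[mu]_(t in `[y, x]) Re (G (t +i* s)))%R = Re (P (x +i* s)) - Re (P (y +i* s)).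
  move=> sH yx; apply: (@Rintegral_derivative _ _ _ (fun t : R => Re (P (t +i* s)))) => //.
    move=> t _; under eq_fun do rewrite horizontalE.
    rewrite -[G _]mulr1; apply: is_derive_Re_line.
    by rewrite -horizontalE; apply/dP/sE.
  by move=> t _; apply: cvg_Re; apply: continuous_at_horizontal; apply/cG/sE.
have ver x e : (V x < e%:E)%E -> `|Re (P (x +i* H)) - Re (P (x +i* eta))| < e.
  move=> Ve.
  have c1 : continuous_on eta H (fun s => Re (G (x +i* s) * 'i)).
    move=> s sH; apply: cvg_Re; apply: (@continuous_at_vertical (fun z => G z * 'i)).
    by apply/ccontMr/cG/sE.
  have c2 : continuous_on eta H (fun s => normc (G (x +i* s))).
    by move=> s sH; apply: cvg_normc; apply: continuous_at_vertical; apply/cG/sE.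
  have <- : (\int[mu]_(s in `[eta, H]) Re (G (x +i* s) * 'i))%R =
      Re (P (x +i* H)) - Re (P (x +i* eta)).
    apply: (@Rintegral_derivative _ _ _ (fun s : R => Re (P (x +i* s)))) => //.
    move=> s sH; under eq_fun do rewrite verticalE.
    apply: is_derive_Re_line.
    by rewrite -verticalE; apply/dP/sE.
  have i1 := continuous_on_integrable c1; have i2 := continuous_on_integrable c2.
  apply: (le_lt_trans (le_normr_Rintegral _ i1)) => //.
  apply: (@le_lt_trans _ _ (\int[mu]_(s in `[eta, H]) normc (G (x +i* s)))%R).
    apply: le_Rintegral => //.
      by apply: continuous_on_integrable => s sH; apply: cvg_norm; exact: c1.
    move=> s _; apply: (le_trans (Re_le_normc _)).
    by rewrite normcM /= expr0n expr1n add0r sqrtr1 mulr1.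
  rewrite -lte_fin; apply: le_lt_trans Ve.
  by rewrite /Rintegral fineK// integrable_fin_num.
have eta_in : eta <= eta <= H by rewrite lexx.
have H_in : eta <= H <= H by rewrite lexx andbT.
have XY n : Y n <= X n.
  have [h1 _] := XP n; have [h2 _] := YP n; apply: (le_trans h2); apply: le_trans h1.
  by rewrite -subr_ge0 opprK addr_ge0.
have close n : `|(\int[mu]_(t in `[Y n, X n]) Re (G (t +i* eta)))%R -
    (\int[mu]_(t in `[Y n, X n]) Re (G (t +i* H)))%R| <= 2 * n.+1%:R^-1.
  rewrite !hor//; have [_ /ver h1] := XP n; have [_ /ver h2] := YP n.
  move: h1 h2; move: (n.+1%:R^-1) => e.
  by rewrite !ltr_norml ler_norml => /andP[? ?] /andP[? ?]; apply/andP; split; lra.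
have l1 := @Rintegral_itv_cvg _ X Y (iG _ eta_in) (fun n => (XP n).1) (fun n => (YP n).1).
have l2 := @Rintegral_itv_cvg _ X Y (iG _ H_in) (fun n => (XP n).1) (fun n => (YP n).1).
pose D n := (\int[mu]_(t in `[Y n, X n]) Re (G (t +i* eta)))%R -
    (\int[mu]_(t in `[Y n, X n]) Re (G (t +i* H)))%R : R.
have l3 : D @ \oo --> (\int[mu]_x Re (G (x +i* eta)))%R -
    (\int[mu]_x Re (G (x +i* H)))%R by exact: cvgB l1 l2.
apply/eqP; rewrite -subr_eq0; apply/eqP.
have l4 : (2 * n.+1%:R^-1 : R) @[n --> \oo] --> (0 : R).
  by rewrite -[X in _ --> X](mulr0 2); apply: cvgM; [exact: cvg_cst|exact: cvg_harmonic].
rewrite -(cvg_lim (@Rhausdorff R) l3); apply/cvg_lim => //.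
apply/cvgr0Pnorm_lt => e e0; near=> n.
apply: (le_lt_trans (close n)); apply: (le_lt_trans (ler_norm _)).
by near: n; move/cvgr0Pnorm_lt : l4; apply.
Unshelve. all: by end_near. Qed.

End StripShift.

(** * Square-integrable functions on the line *)

Section L2.
Variable R : realType.
Local Notation mu := (@lebesgue_measure R).
Implicit Types (u v w : R -> R) (k : R).

Definition L2 u := measurable_fun setT u /\
  (\int[mu]_x (u x ^+ 2)%:E < +oo)%E.

Definition ip u v : R := (\int[mu]_x (u x * v x))%R.

Lemma L2_measurable u : L2 u -> measurable_fun setT u. Proof. by case. Qed.

Lemma L2_sqr_integrable u : L2 u -> mu.-integrable setT (fun x => (u x ^+ 2)%:E).
Proof.
move=> [mf uoo]; apply/integrableP; split.
  by apply/measurable_EFinP; exact: measurable_funX.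
by under eq_integral do rewrite /= (ger0_norm (sqr_ge0 _)).
Qed.

Lemma L2_mul_integrable u v : L2 u -> L2 v ->
  mu.-integrable setT (fun x => (u x * v x)%:E).
Proof.
move=> Lu Lv; have iu := L2_sqr_integrable Lu; have iv := L2_sqr_integrable Lv.
apply: (@le_integrable _ _ _ mu setT measurableT _
  (fun x => (u x ^+ 2)%:E + (v x ^+ 2)%:E)%E).
- by apply/measurable_EFinP; apply: measurable_funM; apply: L2_measurable.
- move=> x _ /=; rewrite lee_fin [leRHS]ger0_norm ?addr_ge0 ?sqr_ge0// ler_norml.
  have := sqr_ge0 (u x - v x); have := sqr_ge0 (u x + v x).
  by have := sqr_ge0 (u x); have := sqr_ge0 (v x) => *; apply/andP; split; nra.
- exact: integrableD.
Qed.

Lemma L2_le u (g : R -> R) (M : R) : measurable_fun setT u ->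
  measurable_fun setT g ->
  (forall x, u x ^+ 2 <= g x) -> (\int[mu]_x (g x)%:E <= M%:E)%E -> L2 u.
Proof.
move=> mf mg ug gM; split=> //; apply: le_lt_trans (le_lt_trans gM (ltry _)).
apply: ge0_le_integral => //.
- by move=> x _; rewrite lee_fin sqr_ge0.
- by apply/measurable_EFinP; exact: measurable_funX.
- exact/measurable_EFinP.
- by move=> x _; rewrite lee_fin.
Qed.

Lemma L2Z k u : L2 u -> L2 (fun x => k * u x).
Proof.
move=> Lu; split; first exact: measurable_funM (measurable_cst _) Lu.1.
have := integrableZl measurableT (k ^+ 2) (L2_sqr_integrable Lu).
move=> /integrableP[_]; apply: le_lt_trans; apply: ge0_le_integral => //.
- by move=> x _; rewrite lee_fin sqr_ge0.
- by apply/measurable_EFinP; apply: measurable_funX; apply: measurable_funM => //; exact: Lu.1.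
- by apply/measurableT_comp => //; apply: measurable_funeM; apply/measurable_EFinP; apply: measurable_funX; exact: Lu.1.
- by move=> x _ /=; rewrite lee_fin -exprMn ger0_norm ?sqr_ge0.
Qed.

Lemma L2D u v : L2 u -> L2 v -> L2 (fun x => u x + v x).
Proof.
move=> Lu Lv; split; first exact: measurable_funD Lu.1 Lv.1.
have iu := L2_sqr_integrable (L2Z 2 Lu); have iv := L2_sqr_integrable (L2Z 2 Lv).
have /integrableP[mo] := integrableD measurableT iu iv.
apply: le_lt_trans; apply: ge0_le_integral => //.
- by move=> x _; rewrite lee_fin sqr_ge0.
- by apply/measurable_EFinP; apply: measurable_funX; exact: measurable_funD Lu.1 Lv.1.
- by apply/measurableT_comp.
- move=> x _ /=; rewrite lee_fin ger0_norm ?addr_ge0 ?sqr_ge0//.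
  by have := sqr_ge0 (u x - v x); nra.
Qed.

Lemma L2B u v : L2 u -> L2 v -> L2 (fun x => u x - v x).
Proof.
move=> Lu Lv; have := L2D Lu (L2Z (-1) Lv).
by under eq_fun do rewrite mulN1r.
Qed.

Lemma ipC u v : ip u v = ip v u.
Proof. by apply: eq_Rintegral => x _; rewrite mulrC. Qed.

Lemma ipDl u v w : L2 u -> L2 v -> L2 w ->
  ip (fun x => u x + v x) w = ip u w + ip v w.
Proof.
move=> Lu Lv Lw; rewrite /ip -RintegralD//; try exact: L2_mul_integrable.
by apply: eq_Rintegral => x _; rewrite mulrDl.
Qed.

Lemma ipZl k u v : L2 u -> L2 v -> ip (fun x => k * u x) v = k * ip u v.
Proof.
move=> Lu Lv; rewrite /ip -RintegralZl//; try exact: L2_mul_integrable.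
by apply: eq_Rintegral => x _; rewrite mulrA.
Qed.

Lemma ipBl u v w : L2 u -> L2 v -> L2 w ->
  ip (fun x => u x - v x) w = ip u w - ip v w.
Proof.
move=> Lu Lv Lw; rewrite -mulN1r -ipZl// -ipDl//; last exact: L2Z.
by under [in RHS]eq_fun do rewrite mulN1r.
Qed.

Lemma ipDr u v w : L2 u -> L2 v -> L2 w ->
  ip w (fun x => u x + v x) = ip w u + ip w v.
Proof. by move=> *; rewrite ipC ipDl// !(ipC w). Qed.

Lemma ipBr u v w : L2 u -> L2 v -> L2 w ->
  ip w (fun x => u x - v x) = ip w u - ip w v.
Proof. by move=> *; rewrite ipC ipBl// !(ipC w). Qed.

Lemma ip_ge0 u : 0 <= ip u u.
Proof. by apply: Rintegral_ge0 => x _; rewrite -expr2 sqr_ge0. Qed.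

Lemma ip_sqrE u : L2 u -> (\int[mu]_x (u x ^+ 2)%:E)%E = (ip u u)%:E.
Proof.
move=> Lu; rewrite /ip /Rintegral fineK//.
by apply: integrable_fin_num => //; exact: L2_mul_integrable.
Qed.

Lemma ip_le u (M : R) : (\int[mu]_x (u x ^+ 2)%:E <= M%:E)%E -> ip u u <= M.
Proof.
move=> uM; have u0 : (0 <= \int[mu]_x (u x ^+ 2)%:E)%E.
  by apply: integral_ge0 => x _; rewrite lee_fin sqr_ge0.
rewrite -lee_fin /ip /Rintegral fineK// ge0_fin_numE//.
exact: le_lt_trans uM (ltry _).
Qed.

Lemma ipB_sqr u v : L2 u -> L2 v ->
  ip (fun x => u x - v x) (fun x => u x - v x) = ip u u + ip v v - 2 * ip u v.
Proof.
by move=> Lu Lv; rewrite ipBl ?ipBr// ?(ipC v u); [ring|exact: L2B].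
Qed.

Lemma ip_CS u v : L2 u -> L2 v -> (ip u v) ^+ 2 <= ip u u * ip v v.
Proof.
move=> Lu Lv.
have H k : 0 <= ip u u - 2 * k * ip u v + k ^+ 2 * ip v v.
  have := ip_ge0 (fun x => u x - k * v x).
  have Lkv := L2Z k Lv; rewrite ipB_sqr// (ipC u (fun x => k * v x)) !ipZl//.
  by rewrite (ipC v (fun x => k * v x)) ipZl// (ipC v u); lra.
have [v0|v0] := eqVneq (ip v v) 0.
  rewrite v0 mulr0; have [->|uv0] := eqVneq (ip u v) 0; first by rewrite expr0n.
  have := H ((ip u u + 1) / (2 * ip u v)); rewrite v0 mulr0 addr0.
  have -> : 2 * ((ip u u + 1) / (2 * ip u v)) * ip u v = ip u u + 1 by field.
  lra.
have vp : 0 < ip v v by rewrite lt_neqAle eq_sym v0 ip_ge0.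
have := H (ip u v / ip v v).
have -> : ip u u - 2 * (ip u v / ip v v) * ip u v + (ip u v / ip v v) ^+ 2 * ip v v =
  ip u u - (ip u v) ^+ 2 / ip v v by field.
by rewrite subr_ge0 ler_pdivrMr.
Qed.

Lemma ip_ineq u v (a : R) : 0 < a -> L2 u -> L2 v ->
  `|ip u v| <= (a * ip u u + a^-1 * ip v v) / 2.
Proof.
move=> a0 Lu Lv; have := ip_CS Lu Lv; have := ip_ge0 u; have := ip_ge0 v.
move: (ip u u) (ip v v) (ip u v) => A B I B0 A0 AB.
rewrite -(@ler_pXn2r _ 2) ?nnegrE//; last by rewrite divr_ge0// addr_ge0// mulr_ge0// ?invr_ge0 ltW.
rewrite -normrX ger0_norm ?sqr_ge0//; apply: (le_trans AB).
have -> : A * B = (a * A) * (a^-1 * B) by field; rewrite gt_eqF.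
by have := sqr_ge0 (a * A - a^-1 * B); nra.
Qed.

(** In a Hilbert space, convergence of one argument in norm passes to the inner
    product. *)
Lemma ip_cvg (u : nat -> R -> R) phi v : (forall n, L2 (u n)) -> L2 phi -> L2 v ->
  ip (fun x => u n x - phi x) (fun x => u n x - phi x) @[n --> \oo] --> (0 : R) ->
  ip (u n) v @[n --> \oo] --> ip phi v.
Proof.
move=> Lu Lphi Lv h; apply/cvgrPdist_lt => e e0.
have v1 : 0 < 1 + ip v v by have := ip_ge0 v; lra.
pose d := e ^+ 2 / (1 + ip v v).
have d0 : 0 < d by rewrite divr_gt0// exprn_gt0.
move/cvgr0Pnorm_lt : h => /(_ _ d0); apply: filterS => n.
rewrite ger0_norm ?ip_ge0// => hn.
rewrite distrC -ipBl// -(@ltr_pXn2r _ 2) ?nnegrE ?(ltW e0)//.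
rewrite -normrX ger0_norm ?sqr_ge0//; apply: (le_lt_trans (ip_CS (L2B (Lu n) Lphi) Lv)).
move: hn; rewrite /d ltr_pdivlMr//; apply: le_lt_trans.
by rewrite ler_wpM2l ?ip_ge0//; lra.
Qed.

End L2.

(** * The Poisson kernel *)

Section PoissonKernel.
Variable R : realType.
Local Notation mu := (@lebesgue_measure R).

Lemma integral_affineT (k c : R) (g : R -> R) : 0 < k -> continuous g ->
  (forall x, 0 <= g x) ->
  (\int[mu]_x (g x)%:E = k%:E * \int[mu]_x (g (c + k * x))%:E)%E.
Proof.
move=> k0 cg g0; pose F (t : R) := c + k * t.
have dF (t : R) : is_derive t 1 F k.
  apply: is_derive_eps => e e0; exists 1 => // h _; rewrite /F.
  rewrite (_ : _ - _ = 0) ?normr0 ?mulr_ge0 ?(ltW e0)//; ring.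
have dF1 : derive1 F = cst k.
  by apply/funext => t; rewrite derive1E; have [_ ->] := dF t.
have cF : continuous F by move=> t; exact: is_derive_continuous (dF t).
rewrite (@increasing_ge0_integration_by_substitutionT R F g)//.
- rewrite dF1 -ge0_integralZl//.
  + by apply: eq_integral => x _; rewrite -EFinM /= !fctE mulrC.
  + apply/measurable_EFinP; apply: measurableT_comp.
      exact: continuous_measurable_fun.
    exact: continuous_measurable_fun.
  + by move=> x _; rewrite lee_fin.
  + by rewrite lee_fin ltW.
- by move=> x y xy; rewrite /F ltrD2l ltr_pM2l.
- by rewrite dF1; exact: cst_continuous.
- by rewrite dF1; exact: is_cvg_cst.
- by rewrite dF1; exact: is_cvg_cst.
- apply/cvgrNyPle => A; near=> x.
  have : x <= (A - c) / k by near: x; apply: nbhs_ninfty_le; exact: num_real.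
  by rewrite ler_pdivlMr// mulrC /F; lra.
- apply/cvgryPge => A; near=> x.
  have : (A - c) / k <= x by near: x; apply: nbhs_pinfty_ge; exact: num_real.
  by rewrite ler_pdivrMr// mulrC /F; lra.
Unshelve. all: by end_near. Qed.

Definition poisson (y x t : R) : R := y / ((t - x) ^+ 2 + y ^+ 2).

Lemma poisson_den (y x t : R) : 0 < y -> 0 < (t - x) ^+ 2 + y ^+ 2.
Proof. by move=> y0; rewrite ltr_wpDl ?sqr_ge0// exprn_gt0. Qed.

Lemma poisson_ge0 (y x t : R) : 0 < y -> 0 <= poisson y x t.
Proof. by move=> y0; rewrite divr_ge0 ?ltW// poisson_den. Qed.

Lemma continuous_poisson (y x : R) : 0 < y -> continuous (poisson y x).
Proof.
move=> y0 t; apply: cvgM; first exact: cvg_cst.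
apply: cvgV; first by rewrite gt_eqF// poisson_den.
apply: cvgD; last exact: cvg_cst.
have h : {for t, continuous (fun s : R => s - x)}.
  by apply: cvgB; [exact: cvg_id|exact: cvg_cst].
exact: (cvgM h h).
Qed.

Lemma integral_poisson (y x : R) : 0 < y ->
  (\int[mu]_t (poisson y x t)%:E = (pi : R)%:E)%E.
Proof.
move=> y0; pose g (t : R) := (oneDsqr t)^-1.
have g0 t : 0 <= g t by rewrite invr_ge0 /oneDsqr addr_ge0 ?sqr_ge0.
have cg : continuous g by exact: continuous_oneDsqrV.
have <- : (\int[mu]_t (g t)%:E = (pi : R)%:E)%E.
  rewrite ge0_symfun_integralT//; last by move=> t; rewrite /g /oneDsqr /= sqrrN.
  rewrite -set_itvcy integral0y_oneDsqr -EFinM; congr EFin.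
  by rewrite mulrC divfK.
have yV : 0 < y^-1 by rewrite invr_gt0.
rewrite (@integral_affineT y^-1 (- x / y) g yV cg g0) -ge0_integralZl//; first last.
- by rewrite lee_fin ltW.
- by move=> t _; rewrite lee_fin.
- apply/measurable_EFinP; apply: measurableT_comp; first exact: continuous_measurable_fun.
  by apply: measurable_funD => //; apply: measurable_funM.
apply: eq_integral => t _; rewrite -EFinM; congr EFin.
have y0' : y != 0 by rewrite gt_eqF.
have := poisson_den x t y0; rewrite /poisson /g /oneDsqr => d0.
have -> : 1 + (- x / y + y^-1 * t) ^+ 2 = ((t - x) ^+ 2 + y ^+ 2) / y ^+ 2 by field.
by rewrite invf_div; field; rewrite y0' gt_eqF.
Qed.

Lemma poisson_sqr_le (y x t : R) : 0 < y -> poisson y x t ^+ 2 <= y^-1 * poisson y x t.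
Proof.
move=> y0; rewrite expr2 ler_wpM2r ?poisson_ge0// /poisson.
rewrite ler_pdivrMr ?poisson_den// mulrDr -[y ^+ 2]/(y * y) mulKf ?gt_eqF//.
by rewrite lerDr mulr_ge0 ?sqr_ge0// invr_ge0 ltW.
Qed.

Lemma measurable_poisson (y x : R) : 0 < y -> measurable_fun setT (poisson y x).
Proof. by move=> y0; apply: continuous_measurable_fun; exact: continuous_poisson. Qed.

Lemma poisson_integral_sqr (y x : R) : 0 < y ->
  (\int[mu]_t (poisson y x t ^+ 2)%:E <= (pi / y)%:E)%E.
Proof.
move=> y0; have mp := measurable_poisson x y0.
apply: (@le_trans _ _ (\int[mu]_t (y^-1%:E * (poisson y x t)%:E))%E).
  apply: ge0_le_integral => //.
  - by move=> t _; rewrite lee_fin sqr_ge0.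
  - by apply/measurable_EFinP; exact: measurable_funX.
  - by apply: measurable_funeM; exact/measurable_EFinP.
  - by move=> t _; rewrite -EFinM lee_fin poisson_sqr_le.
rewrite ge0_integralZl//.
- by rewrite integral_poisson// -EFinM mulrC.
- exact/measurable_EFinP.
- by move=> t _; rewrite lee_fin poisson_ge0.
- by rewrite lee_fin invr_ge0 ltW.
Qed.

Lemma L2_poisson (y x : R) : 0 < y -> L2 (poisson y x).
Proof.
move=> y0; split; first exact: measurable_poisson.
exact: le_lt_trans (poisson_integral_sqr x y0) (ltry _).
Qed.

Lemma ip_poisson (y x : R) : 0 < y -> ip (poisson y x) (poisson y x) <= pi / y.
Proof. by move=> y0; apply: ip_le; exact: poisson_integral_sqr. Qed.

Lemma integrable_poisson (y x : R) : 0 < y ->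
  mu.-integrable setT (EFin \o poisson y x).
Proof.
move=> y0; apply/integrableP; split; first by apply/measurable_EFinP; exact: measurable_poisson.
under eq_integral do rewrite /= (ger0_norm (poisson_ge0 _ _ y0)).
by rewrite integral_poisson// ltry.
Qed.

End PoissonKernel.

(** * The Poisson representation of a function of the Hardy class *)

Section PoissonRepresentation.
Variable R : realType.
Local Notation C := R[i].
Local Notation mu := (@lebesgue_measure R).
Local Notation Re := (@complex.Re R).
Local Notation Im := (@complex.Im R).
Implicit Types (f : C -> C) (M : R) (z w : C).

Definition hardy f M := (forall z, 0 < Im z -> exists l, cderiv f z l) /\
  (forall y, 0 < y -> (horizontal_energy f y <= M%:E)%E).

Definition rl f (y x : R) : R := Re (f (x +i* y)).
Definition il f (y x : R) : R := Im (f (x +i* y)).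

Definition energy f (y : R) : R := ip (rl f y) (rl f y) + ip (il f y) (il f y).

Lemma hardy_ccont f M z : hardy f M -> 0 < Im z -> ccont f z.
Proof. by move=> [df _] /df[l]; exact: cderiv_ccont. Qed.

Lemma continuous_rl f M y : hardy f M -> 0 < y -> continuous (rl f y).
Proof.
by move=> hf y0 x; apply: cvg_Re; apply: continuous_at_horizontal; exact: hardy_ccont hf _.
Qed.

Lemma continuous_il f M y : hardy f M -> 0 < y -> continuous (il f y).
Proof.
by move=> hf y0 x; apply: cvg_Im; apply: continuous_at_horizontal; exact: hardy_ccont hf _.
Qed.

Lemma continuous_normc_line f M y : hardy f M -> 0 < y ->
  continuous (fun x : R => normc (f (x +i* y))).
Proof.
by move=> hf y0 x; apply: cvg_normc; apply: continuous_at_horizontal; exact: hardy_ccont hf _.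
Qed.

Lemma measurable_energy_density f M y : hardy f M -> 0 < y ->
  measurable_fun setT (fun x : R => normc (f (x +i* y)) ^+ 2).
Proof.
move=> hf y0; apply: measurable_funX; apply: continuous_measurable_fun.
exact: continuous_normc_line hf y0.
Qed.

Lemma L2_rl f M y : hardy f M -> 0 < y -> L2 (rl f y).
Proof.
move=> hf y0; apply: (@L2_le _ _ (fun x => normc (f (x +i* y)) ^+ 2) M).
- by apply: continuous_measurable_fun; exact: continuous_rl hf y0.
- exact: measurable_energy_density hf y0.
- by move=> x; rewrite normc_sqr lerDl sqr_ge0.
- exact: hf.2.
Qed.

Lemma L2_il f M y : hardy f M -> 0 < y -> L2 (il f y).
Proof.
move=> hf y0; apply: (@L2_le _ _ (fun x => normc (f (x +i* y)) ^+ 2) M).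
- by apply: continuous_measurable_fun; exact: continuous_il hf y0.
- exact: measurable_energy_density hf y0.
- by move=> x; rewrite normc_sqr lerDr sqr_ge0.
- exact: hf.2.
Qed.

Lemma energyE f M y : hardy f M -> 0 < y ->
  horizontal_energy f y = (energy f y)%:E.
Proof.
move=> hf y0; have Lr := L2_rl hf y0; have Li := L2_il hf y0.
rewrite /energy EFinD -!ip_sqrE// -ge0_integralD//.
- by apply: eq_integral => x _; rewrite normc_sqr EFinD.
- by move=> x _; rewrite lee_fin sqr_ge0.
- by apply/measurable_EFinP; apply: measurable_funX; exact: Lr.1.
- by move=> x _; rewrite lee_fin sqr_ge0.
- by apply/measurable_EFinP; apply: measurable_funX; exact: Li.1.
Qed.

Lemma energy_le f M y : hardy f M -> 0 < y -> energy f y <= M.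
Proof. by move=> hf y0; rewrite -lee_fin -(energyE hf y0); exact: hf.2. Qed.

Lemma hardy_ge0 f M : hardy f M -> 0 <= M.
Proof.
move=> hf; apply: le_trans (energy_le hf (@ltr01 R)).
by rewrite addr_ge0 ?ip_ge0.
Qed.

Lemma ip_rl_le f M y : hardy f M -> 0 < y -> ip (rl f y) (rl f y) <= M.
Proof.
by move=> hf y0; apply: le_trans (energy_le hf y0); rewrite lerDl ip_ge0.
Qed.

Lemma ip_il_le f M y : hardy f M -> 0 < y -> ip (il f y) (il f y) <= M.
Proof.
by move=> hf y0; apply: le_trans (energy_le hf y0); rewrite lerDr ip_ge0.
Qed.

Lemma hardy_mulNi f M : hardy f M -> hardy (fun w => - 'i * f w) M.
Proof.
move=> [df Ef]; split=> [z /df[l dl]|y /Ef]; first by exists (- 'i * l); exact: cderivZ.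
congr (_ <= _)%E; apply: eq_integral => x _.
by rewrite normcM normcN /= expr0n expr1n add0r sqrtr1 mul1r.
Qed.

Lemma rl_mulNi f y x : rl (fun w => - 'i * f w) y x = il f y x.
Proof. by rewrite /rl /il !ReImE /=; ring. Qed.

Lemma il_mulNi f y x : il (fun w => - 'i * f w) y x = - rl f y x.
Proof. by rewrite /rl /il !ReImE /=; ring. Qed.

Definition conj_poisson (y x t : R) : R := (t - x) / ((t - x) ^+ 2 + y ^+ 2).

Lemma conj_poisson_sqr_le (y x t : R) : 0 < y ->
  conj_poisson y x t ^+ 2 <= y^-1 * poisson y x t.
Proof.
move=> y0; have d0 := poisson_den x t y0.
rewrite /conj_poisson /poisson mulrA mulVf ?gt_eqF// exprMn exprVn mul1r.
rewrite ler_pdivrMr ?exprn_gt0// -[_ ^+ 2 in leRHS]/(_ * _) mulrA mulVf ?gt_eqF// mul1r.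
by rewrite lerDl sqr_ge0.
Qed.

Lemma L2_conj_poisson (y x : R) : 0 < y ->
  (\int[mu]_t (conj_poisson y x t ^+ 2)%:E <= (pi / y)%:E)%E /\ L2 (conj_poisson y x).
Proof.
move=> y0; have mp := measurable_poisson x y0.
have mc : measurable_fun setT (conj_poisson y x).
  apply: continuous_measurable_fun => t; apply: cvgM.
    by apply: cvgB; [exact: cvg_id|exact: cvg_cst].
  apply: cvgV; first by rewrite gt_eqF// poisson_den.
  apply: cvgD; last exact: cvg_cst.
  have h : {for t, continuous (fun s : R => s - x)}.
    by apply: cvgB; [exact: cvg_id|exact: cvg_cst].
  exact: (cvgM h h).
have le : (\int[mu]_t (y^-1%:E * (poisson y x t)%:E) <= (pi / y)%:E)%E.
  rewrite ge0_integralZl//.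
  - by rewrite integral_poisson// -EFinM mulrC.
  - exact/measurable_EFinP.
  - by move=> t _; rewrite lee_fin poisson_ge0.
  - by rewrite lee_fin invr_ge0 ltW.
split.
  apply: le_trans le; apply: ge0_le_integral => //.
  - by move=> t _; rewrite lee_fin sqr_ge0.
  - by apply/measurable_EFinP; exact: measurable_funX.
  - by apply: measurable_funeM; exact/measurable_EFinP.
  - by move=> t _; rewrite -EFinM lee_fin conj_poisson_sqr_le.
apply: (@L2_le _ _ (fun t => y^-1 * poisson y x t) (pi / y)) => //.
- exact: measurable_funM.
- by move=> t; exact: conj_poisson_sqr_le.
Qed.

Lemma ip_conj_poisson (y x : R) : 0 < y ->
  ip (conj_poisson y x) (conj_poisson y x) <= pi / y.
Proof. by move=> /(L2_conj_poisson x)[le _]; exact: ip_le. Qed.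

(** The Cauchy integrals of [f] over the line at height [eta], for a pole at
    distance [b] below and above the line. *)
Definition below f (eta b a : R) :=
  ip (rl f eta) (conj_poisson b a) + ip (il f eta) (poisson b a).
Definition above f (eta b a : R) :=
  ip (rl f eta) (conj_poisson b a) - ip (il f eta) (poisson b a).

Lemma cauchy_kernel_line f (eta b a x : R) : b != 0 ->
  Re (f (x +i* eta) * (x +i* eta - (a +i* (eta - b)))^-1) =
  rl f eta x * conj_poisson b a x + il f eta x * poisson b a x.
Proof.
move=> b0; have -> : x +i* eta - (a +i* (eta - b)) = (x - a) +i* b.
  by apply: complexeqP => /=; ring.
by rewrite /rl /il /conj_poisson /poisson; case: (f _) => u v /=; ring.
Qed.

Lemma belowE f M (eta b a : R) : hardy f M -> 0 < eta -> 0 < b ->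
  (\int[mu]_x Re (f (x +i* eta) * (x +i* eta - (a +i* (eta - b)))^-1))%R =
  below f eta b a.
Proof.
move=> hf eta0 b0; have [_ Lc] := L2_conj_poisson a b0.
rewrite /below /ip -RintegralD//.
- by apply: eq_Rintegral => x _; rewrite cauchy_kernel_line ?gt_eqF.
- by apply: L2_mul_integrable => //; exact: L2_rl hf eta0.
- by apply: L2_mul_integrable; [exact: L2_il hf eta0|exact: L2_poisson].
Qed.

Lemma aboveE f M (eta b a : R) : hardy f M -> 0 < eta -> 0 < b ->
  (\int[mu]_x Re (f (x +i* eta) * (x +i* eta - (a +i* (eta + b)))^-1))%R =
  above f eta b a.
Proof.
move=> hf eta0 b0; have [_ Lc] := L2_conj_poisson a b0.
rewrite /above /ip -RintegralB//.
- apply: eq_Rintegral => x _; have := @cauchy_kernel_line f eta (- b) a x.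
  rewrite opprK oppr_eq0 gt_eqF// => ->//.
  by rewrite /conj_poisson /poisson sqrrN mulNr mulrN.
- by apply: L2_mul_integrable => //; exact: L2_rl hf eta0.
- by apply: L2_mul_integrable; [exact: L2_il hf eta0|exact: L2_poisson].
Qed.

Lemma cauchy_shift f M (p : C) (eta H d : R) : hardy f M -> 0 < eta -> eta <= H ->
  0 < d -> Im p + d <= eta \/ H + d <= Im p ->
  (\int[mu]_x Re (f (x +i* eta) * (x +i* eta - p)^-1) =
   \int[mu]_x Re (f (x +i* H) * (x +i* H - p)^-1))%R.
Proof.
move=> hf eta0 etaH d0 pd.
(* a strip around the two lines that avoids the pole *)
have [c [c' [cc ceta Hc' pc]]] : exists c c' : R, [/\ 0 <= c, c < eta, H < c' &
    Im p <= c \/ c' <= Im p].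
  case: pd => pd.
    exists (Num.max 0 (Im p)), (H + 1); rewrite gt_max !le_max !lexx orbT.
    by split=> //; [apply/andP; split|..]; try lra; left.
  by exists 0, (Im p); split=> //; [lra|right].
apply: (@strip_shift _ (fun w => f w * (w - p)^-1) c c' eta H (M + d^-1 * pi)) => //.
  move=> z /andP[cz zc']; have [l dl] := hf.1 z (le_lt_trans cc cz).
  have zp : z != p by apply: contraTneq isT => zp; move: pc; rewrite -zp; lra.
  by exists (f z * (- (z - p)^-1 ^+ 2) + (z - p)^-1 * l); exact: cderivM dl (cderivV_shift zp).
move=> s /andP[etas sH]; have s0 : 0 < s by exact: lt_le_trans etas.
have mf := measurable_energy_density hf s0.
have mp := measurable_poisson (Re p) d0.
have sp : d ^+ 2 <= (s - Im p) ^+ 2 by case: pd => ?; nra.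
apply: (@le_trans _ _ (\int[mu]_x ((normc (f (x +i* s)) ^+ 2)%:E +
    (d^-1 * poisson d (Re p) x)%:E))%E); last first.
  rewrite ge0_integralD//.
  - rewrite EFinD leeD//; first exact: hf.2.
    under eq_integral do rewrite EFinM.
    rewrite ge0_integralZl//.
    + by rewrite integral_poisson.
    + exact/measurable_EFinP.
    + by move=> t _; rewrite lee_fin poisson_ge0.
    + by rewrite lee_fin invr_ge0 ltW.
  - by move=> x _; rewrite lee_fin sqr_ge0.
  - exact/measurable_EFinP.
  - by move=> x _; rewrite lee_fin mulr_ge0 ?poisson_ge0// invr_ge0 ltW.
  - by apply/measurable_EFinP; exact: measurable_funM.
have pden x : (d^-1 * poisson d (Re p) x) = ((x - Re p) ^+ 2 + d ^+ 2)^-1.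
  by rewrite /poisson mulrA mulVf ?gt_eqF// mul1r.
have nle x : normc (f (x +i* s) * (x +i* s - p)^-1) <=
    normc (f (x +i* s)) ^+ 2 + d^-1 * poisson d (Re p) x.
  rewrite normcM normcV pden.
  have n2 : normc (x +i* s - p) ^+ 2 = (x - Re p) ^+ 2 + (s - Im p) ^+ 2.
    by rewrite normc_sqr !ReImE.
  have h1 : (normc (x +i* s - p))^-1 ^+ 2 <= ((x - Re p) ^+ 2 + d ^+ 2)^-1.
    have d2 := poisson_den (Re p) x d0.
    by rewrite exprVn n2 lef_pV2 ?posrE// ?lerD2l//; lra.
  apply: le_trans (lerD (lexx _) h1).
  set A := normc (f _); set B := _^-1.
  by have := sqr_ge0 (A - B); have := sqr_ge0 A; have := sqr_ge0 B; nra.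
apply: ge0_le_integral => //.
- by move=> x _; rewrite lee_fin normc_ge0.
- apply/measurable_EFinP; apply: continuous_measurable_fun => x.
  apply: cvg_normc; apply: (@continuous_at_horizontal _ (fun w => f w * (w - p)^-1)).
  have [l dl] := hf.1 (x +i* s) s0.
  have zp : x +i* s != p.
    by apply: contraTneq isT => zp; move: pd; rewrite -zp /=; lra.
  exact: cderiv_ccont (cderivM dl (cderivV_shift zp)).
- by apply: emeasurable_funD; apply/measurable_EFinP => //; exact: measurable_funM.
- by move=> x _; rewrite -EFinD lee_fin.
Qed.

(** When the pole is below, the line may be pushed up to infinity, where the
    Cauchy kernel tends to 0 in the mean. *)
Lemma below_eq0 f M (eta b a : R) : hardy f M -> 0 < eta -> 0 < b ->
  below f eta b a = 0.
Proof.
move=> hf eta0 b0; have M0 := hardy_ge0 hf.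
have shift (h : R) : 0 <= h -> below f eta b a = below f (eta + h) (b + h) a.
  move=> h0; rewrite -(belowE _ hf)// -(belowE _ hf); [|lra..].
  have -> : eta + h - (b + h) = eta - b by ring.
  by apply: (@cauchy_shift f M _ _ _ b hf) => //=; [lra|left; lra].
have bound (h k : R) : 0 <= h -> 0 < k ->
    `|below f eta b a| <= k * M + k^-1 * (pi / (b + h)).
  move=> h0 k0; have bh : 0 < b + h by lra.
  have eh : 0 < eta + h by lra.
  rewrite (shift h h0) /below; apply: (le_trans (ler_normD _ _)).
  have [_ Lc] := L2_conj_poisson a bh.
  have I1 := ip_ineq k0 (L2_rl hf eh) Lc.
  have I2 := ip_ineq k0 (L2_il hf eh) (L2_poisson a bh).
  apply: (le_trans (lerD I1 I2)); rewrite -mulrDl addrACA -!mulrDr.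
  have e1 : ip (rl f (eta + h)) (rl f (eta + h)) + ip (il f (eta + h)) (il f (eta + h)) <= M
    by exact: energy_le hf eh.
  have e2 : ip (conj_poisson (b + h) a) (conj_poisson (b + h) a) +
      ip (poisson (b + h) a) (poisson (b + h) a) <= 2 * (pi / (b + h)).
    by rewrite mulr_natl; apply: lerD; [exact: ip_conj_poisson|exact: ip_poisson].
  have kV : 0 < k^-1 by rewrite invr_gt0.
  have := ler_wpM2l (ltW k0) e1; have := ler_wpM2l (ltW kV) e2.
  have : 0 <= k * M by rewrite mulr_ge0// ltW.
  lra.
apply/eqP; rewrite -normr_le0 leNgt; apply/negP => e0.
set e := `|_| in e0 bound.
pose k := e / (2 * (M + 1)).
have M1 : 0 < M + 1 by lra.
have k0 : 0 < k by rewrite divr_gt0// mulr_gt0.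
have pi0 := @pi_gt0 R.
pose h := 2 * pi / (k * e).
have ke : 0 < k * e by rewrite mulr_gt0.
have h0 : 0 < h by rewrite divr_gt0// mulr_gt0.
have := bound h k (ltW h0) k0; apply/negP; rewrite -ltNge.
have kM : k * M < e / 2.
  by rewrite /k invfM mulrA mulrAC ltr_pdivrMr// ltr_pM2l ?divr_gt0//; lra.
have : k^-1 * (pi / (b + h)) <= e / 2; last by lra.
rewrite ler_pdivrMl// ler_pdivrMr; last lra.
have hk : h * (k * (e / 2)) = pi by rewrite /h; field; rewrite !gt_eqF.
have k2 : 0 < k * (e / 2) by rewrite mulr_gt0// divr_gt0.
by rewrite mulrDr [X in _ + X]mulrC hk lerDr mulr_ge0// ltW.
Qed.

Lemma above_below f M (eta b a : R) : hardy f M -> 0 < eta -> 0 < b ->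
  above (fun w => - 'i * f w) eta b a - below (fun w => - 'i * f w) eta b a =
  2 * ip (rl f eta) (poisson b a).
Proof.
move=> hf eta0 b0; rewrite /above /below.
have -> : il (fun w => - 'i * f w) eta = (fun x => -1 * rl f eta x).
  by apply/funext => x; rewrite il_mulNi mulN1r.
rewrite ipZl; [ring|exact: L2_rl hf eta0|exact: L2_poisson].
Qed.

(** The Poisson average of [f], taken at distance [s] below the point
    [x + i y], does not depend on [s]. *)
Lemma poisson_average_cst f M (x y s s' : R) : hardy f M ->
  0 < s -> s <= s' -> s' < y ->
  ip (rl f (y - s)) (poisson s x) = ip (rl f (y - s')) (poisson s' x).
Proof.
move=> hf s0 ss' s'y; have hg := hardy_mulNi hf.
suff : 2 * ip (rl f (y - s)) (poisson s x) = 2 * ip (rl f (y - s')) (poisson s' x) by lra.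
rewrite -!(@above_below f M); try assumption; try lra.
rewrite !(below_eq0 _ hg) ?subr0; try lra.
rewrite -!(aboveE _ hg); try lra.
rewrite !subrK; symmetry.
by apply: (@cauchy_shift _ M _ _ _ s hg) => //=; [lra|lra|right; lra].
Qed.

Lemma Rintegral_Zpoisson (k y x : R) : 0 < y ->
  (\int[mu]_t (k * poisson y x t))%R = k * pi.
Proof.
move=> y0; rewrite (@RintegralZl _ _ _ mu setT (poisson y x) k)//.
  by rewrite /Rintegral integral_poisson.
exact: integrable_poisson.
Qed.

Lemma poisson_far (s d u : R) : 0 < s -> s <= d -> d <= `|u| ->
  s / (u ^+ 2 + s ^+ 2) <= 2 * s / (u ^+ 2 + d ^+ 2).
Proof.
move=> s0 sd du; have d0 : 0 < d by lra.
have u2 : d ^+ 2 <= u ^+ 2.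
  by rewrite -(ger0_norm (sqr_ge0 u)) normrX ler_pXn2r ?nnegrE// ltW.
have h1 : 0 < u ^+ 2 + s ^+ 2 by rewrite ltr_wpDl ?sqr_ge0// exprn_gt0.
have h2 : 0 < u ^+ 2 + d ^+ 2 by rewrite ltr_wpDl ?sqr_ge0// exprn_gt0.
rewrite ler_pdivrMr// mulrAC ler_pdivlMr// [2 * s]mulrC -mulrA ler_wpM2l ?(ltW s0)//.
by have := sqr_ge0 s; lra.
Qed.

(** As [s] tends to 0 the average tends to its value at the point. Away from
    the point the kernel is [O(s)], and there [|f|] is integrable against it by
    the arithmetic-geometric inequality. *)
Lemma poisson_average_limit f M (x y e : R) : hardy f M -> 0 < y -> 0 < e ->
  exists c d : R, [/\ 0 <= c, 0 < d & forall s, 0 < s -> s < d -> s < y ->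
  `|ip (rl f (y - s)) (poisson s x) - pi * rl f y x| <= e * pi + s * c].
Proof.
move=> hf y0 e0; have zy : 0 < Im (x +i* y) by [].
have [d2 d20 Hd] := hardy_ccont hf zy e0.
pose d := d2 / 2; have d0 : 0 < d by rewrite divr_gt0.
pose c := M + (d^-1 * d^-1 + 2 * `|rl f y x|) * (pi / d).
have pi0 := @pi_gt0 R.
have c0 : 0 <= c.
  have dV : 0 < d^-1 by rewrite invr_gt0.
  have dVV := mulr_gt0 dV dV.
  have r0 := normr_ge0 (rl f y x).
  apply: addr_ge0; first exact: hardy_ge0 hf.
  by apply: mulr_ge0; [lra|rewrite divr_ge0// ltW].
exists c, d; split=> // s s0 sd sy; have ys : 0 < y - s by lra.
have Lp := L2_poisson x s0; have Lf := L2_rl hf ys.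
have ip1 : mu.-integrable setT (EFin \o poisson s x) by exact: integrable_poisson.
have i1 := L2_mul_integrable Lf Lp.
have i2 : mu.-integrable setT (fun t => (rl f y x * poisson s x t)%:E).
  exact: (integrableZl measurableT (rl f y x) ip1).
have -> : ip (rl f (y - s)) (poisson s x) - pi * rl f y x =
    (\int[mu]_t ((rl f (y - s) t * poisson s x t) - (rl f y x * poisson s x t)))%R.
  by rewrite RintegralB//; congr (_ - _); rewrite Rintegral_Zpoisson// mulrC.
have i3 : mu.-integrable setT
    (fun t => (rl f (y - s) t * poisson s x t - rl f y x * poisson s x t)%:E).
  exact: (integrableB measurableT i1 i2).
apply: (le_trans (le_normr_Rintegral _ i3)) => //.
have i4 : mu.-integrable setT (fun t => (e * poisson s x t)%:E).
  exact: (integrableZl measurableT e ip1).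
have i5 : mu.-integrable setT (fun t => (s * rl f (y - s) t ^+ 2)%:E).
  exact: (integrableZl measurableT s (L2_sqr_integrable Lf)).
pose k := s * ((d^-1 * d^-1 + 2 * `|rl f y x|) / d).
have i6 : mu.-integrable setT (fun t => (k * poisson d x t)%:E).
  exact: (integrableZl measurableT k (integrable_poisson x d0)).
have i45 : mu.-integrable setT (fun t => (e * poisson s x t + s * rl f (y - s) t ^+ 2)%:E).
  exact: (integrableD measurableT i4 i5).
have i456 : mu.-integrable setT
    (fun t => (e * poisson s x t + s * rl f (y - s) t ^+ 2 + k * poisson d x t)%:E).
  exact: (integrableD measurableT i45 i6).
apply: (@le_trans _ _ (\int[mu]_t
    (e * poisson s x t + s * rl f (y - s) t ^+ 2 + k * poisson d x t))%R); last first.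
  rewrite RintegralD// RintegralD// !Rintegral_Zpoisson//.
  rewrite RintegralZl//; last exact: L2_sqr_integrable.
  have -> : (\int[mu]_t (rl f (y - s) t ^+ 2))%R = ip (rl f (y - s)) (rl f (y - s)).
    by apply: eq_Rintegral => t _; rewrite expr2.
  have := ip_rl_le hf ys; rewrite /c /k => h; have := ler_wpM2l (ltW s0) h.
  have -> : s * ((d^-1 * d^-1 + 2 * `|rl f y x|) / d) * pi =
    s * ((d^-1 * d^-1 + 2 * `|rl f y x|) * (pi / d)) by ring.
  by lra.
apply: le_Rintegral => //; first exact: (integrable_norm i3).
move=> t _; rewrite -mulrBl normrM (ger0_norm (poisson_ge0 x t s0)).
have P0 := poisson_ge0 x t s0; have P1 := poisson_ge0 x t d0.
have dV : 0 < d^-1 by rewrite invr_gt0.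
have dVV := mulr_gt0 dV dV.
have r0 := normr_ge0 (rl f y x).
have k0 : 0 <= k.
  apply: mulr_ge0; first exact: ltW.
  by apply: mulr_ge0; [lra|exact: ltW].
have rest0 : 0 <= s * rl f (y - s) t ^+ 2 + k * poisson d x t.
  apply: addr_ge0; last exact: mulr_ge0.
  by apply: mulr_ge0; [exact: ltW|exact: sqr_ge0].
have [near|far] := ltP `|t - x| d.
  have : `|rl f (y - s) t - rl f y x| <= e.
    have := Re_le_normc (f (t +i* (y - s)) - f (x +i* y)); rewrite !ReImE.
    move/le_trans; apply; apply/ltW/Hd; apply: normc_lt_ReIm; rewrite !ReImE //=.
    by rewrite addrAC subrr add0r normrN gtr0_norm.
  by move=> /(ler_wpM2r P0); lra.
have pf := poisson_far s0 (ltW sd) far; rewrite -/(poisson s x t) in pf.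
have pd : poisson d x t <= d^-1.
  have := poisson_sqr_le x t d0; rewrite expr2.
  have [->|Pn0] := eqVneq (poisson d x t) 0; first by move=> _; exact: ltW.
  by rewrite ler_pM2r// lt_neqAle eq_sym Pn0.
have pE : 2 * s / ((t - x) ^+ 2 + d ^+ 2) = 2 * s * (d^-1 * poisson d x t).
  by rewrite /poisson mulKf// gt_eqF.
rewrite pE in pf.
have eP : 0 <= e * poisson s x t by rewrite mulr_ge0// ltW.
set A := rl f (y - s) t in rest0 *.
set p := poisson d x t in pf pd P1 rest0 *; set q := poisson s x t in pf P0 eP *.
apply: (@le_trans _ _ ((`|A| + `|rl f y x|) * (2 * s * (d^-1 * p)))).
  apply: ler_pM => //; exact: ler_normB.
apply: (@le_trans _ _ (s * A ^+ 2 + k * p)); last lra.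
rewrite /k.
have Asq : A ^+ 2 = `|A| ^+ 2 by rewrite -normrX ger0_norm// sqr_ge0.
have d1p : 0 <= d^-1 * p by rewrite mulr_ge0// ltW.
have key : 2 * `|A| * (d^-1 * p) <= A ^+ 2 + d^-1 * d^-1 * (d^-1 * p).
  have : 2 * `|A| * (d^-1 * p) <= A ^+ 2 + (d^-1 * p) ^+ 2.
    by rewrite Asq; have := sqr_ge0 (`|A| - d^-1 * p); nra.
  move/le_trans; apply; rewrite lerD2l expr2 ler_wpM2r//.
  by rewrite ler_pM2l.
by have := ler_wpM2l (ltW s0) key; lra.
Qed.

(** The Poisson formula for the half-plane above the line at height [eta]. *)
Lemma poisson_formula f M (eta y x : R) : hardy f M -> 0 < eta -> 0 < y ->
  ip (rl f eta) (poisson y x) = pi * rl f (eta + y) x.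
Proof.
move=> hf eta0 y0; have ey : 0 < eta + y by lra.
set I := ip _ _; set V := pi * _.
apply/eqP; rewrite -subr_eq0 -normr_le0 leNgt; apply/negP => D0.
have pi0 := @pi_gt0 R.
pose e := `|I - V| / (4 * pi).
have e0 : 0 < e by rewrite divr_gt0// mulr_gt0.
have [c [d [c0 d0 H]]] := poisson_average_limit x hf ey e0.
pose s := Num.min (Num.min (d / 2) (y / 2)) (`|I - V| / (4 * (c + 1))).
have c1 : 0 < c + 1 by lra.
have s0 : 0 < s by rewrite !lt_min !divr_gt0// mulr_gt0.
have [s1 s2 s3] : [/\ s <= d / 2, s <= y / 2 & s <= `|I - V| / (4 * (c + 1))].
  by split; rewrite /s !ge_min lexx ?orbT.
have sd : s < d by lra.
have sy : s < y by lra.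
have sey : s < eta + y by lra.
have := H s s0 sd sey.
rewrite (@poisson_average_cst f M x (eta + y) s y hf)//; [|lra|lra].
rewrite addrK -/I -/V; apply/negP; rewrite -ltNge.
have ep : e * pi = `|I - V| / 4.
  by rewrite /e invfM mulrA divfK// gt_eqF.
have sc : s * c <= `|I - V| / 4.
  apply: (@le_trans _ _ (s * (c + 1))); first by rewrite ler_pM2l//; lra.
  apply: (le_trans (ler_wpM2r (ltW c1) s3)); rewrite invfM mulrA divfK//.
  by rewrite gt_eqF.
by rewrite ep; lra.
Qed.

End PoissonRepresentation.

(** * Completeness of the space of square-integrable functions *)

Section L2Complete.
Variable R : realType.
Local Notation mu := (@lebesgue_measure R).

Lemma measurable_sqrB (v w : R -> R) : measurable_fun setT v ->
  measurable_fun setT w -> measurable_fun setT (fun x => ((v x - w x) ^+ 2)%:E).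
Proof.
move=> mv mw; apply/measurable_EFinP; apply: measurable_funX.
exact: (measurable_funB mv mw).
Qed.

Lemma limn_einf_le (u : nat -> \bar R) (c : \bar R) :
  (forall n, (u n <= c)%E) -> (limn_einf u <= c)%E.
Proof.
move=> uc; rewrite limn_einf_lim; apply: lime_le; first exact: is_cvg_einfs.
apply: nearW => n; apply: le_trans (uc n).
by apply: ereal_inf_lbound; exists n => /=.
Qed.

(** The weights [4 ^ k] make a sequence whose increments decay like [8 ^- k] in
    squared norm have summable increments almost everywhere; Fatou's lemma
    then identifies the pointwise limit as the limit in norm. *)
Lemma L2_complete (u : nat -> R -> R) : (forall n, L2 (u n)) ->
  (forall n m, (n <= m)%N ->
    ip (fun x => u n x - u m x) (fun x => u n x - u m x) <= 8 ^- n) ->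
  exists2 phi, L2 phi &
    forall n, ip (fun x => u n x - phi x) (fun x => u n x - phi x) <= 8 ^- n.
Proof.
move=> Lu Cu; have mu_ n : measurable_fun setT (u n) := (Lu n).1.
pose d k x : \bar R := (4 ^+ k * (u k x - u k.+1 x) ^+ 2)%:E.
have d0 k x : (0 <= d k x)%E by rewrite lee_fin mulr_ge0 ?sqr_ge0 ?exprn_ge0.
have md k : measurable_fun setT (d k).
  by apply/measurable_EFinP; apply: measurable_funM => //; apply: measurable_funX; exact: measurable_funB.
pose g x : \bar R := (\sum_(0 <= k <oo) d k x)%E.
have mg : measurable_fun setT g.
  by have := @ge0_emeasurable_sum _ _ _ setT d xpredT; apply=> // k x _ _; exact: d0.
have g0 x : (0 <= g x)%E by apply: nneseries_ge0.
have ig : mu.-integrable setT g.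
  apply/integrableP; split=> //.
  under eq_integral do rewrite gee0_abs//.
  rewrite integral_nneseries//.
  apply: (@le_lt_trans _ _ 2%:E); last exact: ltry.
  apply: lime_le; first by apply: is_cvg_nneseries => n _ _; apply: integral_ge0.
  apply: nearW => n; apply: (@le_trans _ _ (2 - 2 * (1 / 2) ^+ n)%:E); last first.
    by rewrite lee_fin gerBl mulr_ge0// exprn_ge0.
  elim: n => [|n IH]; first by rewrite big_nil expr0 mulr1 subrr.
  rewrite big_nat_recr//=.
  apply: (@le_trans _ _ ((2 - 2 * (1 / 2) ^+ n)%:E + ((1 / 2) ^+ n)%:E)%E); last first.
    by rewrite -EFinD lee_fin exprS; lra.
  apply: leeD => //; rewrite /d.
  under eq_integral do rewrite EFinM.
  rewrite ge0_integralZl//; first last.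
  - by move=> x _; rewrite lee_fin sqr_ge0.
  - exact: (measurable_sqrB (mu_ n) (mu_ n.+1)).
  rewrite ip_sqrE; last exact: L2B.
  rewrite -EFinM lee_fin.
  apply: (@le_trans _ _ (4 ^+ n * 8 ^- n)); first by rewrite ler_wpM2l ?exprn_ge0// Cu.
  by rewrite -exprVn -exprMn le_eqVlt; apply/orP; left; apply/eqP; congr (_ ^+ _); field.
pose good x := g x \is a fin_num.
have cvgu x : good x -> exists l : R, u n x @[n --> \oo] --> l.
  move=> gx; pose L := Num.sqrt (fine (g x)).
  have step n : `|u n.+1 x - u n x| <= L / 2 ^+ n.
    rewrite ler_pdivlMr ?exprn_gt0// -(@ler_pXn2r _ 2) ?nnegrE ?sqrtr_ge0 ?mulr_ge0 ?exprn_ge0//.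
    rewrite sqr_sqrtr ?fine_ge0// exprMn -normrX ger0_norm ?sqr_ge0//.
    rewrite -exprM mulnC exprM -[(2 ^+ 2 : R)]natrX -/4 mulrC -[X in _ * X]sqrrN opprB.
    rewrite -lee_fin fineK//; apply: le_trans (nneseries_lim_ge n.+1 _); last first.
      by move=> k _ _; exact: d0.
    by rewrite big_nat_recr//= leeDr// sume_ge0.
  have [l lP] := geometric_limit step; exists l.
  apply/cvgrPdist_lt => e e0; have [N NP] := exp2_small (2 * L) e0.
  exists N => // n /= Nn; apply: (le_lt_trans (lP n)); apply: le_lt_trans NP.
  rewrite ler_wpM2l ?mulr_ge0 ?sqrtr_ge0// lef_pV2 ?posrE ?exprn_gt0//.
  by rewrite ler_eXn2l ?ltr1n.
pose phi x := fine (limn_esup (fun n => (u n x)%:E)).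
have mphi : measurable_fun setT phi.
  apply: measurableT_comp => //; apply: measurable_fun_limn_esup => n.
  exact/measurable_EFinP.
have phiP x : good x -> u n x @[n --> \oo] --> phi x.
  move=> /cvgu[l ul]; suff -> : phi x = l by [].
  have : (u n x)%:E @[n --> \oo] --> l%:E by apply: cvg_EFin => //; exact: nearW.
  by move=> /cvg_limn_einf_sup[_]; rewrite /phi => ->.
have aeg : {ae mu, forall x, setT x -> good x} by exact: integrable_ae ig.
have bound n : (\int[mu]_x ((u n x - phi x) ^+ 2)%:E <= (8 ^- n)%:E)%E.
  pose F m x : \bar R := ((u n x - u (n + m)%N x) ^+ 2)%:E.
  have mF m : measurable_fun setT (F m).
    exact: (measurable_sqrB (mu_ n) (mu_ (n + m)%N)).
  have F0 m x : (0 <= F m x)%E by rewrite lee_fin sqr_ge0.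
  rewrite (_ : \int[mu]_x _ = \int[mu]_x limn_einf (F ^~ x))%E; last first.
    apply: ge0_ae_eq_integral => //.
    - exact: (measurable_sqrB (mu_ n) mphi).
    - have h : measurable_fun setT (fun x => limn_esup (fun m => - F m x)%E).
        apply: measurable_fun_limn_esup => m.
        exact: (measurableT_comp (@oppe_measurable R setT) (mF m)).
      exact: (measurableT_comp (@oppe_measurable R setT) h).
    - by move=> x _; rewrite lee_fin sqr_ge0.
    - move=> x _; rewrite limn_einf_lim; apply: lime_ge; first exact: is_cvg_einfs.
      by apply: nearW => m; apply: le_ereal_inf_tmp => _ [k _ <-].
    - have [N [mN N0 NP]] := aeg; exists N; split=> // x; apply: contra_notP => xN.
      have /(_ I)/phiP ux : setT x -> good x by apply: contrapT => /NP.
      move=> _.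
      have : F m x @[m --> \oo] --> ((u n x - phi x) ^+ 2)%:E.
        apply: cvg_EFin; first exact: nearW.
        have h : u n x - u (n + m)%N x @[m --> \oo] --> u n x - phi x.
          apply: cvgB; first exact: cvg_cst.
          exact: (cvg_comp _ (fun m => u m x) (cvg_addnl n) ux).
        exact: (cvgM h h).
      by move=> /cvg_limn_einf_sup[].
  have h := @fatou _ _ R mu setT measurableT F mF (fun m x _ => F0 m x).
  apply: (le_trans h); apply: limn_einf_le => m.
  by rewrite ip_sqrE ?lee_fin ?Cu ?leq_addr//; exact: L2B.
have Lphi : L2 phi.
  have h : L2 (fun x => u 0%N x - phi x).
    split; first exact: measurable_funB.
    exact: le_lt_trans (bound 0%N) (ltry _).
  have := L2B (Lu 0%N) h; congr L2; apply/funext => x.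
  by rewrite opprB addrC subrK.
by exists phi => // n; exact: ip_le.
Qed.

End L2Complete.

(** * The boundary function of a function of the Hardy class *)

Section BoundaryFunction.
Variable R : realType.
Local Notation C := R[i].
Local Notation mu := (@lebesgue_measure R).
Local Notation Re := (@complex.Re R).
Local Notation Im := (@complex.Im R).
Implicit Types (f : C -> C) (M : R) (z w : C).

Definition cross f (a b : R) := ip (rl f a) (rl f b) + ip (il f a) (il f b).

(** [f(x + i a) * conj (f (x + i b))] is the restriction to a line of the
    function [w |-> f(w) * conj (f (conj w + i (a + b)))], which is
    holomorphic in the strip [0 < Im w < a + b]; moving the line to the middle
    of the strip makes both heights equal. *)
Lemma cross_le f M (a b : R) : hardy f M -> 0 < a -> a <= b ->
  cross f a b = energy f ((a + b) / 2).
Proof.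
move=> hf a0 ab; pose sg := a + b; pose c : C := 0 +i* sg.
have b0 : 0 < b by lra.
pose G (w : C) := f w * (f (w^*%C + c))^*%C.
have cE (x s : R) : (x +i* s)^*%C + c = x +i* (sg - s).
  by apply: complexeqP => /=; ring.
have ReG (x s : R) : Re (G (x +i* s)) =
    rl f s x * rl f (sg - s) x + il f s x * il f (sg - s) x.
  by rewrite /G cE /rl /il; case: (f _) (f _) => [? ?] [? ?] /=; ring.
have crossE s : 0 < s < sg -> (\int[mu]_x Re (G (x +i* s)))%R = cross f s (sg - s).
  move=> /andP[s0 s1]; have s2 : 0 < sg - s by lra.
  rewrite /cross /ip -RintegralD//; first by apply: eq_Rintegral => x _; rewrite ReG.
  - exact: L2_mul_integrable (L2_rl hf s0) (L2_rl hf s2).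
  - exact: L2_mul_integrable (L2_il hf s0) (L2_il hf s2).
have m0 : 0 < sg / 2 by rewrite divr_gt0// addr_gt0.
have mE : sg - sg / 2 = sg / 2 by field.
have -> : energy f ((a + b) / 2) = cross f (sg / 2) (sg - sg / 2) by rewrite mE.
rewrite -[RHS]crossE; last by lra.
have {1}-> : b = sg - a by rewrite /sg; ring.
rewrite -crossE; last by rewrite a0 /sg ltrDl.
apply: (@strip_shift _ G 0 sg a (sg / 2) M) => //; try (rewrite /sg; lra).
  move=> z /andP[z0 z1]; have [l dl] := hf.1 z z0.
  have [|m dm] := hf.1 (z^*%C + c); first by rewrite !ReImE /=; lra.
  by exists (f z * m^*%C + (f (z^*%C + c))^*%C * l); exact: cderivM dl (cderiv_conj dm).
move=> s /andP[as_ sm]; have s0 : 0 < s by lra.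
have s1 : 0 < sg - s by lra.
have m1 := measurable_energy_density hf s0; have m2 := measurable_energy_density hf s1.
have half0 : 0 <= 2^-1 :> R by rewrite invr_ge0.
apply: (@le_trans _ _ (\int[mu]_x (2^-1%:E * ((normc (f (x +i* s)) ^+ 2)%:E +
   (normc (f (x +i* (sg - s))) ^+ 2)%:E)))%E); last first.
  rewrite ge0_integralZl//.
  - rewrite ge0_integralD//; first last.
    + exact/measurable_EFinP.
    + by move=> x _; rewrite lee_fin sqr_ge0.
    + exact/measurable_EFinP.
    + by move=> x _; rewrite lee_fin sqr_ge0.
    have := leeD (hf.2 s s0) (hf.2 _ s1); rewrite -EFinD => h.
    apply: (le_trans (lee_wpmul2l _ h)); first by rewrite lee_fin.
    by rewrite -EFinM lee_fin; lra.
  - by apply: emeasurable_funD; apply/measurable_EFinP.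
  - by move=> x _; rewrite adde_ge0// lee_fin sqr_ge0.
apply: ge0_le_integral => //.
- by move=> x _; rewrite lee_fin normc_ge0.
- apply/measurable_EFinP; apply: (eq_measurable_fun (fun x => normc (f (x +i* s)) * normc (f (x +i* (sg - s))))).
    by move=> x _; rewrite /G normcM normcJ cE.
  apply: measurable_funM; apply: continuous_measurable_fun; apply: continuous_normc_line => //; exact: hf.
- by apply: measurable_funeM; apply: emeasurable_funD; apply/measurable_EFinP.
- move=> x _; rewrite -EFinD -EFinM lee_fin /G normcM normcJ cE.
  move: (normc _) (normc _) => A B; have := sqr_ge0 (A - B); nra.
Qed.

Lemma crossE f M (a b : R) : hardy f M -> 0 < a -> 0 < b ->
  cross f a b = energy f ((a + b) / 2).
Proof.
move=> hf a0 b0; have [ab|ba] := leP a b; first exact: cross_le hf a0 ab.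
rewrite [a + b]addrC -(cross_le hf b0 (ltW ba)) /cross.
by congr (_ + _); exact: ipC.
Qed.

Definition energy_dist f (a b : R) :=
  ip (fun x => rl f a x - rl f b x) (fun x => rl f a x - rl f b x) +
  ip (fun x => il f a x - il f b x) (fun x => il f a x - il f b x).

Lemma energy_dist_ge0 f (a b : R) : 0 <= energy_dist f a b.
Proof. by rewrite addr_ge0 ?ip_ge0. Qed.

Lemma energy_distE f M (a b : R) : hardy f M -> 0 < a -> 0 < b ->
  energy_dist f a b = energy f a + energy f b - 2 * energy f ((a + b) / 2).
Proof.
move=> hf a0 b0; rewrite -(crossE hf a0 b0) /energy_dist.
rewrite (ipB_sqr (L2_rl hf a0) (L2_rl hf b0)) (ipB_sqr (L2_il hf a0) (L2_il hf b0)).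
by rewrite /energy /cross; ring.
Qed.

(** The energy is midpoint convex and bounded on a half-line. *)
Lemma energy_nonincreasing f M (a b : R) : hardy f M -> 0 < a -> a <= b ->
  energy f b <= energy f a.
Proof.
move=> hf a0; rewrite le_eqVlt => /predU1P[->//|ab].
rewrite leNgt; apply/negP => Qab.
pose d := b - a; have d0 : 0 < d by rewrite subr_gt0.
pose q n := energy f (a + n%:R * d).
have pos n : 0 < a + n%:R * d by rewrite ltr_pwDl// mulr_ge0// ltW.
have inc n : q n.+1 - q n >= energy f b - energy f a.
  elim: n => [|n IH].
    by rewrite /q mul0r addr0 mul1r /d [a + _]addrC subrK.
  apply: (le_trans IH).
  have := energy_dist_ge0 f (a + n.+2%:R * d) (a + n%:R * d).
  rewrite (energy_distE hf)//.
  have -> : (a + n.+2%:R * d + (a + n%:R * d)) / 2 = a + n.+1%:R * d.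
    by rewrite -[in n.+2]addn2 -addn1 !natrD; field.
  by rewrite -/(q n) -/(q n.+1) -/(q n.+2); lra.
have grow n : n%:R * (energy f b - energy f a) <= q n - q 0%N.
  elim: n => [|n IH]; first by rewrite mul0r subrr.
  by rewrite -addn1 natrD mulrDl mul1r addn1; have := inc n; lra.
have D0 : 0 < energy f b - energy f a by rewrite subr_gt0.
have qM n : q n - q 0%N <= M.
  have := energy_le hf (pos n); have : 0 <= q 0%N by rewrite addr_ge0 ?ip_ge0.
  by rewrite -/(q n); lra.
have := archi_boundP (divr_ge0 (hardy_ge0 hf) (ltW D0)).
rewrite ltr_pdivrMr//; move: (Num.Def.archi_bound _) => n h.
by have := le_lt_trans (le_trans (grow n) (qM n)) h; rewrite ltxx.
Qed.

Lemma energy_cauchy f M (e : R) : hardy f M -> 0 < e -> exists2 d : R, 0 < d &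
  forall a b, 0 < a -> a <= d -> 0 < b -> b <= d -> energy_dist f a b <= e.
Proof.
move=> hf e0; pose A := [set energy f y | y in [set y | 0 < y]].
have hA : has_sup A.
  split; first by exists (energy f 1), 1 => //=.
  by exists M => _ [y /= y0 <-]; exact: energy_le hf y0.
have e2 : 0 < e / 2 by rewrite divr_gt0.
have [_ [d /= d0 <-] dA] := sup_adherent e2 hA.
have up y : 0 < y -> energy f y <= sup A.
  by move=> y0; apply: ub_le_sup; [exact: hA.2|exists y].
exists d => // a b a0 ad b0 bd; rewrite (energy_distE hf)//.
have m0 : 0 < (a + b) / 2 by rewrite divr_gt0// addr_gt0.
have := up _ a0; have := up _ b0.
have := @energy_nonincreasing f M ((a + b) / 2) d hf m0 _; lra.
Qed.

End BoundaryFunction.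

Section BoundaryPoisson.
Variable R : realType.
Local Notation C := R[i].
Local Notation mu := (@lebesgue_measure R).
Local Notation Re := (@complex.Re R).
Local Notation Im := (@complex.Im R).
Implicit Types (f : C -> C) (M : R) (z w : C) (phi psi : R -> R).

(** What is known of the boundary values of [f] as elements of L2: they
    reproduce [f] through the Poisson kernel, and are the limit in norm of the
    restrictions of [f] to horizontal lines. *)
Definition boundary_of f phi psi := [/\ L2 phi, L2 psi,
  forall x y : R, 0 < y -> ip phi (poisson y x) = pi * rl f y x,
  forall x y : R, 0 < y -> ip psi (poisson y x) = pi * il f y x &
  forall e : R, 0 < e -> exists2 d : R, 0 < d & forall y, 0 < y -> y < d ->
    ip (fun x => rl f y x - phi x) (fun x => rl f y x - phi x) <= e /\
    ip (fun x => il f y x - psi x) (fun x => il f y x - psi x) <= e].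

Lemma boundary_exists f M : hardy f M -> exists phi psi, boundary_of f phi psi.
Proof.
move=> hf.
have e0 (n : nat) : 0 < 8 ^- n :> R by rewrite invr_gt0 exprn_gt0.
have /choice[d dP] (n : nat) : exists d : R, 0 < d /\
    forall a b, 0 < a -> a <= d -> 0 < b -> b <= d -> energy_dist f a b <= 8 ^- n.
  by have [d d0 dP] := energy_cauchy hf (e0 n); exists d.
pose a := fix a n : R := if n is m.+1 then
  Num.min (a m) (Num.min (d m.+1) m.+2%:R^-1) else Num.min (d 0%N) 1.
have a0 n : 0 < a n.
  elim: n => [|n IH] /=; first by rewrite lt_min (dP 0%N).1 ltr01.
  by rewrite !lt_min IH (dP n.+1).1 invr_gt0 ltr0n.
have ad n : a n <= d n.
  by case: n => [|n] /=; rewrite !ge_min lexx ?orbT.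
have an n : a n <= n.+1%:R^-1.
  by case: n => [|n] /=; rewrite !ge_min ?invr1 lexx ?orbT.
have amono n m : (n <= m)%N -> a m <= a n.
  move=> /subnK <-; elim: (m - n)%N => [|k IH]; first by rewrite add0n.
  by rewrite addSn /= ge_min IH.
have close n m : (n <= m)%N -> energy_dist f (a n) (a m) <= 8 ^- n.
  move=> nm; have [_ H] := dP n.
  by apply: H => //; exact: le_trans (amono _ _ nm) (ad n).
have Lr n := L2_rl hf (a0 n); have Li n := L2_il hf (a0 n).
have [|phi Lphi rphi] := L2_complete Lr.
  by move=> n m nm; apply: le_trans (close n m nm); rewrite lerDl ip_ge0.
have [|psi Lpsi ipsi] := L2_complete Li.
  by move=> n m nm; apply: le_trans (close n m nm); rewrite lerDr ip_ge0.
have eighth : 8 ^- n @[n --> \oo] --> (0 : R).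
  have -> : (fun n => 8 ^- n) = (fun n => (8^-1 : R) ^+ n).
    by apply/funext => n; rewrite exprVn.
  by apply: cvg_expr; rewrite ger0_norm ?invr_ge0// invf_lt1// ltr1n.
have sq0 (u : nat -> R -> R) : (forall n, ip (u n) (u n) <= 8 ^- n) ->
    ip (u n) (u n) @[n --> \oo] --> (0 : R).
  move=> h; apply: (squeeze_cvgr _ (cvg_cst 0) eighth).
  by apply: nearW => n; rewrite h ip_ge0.
have cr := sq0 _ rphi; have ci := sq0 _ ipsi.
have a_cvg : a n @[n --> \oo] --> (0 : R).
  apply: (squeeze_cvgr _ (cvg_cst 0) cvg_harmonic).
  by apply: nearW => n; rewrite an ltW.
have ay (y : R) : a n + y @[n --> \oo] --> y.
  by rewrite -[X in _ --> X]add0r; apply: cvgD => //; exact: cvg_cst.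
exists phi, psi; split=> //.
- move=> x y y0; have h := ip_cvg Lr Lphi (L2_poisson x y0) cr.
  rewrite -(cvg_lim (@Rhausdorff R) h); apply/cvg_lim => //.
  under eq_fun do rewrite (poisson_formula _ hf)//.
  apply: cvgM; first exact: cvg_cst.
  have zy : 0 < Im (x +i* y) by [].
  have c : rl f t x @[t --> y] --> rl f y x.
    by apply: cvg_Re; exact: continuous_at_vertical (hardy_ccont hf zy).
  exact: (cvg_comp _ _ (ay y) c).
- move=> x y y0; have h := ip_cvg Li Lpsi (L2_poisson x y0) ci.
  rewrite -(cvg_lim (@Rhausdorff R) h); apply/cvg_lim => //.
  have hg := hardy_mulNi hf.
  have -> : (fun n => ip (il f (a n)) (poisson y x)) = (fun n => pi * il f (a n + y) x).
    apply/funext => n; have := poisson_formula x hg (a0 n) y0.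
    rewrite rl_mulNi => <-; congr ip; apply/funext => t.
    by rewrite rl_mulNi.
  apply: cvgM; first exact: cvg_cst.
  have zy : 0 < Im (x +i* y) by [].
  have c : il f t x @[t --> y] --> il f y x.
    by apply: cvg_Im; exact: continuous_at_vertical (hardy_ccont hf zy).
  exact: (cvg_comp _ _ (ay y) c).
move=> e e_gt0; have [N NP] := exp2_small 4 e_gt0.
exists (a N) => // y y0 /ltW yN.
have [_ H] := dP N; have h := H y (a N) y0 (le_trans yN (ad N)) (a0 N) (ad N).
have small : 4 * 8 ^- N <= e :> R.
  apply: le_trans (ltW NP); rewrite ler_wpM2l// lef_pV2 ?posrE ?exprn_gt0//.
  by apply: lerXn2r; rewrite ?nnegrE// ler_nat.
have tri (u v w : R -> R) : L2 u -> L2 v -> L2 w -> ip (fun x => u x - w x) (fun x => u x - w x) <=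
    2 * ip (fun x => u x - v x) (fun x => u x - v x) +
    2 * ip (fun x => v x - w x) (fun x => v x - w x).
  move=> Lu Lv Lw; have := ip_ge0 (fun x => (u x - v x) - (v x - w x)).
  have L1 := L2B Lu Lv; have L3 := L2B Lv Lw.
  rewrite ipB_sqr//.
  have -> : (fun x => u x - w x) = (fun x => (u x - v x) + (v x - w x)).
    by apply/funext => x; ring.
  rewrite (ipDl L1 L3 (L2D L1 L3)) (ipDr L1 L3 L1) (ipDr L1 L3 L3).
  by rewrite (ipC (fun x => v x - w x) (fun x => u x - v x)); lra.
have Lry := L2_rl hf y0; have Liy := L2_il hf y0.
have n1 := ip_ge0 (fun x => rl f y x - rl f (a N) x).
have n2 := ip_ge0 (fun x => il f y x - il f (a N) x).
move: h; rewrite /energy_dist => h.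
split.
- have := tri _ _ _ Lry (Lr N) Lphi; have := rphi N; lra.
- have := tri _ _ _ Liy (Li N) Lpsi; have := ipsi N; lra.
Qed.

(** * Nontangential limits at Lebesgue points *)

Lemma lebesgue_pt_ball phi (x0 e : R) : lebesgue_pt phi x0 -> 0 < e ->
  exists2 r0 : R, 0 < r0 & forall r, 0 < r -> r <= r0 ->
    (\int[mu]_(t in ball x0 r) (`|phi t - phi x0|)%:E <= (2 * r * e)%:E)%E.
Proof.
move=> lp e0.
have /fine_cvgP[ff] := lp; move=> /cvgrPdist_lt/(_ _ e0) fe.
have [r0 /= r00 H] : \forall r \near (0 : R)^'+,
    davg phi x0 r \is a fin_num /\ `|0 - fine (davg phi x0 r)| < e.
  exact: filterI ff fe.
exists (r0 / 2); first by rewrite divr_gt0.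
move=> r r_gt0 rr0; have [] := H r _ r_gt0.
  by rewrite /= sub0r normrN gtr0_norm//; lra.
rewrite sub0r normrN => fr; rewrite -lte_fin.
rewrite ger0_norm ?fine_ge0 ?davg_ge0// fineK//.
rewrite /davg /iavg lebesgue_measure_ball ?(ltW r_gt0)//.
have r2 : 0 < r *+ 2 by rewrite mulrn_wgt0.

rewrite inver gt_eqF// => h.
have := lee_wpmul2l (_ : (0 <= (r *+ 2)%:E)%E) (ltW h).
rewrite muleA -EFinM divff ?gt_eqF// mul1e => H2.
rewrite (_ : 2 * r = r *+ 2); last by rewrite mulr_natl.
rewrite EFinM; apply: H2; rewrite lee_fin ltW//.
Qed.

(** In a cone, the kernel at [x + i y] is comparable to the one at
    [x0 + i y]. *)
Lemma poisson_cone (a x x0 y t : R) : 0 < y -> `|x - x0| < a * y ->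
  poisson y x t <= (2 * a ^+ 2 + 2) * poisson y x0 t.
Proof.
move=> y0 xa; have d1 := poisson_den x t y0; have d2 := poisson_den x0 t y0.
have a2 : 0 <= a ^+ 2 by exact: sqr_ge0.
have xa2 : (x - x0) ^+ 2 <= a ^+ 2 * y ^+ 2.
  rewrite -exprMn -(ger0_norm (sqr_ge0 (x - x0))) normrX ler_pXn2r ?nnegrE//.
    exact: ltW.
  exact: le_trans (ltW xa).
rewrite /poisson mulrA ler_pdivrMr// mulrAC ler_pdivlMr//.
rewrite [_ * y]mulrC -mulrA ler_wpM2l ?(ltW y0)//.
have h : (t - x0) ^+ 2 <= 2 * (t - x) ^+ 2 + 2 * (x - x0) ^+ 2.
  by have := sqr_ge0 ((t - x) - (x - x0)); nra.
have := sqr_ge0 (t - x); have := sqr_ge0 y; nra.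
Qed.

Section Dyadic.
Variables (h : R -> R) (x0 y r0 e : R).
Hypotheses (mh : measurable_fun setT h) (h0 : forall t, 0 <= h t).
Hypotheses (y0 : 0 < y) (e0 : 0 <= e).
Hypothesis havg : forall r, 0 < r -> r <= r0 ->
  (\int[mu]_(t in ball x0 r) (h t)%:E <= (2 * r * e)%:E)%E.

(** The ball of radius [2 ^ n * y] is exhausted by dyadic annuli; on the
    [n]-th one the kernel is at most [4 ^- n / y], while the mass of [h] grows
    only like [2 ^ n], so that the contributions form a geometric series. *)
Lemma dyadic_poisson n : 2 ^+ n * y <= r0 ->
  (\int[mu]_(t in ball x0 (2 ^+ n * y)) (h t * poisson y x0 t)%:E <=
   (e * (16 - 8 / 2 ^+ n))%:E)%E.
Proof.
have mp := measurable_poisson x0 y0; have mhp := measurable_funM mh mp.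
have p0 t := poisson_ge0 x0 t y0.
have mball r : measurable (ball x0 r) by exact: measurable_ball.
have mhA (A : set R) : measurable_fun A (fun t => (h t)%:E).
  by apply/measurable_EFinP; exact: measurable_funTS.
have mkA (k : R) (A : set R) : measurable_fun A (fun t => k%:E * (h t)%:E)%E.
  exact: measurable_funeM.
have mhpA (A : set R) : measurable_fun A (fun t => (h t * poisson y x0 t)%:E).
  by apply/measurable_EFinP; exact: measurable_funTS.
have upper r (k : R) (A : set R) : measurable A -> A `<=` ball x0 r -> 0 < r -> r <= r0 ->
    0 <= k -> (forall t, A t -> poisson y x0 t <= k) ->
    (\int[mu]_(t in A) (h t * poisson y x0 t)%:E <= (k * (2 * r * e))%:E)%E.
  move=> mA AB r_gt0 rr0 k0 pk; rewrite EFinM.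
  apply: le_trans (lee_wpmul2l _ (havg r_gt0 rr0)); last by rewrite lee_fin.
  rewrite -(ge0_integralZl mu (mball r) (mhA _)); first last.
  - by rewrite lee_fin.
  - by move=> t _; rewrite lee_fin.
  apply: (@le_trans _ _ (\int[mu]_(t in A) (k%:E * (h t)%:E))%E).
    apply: (@ge0_le_integral _ _ _ mu _ mA _ _ _ (mhpA _) (mkA k _)).
    - by move=> t _; rewrite lee_fin mulr_ge0.
    - by move=> t At; rewrite -EFinM lee_fin mulrC ler_wpM2r// pk.
  apply: (@ge0_subset_integral _ _ _ mu _ _ mA (mball r) _ (mkA k _)) => //.
  by move=> t _; rewrite -EFinM lee_fin mulr_ge0.
have two0 m : 0 < 2 ^+ m :> R by rewrite exprn_gt0.
elim: n => [|n IH].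
  rewrite expr0 mul1r divr1 => yr.
  have := @upper y y^-1 (ball x0 y) (mball _) _ y0 yr.
  move=> /(_ (@subset_refl _ _)); rewrite invr_ge0 (ltW y0) => /(_ isT) H.
  apply: (le_trans (H _)).
    move=> t _; rewrite /poisson ler_pdivrMr ?poisson_den// mulrDr.
    by rewrite -[y ^+ 2]/(y * y) mulKf ?gt_eqF// lerDr mulr_ge0 ?sqr_ge0// invr_ge0 ltW.
  rewrite lee_fin; have -> : y^-1 * (2 * y * e) = 2 * e by field; rewrite gt_eqF.
  by move: e0; lra.
rewrite exprS => yr.
have le2 : 2 ^+ n * y <= 2 * 2 ^+ n * y by have := mulr_gt0 (two0 n) y0; lra.
have yn : 2 ^+ n * y <= r0 by exact: le_trans yr.
pose B := ball x0 (2 ^+ n * y); pose B' := ball x0 (2 * 2 ^+ n * y).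
have BB' : B `<=` B' by exact: le_ball.
have mB : measurable B by exact: mball.
have mB'B : measurable (B' `\` B) by apply: measurableD => //; exact: mball.
have dB : [disjoint B & B' `\` B] by apply/disj_setPS => t [Bt []].
rewrite -/B' -(setDUK BB') (@ge0_integral_setU _ _ _ mu _ _ mB mB'B _ (mhpA _) _ dB);
  last by move=> t _; rewrite lee_fin mulr_ge0.
have n2y : 0 < 2 * 2 ^+ n * y by rewrite !mulr_gt0.
have k0 : 0 < 2 ^+ n * 2 ^+ n * y by rewrite !mulr_gt0.
have H : (\int[mu]_(t in B' `\` B) (h t * poisson y x0 t)%:E <=
    ((2 ^+ n * 2 ^+ n * y)^-1 * (2 * (2 * 2 ^+ n * y) * e))%:E)%E.
  apply: upper => //; first by rewrite invr_ge0 ltW.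
  move=> t [_]; rewrite /B /ball/= => /negP; rewrite -leNgt => far.
  rewrite /poisson ler_pdivrMr ?poisson_den// ler_pdivlMl//.
  have sq : 2 ^+ n * y * (2 ^+ n * y) <= (t - x0) ^+ 2.
    rewrite -expr2 -(ger0_norm (sqr_ge0 (t - x0))) normrX distrC.
    by rewrite ler_pXn2r ?nnegrE// ltW// mulr_gt0.
  by have := sqr_ge0 y; move: sq; lra.
apply: (@le_trans _ _ ((e * (16 - 8 / 2 ^+ n))%:E +
  ((2 ^+ n * 2 ^+ n * y)^-1 * (2 * (2 * 2 ^+ n * y) * e))%:E)%E).
  exact: leeD (IH yn) H.
rewrite -EFinD lee_fin.
have -> : (2 ^+ n * 2 ^+ n * y)^-1 * (2 * (2 * 2 ^+ n * y) * e) = 4 * e / 2 ^+ n.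
  by field; rewrite !gt_eqF.
have -> : 8 / (2 * 2 ^+ n) = 4 / 2 ^+ n :> R by field; rewrite gt_eqF.
by move: e0; lra.
Qed.

End Dyadic.

End BoundaryPoisson.

Section Fatou.
Variable R : realType.
Local Notation C := R[i].
Local Notation mu := (@lebesgue_measure R).
Local Notation Re := (@complex.Re R).
Local Notation Im := (@complex.Im R).
Implicit Types (f : C -> C) (M : R) (z w : C) (phi psi : R -> R).

Lemma L2_locally_integrable phi : L2 phi -> locally_integrable setT phi.
Proof.
move=> Lp; split; [exact: Lp.1|exact: openT|move=> K _ cK].
have mK : measurable K by exact: compact_measurable.
have mp : measurable_fun K phi by apply: measurable_funTS; exact: Lp.1.
have m1 : measurable_fun K (fun x => (phi x ^+ 2)%:E).
  by apply/measurable_EFinP; exact: measurable_funX.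
have m2 : measurable_fun K (fun x => `|phi x|%:E).
  by apply/measurable_EFinP; exact: measurableT_comp.
have m3 : measurable_fun K (fun x => 1%:E + (phi x ^+ 2)%:E)%E.
  by apply: emeasurable_funD => //; exact: measurable_cst.
apply: (@le_lt_trans _ _ (\int[mu]_(x in K) (1%:E + (phi x ^+ 2)%:E))%E).
  apply: (@ge0_le_integral _ _ _ mu _ mK _ _ _ m2 m3) => // x _.
  rewrite -EFinD lee_fin -[phi x ^+ 2]ger0_norm ?sqr_ge0// normrX.
  by have := sqr_ge0 (`|phi x| - 1); have := normr_ge0 (phi x); nra.
rewrite ge0_integralD//; [|by move=> x _; rewrite lee_fin sqr_ge0].
apply: lte_add_pinfty.
  rewrite integral_cst// mul1e; exact: compact_finite_measure.
apply: le_lt_trans Lp.2; apply: ge0_subset_integral => //.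
  by apply/measurable_EFinP; apply: measurable_funX; exact: Lp.1.
by move=> x _; rewrite lee_fin sqr_ge0.
Qed.

Lemma dyadic_scale (y r0 : R) : 0 < y -> y <= r0 ->
  exists n, 2 ^+ n * y <= r0 /\ r0 < 2 * 2 ^+ n * y.
Proof.
move=> y0 yr; have : exists n : nat, r0 < 2 ^+ n * y.
  have [n] := exp2_small r0 y0; rewrite ltr_pdivrMr ?exprn_gt0// mulrC.
  by exists n.
move=> ex; case: (ex_minnP ex) => -[|n] nP nmin.
  by move: nP; rewrite expr0 mul1r ltNge yr.
exists n; split; last by rewrite -exprS.
by rewrite leNgt; apply/negP => /nmin; rewrite ltnn.
Qed.

(** The Poisson integral of [phi] converges nontangentially at each Lebesgue
    point: near the point by the dyadic estimate, far from it because the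
    kernel is [O(y)]. *)
Lemma poisson_integral_cone phi (x0 a e : R) : L2 phi -> lebesgue_pt phi x0 -> 0 < e ->
  exists2 d : R, 0 < d & forall x y, 0 < y -> y < d -> `|x - x0| < a * y ->
    `|ip phi (poisson y x) - pi * phi x0| <= e.
Proof.
move=> Lp lp e0; pose c := 2 * a ^+ 2 + 2.
have c0 : 0 < c by rewrite /c; have := sqr_ge0 a; lra.
pose eps := e / (32 * c).
have eps0 : 0 < eps by rewrite divr_gt0// mulr_gt0.
have [r0 r00 havg] := lebesgue_pt_ball lp eps0.
pose h t := `|phi t - phi x0|.
have h0 t : 0 <= h t by exact: normr_ge0.
have mh : measurable_fun setT h.
  by apply: measurableT_comp => //; apply: measurable_funB => //; exact: Lp.1.
pose d := r0 / 2; have d0 : 0 < d by rewrite divr_gt0.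
have int_diff (x y : R) : 0 < y ->
    mu.-integrable setT (fun t => ((phi t - phi x0) * poisson y x t)%:E).
  move=> y0; have i1 := L2_mul_integrable Lp (L2_poisson x y0).
  have i2 := integrableZl measurableT (phi x0) (integrable_poisson x y0).
  under eq_fun do rewrite mulrBl.
  exact: (integrableB measurableT i1 i2).
have int_h (x y : R) : 0 < y -> mu.-integrable setT (fun t => (h t * poisson y x t)%:E).
  move=> y0; have := integrable_abse (int_diff x y y0).
  congr (integrable _ _ _); apply/funext => t /=.
  by rewrite normrM (ger0_norm (poisson_ge0 x t y0)).
pose K := (\int[mu]_t (h t * poisson d x0 t))%R.
have K0 : 0 <= K by apply: Rintegral_ge0 => t _; rewrite mulr_ge0// poisson_ge0.
have main (y : R) : 0 < y -> y <= d ->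
    (\int[mu]_t (h t * poisson y x0 t))%R <= eps * 16 + 2 * (y / d) * K.
  move=> y0 yd.
  have yr : y <= r0 by move: yd; rewrite /d; lra.
  have [n [n1 n2]] := dyadic_scale y0 yr.
  have near_ := dyadic_poisson mh h0 y0 (ltW eps0) havg n1.
  pose B := ball x0 (2 ^+ n * y).
  have mB : measurable B by exact: measurable_ball.
  have mBC : measurable (~` B) by exact: measurableC.
  have mp y' : 0 < y' -> measurable_fun setT (fun t => (h t * poisson y' x0 t)%:E).
    by move=> y'0; apply/measurable_EFinP; apply: measurable_funM => //; exact: measurable_poisson.
  have p0 y' t : 0 < y' -> (0 <= (h t * poisson y' x0 t)%:E)%E.
    by move=> y'0; rewrite lee_fin mulr_ge0// poisson_ge0.
  have k0 : 0 <= 2 * (y / d) by rewrite mulr_ge0// divr_ge0// ltW.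
  have far : (\int[mu]_(t in ~` B) (h t * poisson y x0 t)%:E <=
      (2 * (y / d) * K)%:E)%E.
    have -> : (2 * (y / d) * K)%:E =
        (\int[mu]_t ((2 * (y / d))%:E * (h t * poisson d x0 t)%:E))%E.
      rewrite ge0_integralZl//; first last.
      - by move=> t _; exact: p0.
      - exact: mp.
      by rewrite EFinM /K /Rintegral fineK// integrable_fin_num// int_h.
    apply: (@le_trans _ _ (\int[mu]_(t in ~` B)
        ((2 * (y / d))%:E * (h t * poisson d x0 t)%:E))%E).
      apply: ge0_le_integral => //.
      - by move=> t _; exact: p0.
      - by apply: measurable_funTS; exact: mp.
      - by apply: measurable_funTS; apply: measurable_funeM; exact: mp.
      - move=> t tB; rewrite -EFinM lee_fin [leRHS]mulrCA ler_wpM2l//.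
        have td : d <= `|t - x0|.
          have : 2 ^+ n * y <= `|t - x0|.
            by rewrite leNgt; apply/negP => tB'; apply: tB; rewrite /B /ball/= distrC.
          by move: n2; rewrite /d; lra.
        apply: (le_trans (poisson_far y0 yd td)).
        have := poisson_den x0 t d0; rewrite /poisson => den0.
        by rewrite le_eqVlt; apply/orP; left; apply/eqP; field; rewrite !gt_eqF.
    apply: ge0_subset_integral => //.
    - by apply: measurable_funeM; exact: mp.
    - by move=> t _; rewrite mule_ge0// p0.
  have fin : (\int[mu]_t (h t * poisson y x0 t)%:E)%E \is a fin_num.
    by apply: integrable_fin_num => //; exact: int_h.
  rewrite -lee_fin /Rintegral fineK//.
  have -> : (\int[mu]_t (h t * poisson y x0 t)%:E =
      \int[mu]_(t in B) (h t * poisson y x0 t)%:E +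
      \int[mu]_(t in ~` B) (h t * poisson y x0 t)%:E)%E.
    rewrite -(@ge0_integral_setU _ _ _ mu _ _ mB mBC) ?setUv//.
    - exact: mp.
    - by move=> t _; exact: p0.
    - by apply/disj_setPCl.
  rewrite EFinD; apply: leeD far; apply: (le_trans near_).
  by rewrite lee_fin ler_wpM2l ?(ltW eps0)// gerBl divr_ge0// exprn_ge0.
pose L := 4 * c * K / d.
have L0 : 0 <= L by rewrite divr_ge0 ?mulr_ge0 ?(ltW d0)// ltW.
exists (Num.min d (e / (L + 1))).
  by rewrite lt_min d0 divr_gt0//; lra.
move=> x y y0; rewrite lt_min => /andP[yd yL] xa.
have i1 := L2_mul_integrable Lp (L2_poisson x y0).
have -> : ip phi (poisson y x) - pi * phi x0 =
    (\int[mu]_t ((phi t - phi x0) * poisson y x t))%R.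
  have i2 : mu.-integrable setT (fun t => (phi x0 * poisson y x t)%:E).
    exact: (integrableZl measurableT (phi x0) (integrable_poisson x y0)).
  rewrite [pi * _]mulrC -(Rintegral_Zpoisson (phi x0) x y0) -RintegralB//.
  by apply: eq_Rintegral => t _; rewrite mulrBl.
apply: (le_trans (le_normr_Rintegral _ (int_diff x y y0))) => //.
have ic : mu.-integrable setT (fun t => (c * (h t * poisson y x0 t))%:E).
  exact: (integrableZl measurableT c (int_h x0 y y0)).
apply: (@le_trans _ _ (\int[mu]_t (c * (h t * poisson y x0 t)))%R).
  apply: le_Rintegral => //.
    have := int_h x y y0; congr (integrable _ _ _); apply/funext => t /=.
    by rewrite normrM (ger0_norm (poisson_ge0 x t y0)).
  move=> t _; rewrite normrM (ger0_norm (poisson_ge0 x t y0)) [leRHS]mulrCA ler_wpM2l//.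
  exact: poisson_cone.
rewrite RintegralZl//; last exact: int_h.
apply: (le_trans (ler_wpM2l (ltW c0) (main y y0 (ltW yd)))).
have e1 : c * (eps * 16) = e / 2 by rewrite /eps; field; rewrite gt_eqF.
have e2 : c * (2 * (y / d) * K) = y * L / 2 by rewrite /L; field; rewrite gt_eqF.
rewrite mulrDr e1 e2.
have L1 : 0 < L + 1 by lra.
have : y * (L + 1) < e by rewrite -ltr_pdivlMr.
by rewrite mulrDr mulr1; lra.
Qed.

Lemma nontangential_filter (x : R) : ProperFilter (nontangential x).
Proof.
have im (c : R) : 0 < c -> forall d : R, 0 < d ->
    exists2 z : C, normc (z - x%:C) < d & cone c x z.
  move=> c0 d d0; exists (x +i* (d / 2)).
    have -> : x +i* (d / 2) - x%:C = 0 +i* (d / 2) by apply: complexeqP => /=; ring.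
    by rewrite /= expr0n add0r sqrtr_sqr gtr0_norm; lra.
  by rewrite /cone /= subrr normr0 mulr_gt0// divr_gt0.
split.
  move=> /(_ 1 ltr01)/nbhs_normc[d d0 H].
  by have [z zd zc] := im 1 ltr01 d d0; exact: H zd zc.
split.
- by move=> c _; exact: filterT.
- by move=> A B hA hB c c0; apply: filterI; [exact: hA|exact: hB].
- by move=> A B AB hA c c0; apply: filterS AB _; exact: hA.
Qed.

Lemma boundary_value_lebesgue_pt f M phi psi x : hardy f M -> boundary_of f phi psi ->
  lebesgue_pt phi x -> lebesgue_pt psi x -> boundary_value f x = phi x +i* psi x.
Proof.
move=> hf [Lphi Lpsi pphi ppsi _] lphi lpsi.
have PF := nontangential_filter x.
apply/cvg_lim; first exact: norm_hausdorff.
move=> A /nbhs_normc[e e0 HA] a /= a0.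
have pi0 := @pi_gt0 R.
have e2 : 0 < e * pi / 4 by rewrite divr_gt0// mulr_gt0.
have [d1 d10 H1] := poisson_integral_cone a Lphi lphi e2.
have [d2 d20 H2] := poisson_integral_cone a Lpsi lpsi e2.
apply/nbhs_normc; exists (Num.min d1 d2); first by rewrite lt_min d10.
move=> z; rewrite lt_min => /andP[zd1 zd2] zc; apply: HA.
have z0 : 0 < Im z.
  rewrite -(pmulr_rgt0 _ a0); move: zc; rewrite /cone /= => zc.
  exact: le_lt_trans (normr_ge0 _) zc.
have zd : Im z <= normc (z - x%:C).
  apply: (@le_trans _ _ `|Im (z - x%:C)|); last exact: Im_le_normc.
  by rewrite !ReImE /= subr0 ler_norm.
have zE : f z = rl f (Im z) (Re z) +i* il f (Im z) (Re z).
  by rewrite /rl /il; case: (z) => u v /=; case: (f _).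
have scale (u v : R) : `|pi * u - pi * v| <= e * pi / 4 -> `|u - v| < e / 2.
  rewrite -mulrBr normrM (gtr0_norm pi0) -ler_pdivlMl// => /le_lt_trans; apply.
  have -> : pi^-1 * (e * pi / 4) = e / 4 * (pi^-1 * pi) by ring.
  by rewrite mulVf ?gt_eqF// mulr1; lra.
have := H1 _ _ z0 (le_lt_trans zd zd1) zc; have := H2 _ _ z0 (le_lt_trans zd zd2) zc.
rewrite pphi// ppsi// => /scale h2 /scale h1.
by rewrite zE; apply: normc_lt_ReIm; rewrite !ReImE.
Qed.

Lemma boundary_value_ae f M phi psi : hardy f M -> boundary_of f phi psi ->
  {ae mu, forall x, boundary_value f x = phi x +i* psi x}.
Proof.
move=> hf bf; have [Lphi Lpsi _ _ _] := bf.
have h1 := lebesgue_differentiation (L2_locally_integrable Lphi).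
have h2 := lebesgue_differentiation (L2_locally_integrable Lpsi).
have [N1 [m1 z1 s1]] := h1; have [N2 [m2 z2 s2]] := h2.
exists (N1 `|` N2); split; first exact: measurableU.
  by rewrite null_set_setU.
move=> x; apply: contra_notP => /not_orP[x1 x2].
apply: boundary_value_lebesgue_pt hf bf _ _.
- by apply: contrapT => l1; apply: x1; exact: s1.
- by apply: contrapT => l2; apply: x2; exact: s2.
Qed.

End Fatou.

(** * The inner product of boundary values *)

Section InnerProduct.
Variable R : realType.
Local Notation C := R[i].
Local Notation mu := (@lebesgue_measure R).
Local Notation Re := (@complex.Re R).
Local Notation Im := (@complex.Im R).
Implicit Types (f g : C -> C) (M : R) (z w : C) (phi psi : R -> R).

Import HBNNSimple.

(** Nontangential limits are only known almost everywhere, on a set whose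
    complement is negligible; nothing says that the function [boundary_value f]
    is Borel. The Lebesgue integral, a supremum over simple functions, is
    nevertheless insensitive to the negligible set. *)
Lemma ge0_integral_ae (f g : R -> \bar R) : measurable_fun setT g ->
  (forall x, 0 <= f x)%E -> (forall x, 0 <= g x)%E ->
  {ae mu, forall x, f x = g x} -> (\int[mu]_x f x = \int[mu]_x g x)%E.
Proof.
move=> mg f0 g0 [N [mN N0 NP]].
have fg x : ~ N x -> f x = g x by move=> xN; apply: contrapT => /NP.
have mNC : measurable (~` N) by exact: measurableC.
apply/eqP; rewrite eq_le; apply/andP; split.
  rewrite [leLHS]ge0_integralTE//; apply: ge_ereal_sup => _ /= [h hf <-].
  rewrite -integralT_nnsfun.
  have h0 x : 0 <= h x by exact: fun_ge0.
  have mh : measurable_fun setT (EFin \o h) by exact/measurable_EFinP.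
  have mhN : measurable_fun setT ((EFin \o h) \_ (~` N)).
    by apply/(measurable_restrictT _ mNC); exact: measurable_funTS.
  apply: (@le_trans _ _ (\int[mu]_x ((EFin \o h) \_ (~` N)) x)%E).
    rewrite le_eqVlt; apply/orP; left; apply/eqP.
    apply: ge0_ae_eq_integral => //.
    - by move=> x _; rewrite /= lee_fin.
    - by move=> x _; rewrite patchE; case: ifPn => //= _; rewrite lee_fin.
    - exists N; split=> // x /=; apply: contra_notP => xN _.
      by rewrite patchE mem_set.
  apply: ge0_le_integral => //.
  - by move=> x _; rewrite patchE; case: ifPn => //= _; rewrite lee_fin.
  - move=> x _; rewrite patchE; case: ifPn => // /set_mem xN.
    by rewrite /= -fg.
have -> : (\int[mu]_x g x = \int[mu]_x (g \_ (~` N)) x)%E.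
  apply: ge0_ae_eq_integral => //.
  - by apply/(measurable_restrictT _ mNC); exact: measurable_funTS.
  - by move=> x _; rewrite patchE; case: ifPn.
  - by exists N; split=> // x /=; apply: contra_notP => xN _; rewrite patchE mem_set.
rewrite [leLHS]ge0_integralTE; last by move=> x; rewrite patchE; case: ifPn.
rewrite [leRHS]ge0_integralTE//; apply: ge_ereal_sup => _ [h hg <-].
apply: ereal_sup_ubound; exists h => // x; apply: (le_trans (hg x)); rewrite patchE.
by case: ifPn => // /set_mem xN; rewrite -fg.
Qed.

Lemma Rintegral_ae (u v : R -> R) : measurable_fun setT v ->
  {ae mu, forall x, u x = v x} -> (\int[mu]_x u x = \int[mu]_x v x)%R.
Proof.
move=> mv [N [mN N0 NP]].
have uv x : ~ N x -> u x = v x by move=> xN; apply: contrapT => /NP.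
have mEv : measurable_fun setT (EFin \o v) by exact/measurable_EFinP.
rewrite /Rintegral; congr fine; rewrite integralE [RHS]integralE; congr (_ - _)%E.
- apply: ge0_integral_ae => //; first exact: measurable_funepos.
  by exists N; split=> // x /=; apply: contra_notP => /uv; rewrite !funeposE /= => ->.
- apply: ge0_integral_ae => //; first exact: measurable_funeneg.
  by exists N; split=> // x /=; apply: contra_notP => /uv; rewrite !funenegE /= => ->.
Qed.

Lemma conjE (z : C) : (z^*)%R = (z^*)%C.
Proof. by []. Qed.

Lemma innerE (f g : H2 R) Mf Mg phi psi phi' psi' : hardy f Mf -> hardy g Mg ->
  boundary_of f phi psi -> boundary_of g phi' psi' ->
  inner f g = (ip phi phi' + ip psi psi') +i* (ip psi phi' - ip phi psi').
Proof.
move=> hf hg bf bg; have [Lp Lq _ _ _] := bf; have [Lp' Lq' _ _ _] := bg.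
have [N1 [m1 z1 s1]] := boundary_value_ae hf bf.
have [N2 [m2 z2 s2]] := boundary_value_ae hg bg.
have prod x : ~ (N1 `|` N2) x -> boundary_value f x * ((boundary_value g x)^*)%R =
    (phi x * phi' x + psi x * psi' x) +i* (psi x * phi' x - phi x * psi' x).
  move=> /not_orP[x1 x2].
  have -> : boundary_value f x = phi x +i* psi x by apply: contrapT => /s1.
  have -> : boundary_value g x = phi' x +i* psi' x by apply: contrapT => /s2.
  by rewrite conjE; apply: complexeqP; rewrite !ReImE /=; ring.
have nN : mu (N1 `|` N2) = 0%E by rewrite null_set_setU.
have mN : measurable (N1 `|` N2) by exact: measurableU.
have aeRe : {ae mu, forall x, Re (boundary_value f x * ((boundary_value g x)^*)%R) =
    phi x * phi' x + psi x * psi' x}.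
  exists (N1 `|` N2); split; [exact: mN|exact: nN|move=> x nx].
  by apply: contrapT => xN; apply: nx; exact: (congr1 Re (prod x xN)).
have aeIm : {ae mu, forall x, Im (boundary_value f x * ((boundary_value g x)^*)%R) =
    psi x * phi' x - phi x * psi' x}.
  exists (N1 `|` N2); split; [exact: mN|exact: nN|move=> x nx].
  by apply: contrapT => xN; apply: nx; exact: (congr1 Im (prod x xN)).
rewrite /inner /cintegral; congr Complex.
  rewrite (Rintegral_ae _ aeRe); last first.
    by apply: measurable_funD; apply: measurable_funM; apply: L2_measurable.
  by rewrite RintegralD//; exact: L2_mul_integrable.
rewrite (Rintegral_ae _ aeIm); last first.
  by apply: measurable_funB; apply: measurable_funM; apply: L2_measurable.
by rewrite RintegralB//; exact: L2_mul_integrable.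
Qed.

(** The real part of the inner product of the restrictions of [f] and [g] to
    the line at height [y]. *)
Definition pairing f g (y : R) : R := ip (rl f y) (rl g y) + ip (il f y) (il g y).

Lemma ip_cvg2 (u v : nat -> R -> R) phi psi : (forall n, L2 (u n)) ->
  (forall n, L2 (v n)) -> L2 phi -> L2 psi ->
  ip (fun x => u n x - phi x) (fun x => u n x - phi x) @[n --> \oo] --> (0 : R) ->
  ip (fun x => v n x - psi x) (fun x => v n x - psi x) @[n --> \oo] --> (0 : R) ->
  ip (u n) (v n) @[n --> \oo] --> ip phi psi.
Proof.
move=> Lu Lv Lp Lq cu cv.
have c1 := ip_cvg Lu Lp Lq cu; have c2 := ip_cvg Lv Lq Lp cv.
have c3 : ip (fun x => u n x - phi x) (fun x => v n x - psi x) @[n --> \oo] --> (0 : R).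
  apply/cvgr0Pnorm_lt => e e0.
  move/cvgr0Pnorm_lt : cu => /(_ _ e0); move/cvgr0Pnorm_lt : cv => /(_ _ e0).
  apply: filterS2 => n h1 h2.
  move: h1 h2; rewrite (ger0_norm (ip_ge0 (fun x => v n x - psi x))).
  rewrite (ger0_norm (ip_ge0 (fun x => u n x - phi x))) => h1 h2.
  have := ip_ineq ltr01 (L2B (Lu n) Lp) (L2B (Lv n) Lq).
  by rewrite invr1 !mul1r; lra.
have E n : ip (u n) (v n) = ip (fun x => u n x - phi x) (fun x => v n x - psi x) +
    (ip (u n) psi + ip (v n) phi) - ip phi psi.
  have L1 := L2B (Lu n) Lp.
  by rewrite (ipBr (Lv n) Lq L1) !ipBl// (ipC (v n) phi); ring.
have -> : (fun n => ip (u n) (v n)) = (fun n =>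
    ip (fun x => u n x - phi x) (fun x => v n x - psi x) +
    (ip (u n) psi + ip (v n) phi) - ip phi psi) by apply/funext.
have c4 : (fun _ : nat => ip phi psi) @ \oo --> ip phi psi by exact: cvg_cst.
rewrite [X in _ --> X](_ : _ = 0 + (ip phi psi + ip psi phi) - ip phi psi).
  exact: (cvgB (cvgD c3 (cvgD c1 c2)) c4).
by rewrite (ipC psi phi); ring.
Qed.

Lemma boundary_ip_cvg f g Mf Mg phi psi phi' psi' (y : nat -> R) :
  hardy f Mf -> hardy g Mg -> boundary_of f phi psi -> boundary_of g phi' psi' ->
  (forall n, 0 < y n) -> y n @[n --> \oo] --> (0 : R) ->
  [/\ ip (rl f (y n)) (rl g (y n)) @[n --> \oo] --> ip phi phi',
      ip (il f (y n)) (il g (y n)) @[n --> \oo] --> ip psi psi',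
      ip (il f (y n)) (rl g (y n)) @[n --> \oo] --> ip psi phi' &
      ip (rl f (y n)) (il g (y n)) @[n --> \oo] --> ip phi psi'].
Proof.
move=> hf hg [Lp Lq _ _ cf] [Lp' Lq' _ _ cg] y0 cy.
have conv (h : C -> C) p q : (forall e : R, 0 < e -> exists2 d : R, 0 < d & forall y, 0 < y -> y < d ->
    ip (fun x => rl h y x - p x) (fun x => rl h y x - p x) <= e /\
    ip (fun x => il h y x - q x) (fun x => il h y x - q x) <= e) ->
    ip (fun x => rl h (y n) x - p x) (fun x => rl h (y n) x - p x) @[n --> \oo] --> (0 : R) /\
    ip (fun x => il h (y n) x - q x) (fun x => il h (y n) x - q x) @[n --> \oo] --> (0 : R).
  move=> H; split; apply/cvgr0Pnorm_le => e e0; have [d d0 Hd] := H e e0;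
    (move/cvgr0Pnorm_lt : cy => /(_ _ d0); apply: filterS => n;
     rewrite ger0_norm ?(ltW (y0 n))// => yd; rewrite ger0_norm ?ip_ge0//;
     by have [] := Hd _ (y0 n) yd).
have [c1 c2] := conv _ _ _ cf; have [c3 c4] := conv _ _ _ cg.
have Lrf n := L2_rl hf (y0 n); have Lif n := L2_il hf (y0 n).
have Lrg n := L2_rl hg (y0 n); have Lig n := L2_il hg (y0 n).
by split; exact: ip_cvg2.
Qed.

Lemma pairing_cvg f g Mf Mg phi psi phi' psi' (y : nat -> R) :
  hardy f Mf -> hardy g Mg -> boundary_of f phi psi -> boundary_of g phi' psi' ->
  (forall n, 0 < y n) -> y n @[n --> \oo] --> (0 : R) ->
  pairing f g (y n) @[n --> \oo] --> ip phi phi' + ip psi psi'.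
Proof.
by move=> hf hg bf bg y0 cy; have [? ? _ _] := boundary_ip_cvg hf hg bf bg y0 cy; exact: cvgD.
Qed.

Lemma pairing_mulNi f g Mf Mg y : hardy f Mf -> hardy g Mg -> 0 < y ->
  pairing (fun w => - 'i * f w) g y = ip (il f y) (rl g y) - ip (rl f y) (il g y).
Proof.
move=> hf hg y0; rewrite /pairing.
have -> : rl (fun w => - 'i * f w) y = il f y by apply/funext => x; exact: rl_mulNi.
have -> : il (fun w => - 'i * f w) y = (fun x => -1 * rl f y x).
  by apply/funext => x; rewrite il_mulNi mulN1r.
by rewrite (ipZl _ (L2_rl hf y0) (L2_il hg y0)) mulN1r.
Qed.

Lemma pairing_mulNi_cvg f g Mf Mg phi psi phi' psi' (y : nat -> R) :
  hardy f Mf -> hardy g Mg -> boundary_of f phi psi -> boundary_of g phi' psi' ->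
  (forall n, 0 < y n) -> y n @[n --> \oo] --> (0 : R) ->
  pairing (fun w => - 'i * f w) g (y n) @[n --> \oo] --> ip psi phi' - ip phi psi'.
Proof.
move=> hf hg bf bg y0 cy; have [_ _ c1 c2] := boundary_ip_cvg hf hg bf bg y0 cy.
under eq_fun do rewrite (pairing_mulNi hf hg)//.
exact: cvgB.
Qed.

End InnerProduct.

(** * Averages of dilates *)

Section UnitInterval.
Variable R : realType.
Local Notation mu := (@lebesgue_measure R).
Local Notation I := [set` `](0 : R)%R, 1%R]].

Definition invsqrt (t : R) : R := (Num.sqrt t)^-1.

Lemma shrinking_cover : \bigcup_(n in [set: nat]) `[n.+1%:R^-1, 1]%classic = I.
Proof.
apply/seteqP; split=> [t [n _] /=|t /=]; rewrite !in_itv/= => /andP[nt t1].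
  by rewrite t1 andbT (lt_le_trans _ nt)// invr_gt0.
exists (Num.Def.archi_bound t^-1) => //=; rewrite in_itv/= t1 andbT.
rewrite invf_ple ?posrE// ltW//; apply: (@lt_trans _ _ (Num.Def.archi_bound t^-1)%:R).
  by apply: archi_boundP; rewrite invr_ge0 ltW.
by rewrite ltr_nat.
Qed.

Lemma Rintegral_shrink (g : R -> R) : mu.-integrable I (EFin \o g) ->
  (\int[mu]_(t in `[n.+1%:R^-1, 1]) g t)%R @[n --> \oo] --> (\int[mu]_(t in I) g t)%R.
Proof.
move=> ig; have mg : measurable_fun I (EFin \o g) := measurable_int mu ig.
pose P n := `[n.+1%:R^-1 : R, 1]%classic; pose gn n := (EFin \o g) \_ (P n).
have PI n : P n `<=` I by rewrite -shrinking_cover; exact: bigcup_sup.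
have mI : measurable I by exact: measurable_itv.
have mP n : measurable (P n) by exact: measurable_itv.
have mgn n : measurable_fun I (gn n).
  apply/(measurable_restrict _ (mP n) mI); apply: measurable_funS mg => //.
have cgn : {ae mu, forall t, I t -> gn ^~ t @ \oo --> (EFin \o g) t}.
  apply: aeW => t It; apply: cvg_near_cst.
  have : (\bigcup_(n in [set: nat]) P n) t by rewrite shrinking_cover.
  move=> [N _ PNt]; exists N => // n /= Nn; rewrite /gn patchE mem_set//.
  move: PNt; rewrite /P /= !in_itv/= => /andP[nt ->]; rewrite andbT.
  by apply: le_trans nt; rewrite lef_pV2 ?posrE// ler_nat.
have ign := integrable_abse ig.
have dgn : {ae mu, forall t n, I t -> (`|gn n t| <= `|(EFin \o g) t|)%E}.
  by apply: aeW => t n _; rewrite /gn patchE; case: ifP => _ //=; rewrite normr0 lee_fin.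
have [_ _ H] := @dominated_convergence _ _ R mu I mI gn _ _ mgn mg cgn ign dgn.
have -> : (fun n => (\int[mu]_(t in `[n.+1%:R^-1, 1]) g t)%R) =
    fine \o (fun n => (\int[mu]_(t in I) gn n t)%E).
  apply/funext => n; rewrite /Rintegral /=; congr fine.
  by rewrite -integral_mkcondr setIidr//; exact: PI.
apply: fine_cvg; rewrite fineK//.
by apply: integrable_fin_num.
Qed.

Lemma invsqrt_ge0 (t : R) : 0 <= invsqrt t.
Proof. by rewrite invr_ge0 sqrtr_ge0. Qed.

Lemma continuous_invsqrt (t : R) : 0 < t -> {for t, continuous invsqrt}.
Proof. by move=> t0; apply: cvgV; [rewrite gt_eqF// sqrtr_gt0|exact: sqrt_continuous]. Qed.

Lemma open_measurable_I (g : R -> R) : (forall t, 0 < t -> {for t, continuous g}) ->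
  measurable_fun I g.
Proof.
move=> cg; apply: (@measurable_funS _ _ _ _ `]0 : R, +oo[%classic); first exact: measurable_itv.
  by move=> t /=; rewrite !in_itv/= => /andP[->].
apply: open_continuous_measurable_fun; first exact: interval_open.
by move=> t /[!inE] /=; rewrite in_itv/= andbT; exact: cg.
Qed.

Lemma integral_invsqrt : (\int[mu]_(t in I) (invsqrt t)%:E <= 2%:E)%E.
Proof.
pose P n := `[n.+1%:R^-1 : R, 1]%classic.
have n0 (n : nat) : 0 < n.+1%:R^-1 :> R by rewrite invr_gt0.
have n1 (n : nat) : n.+1%:R^-1 <= 1 :> R by rewrite invf_le1// ler1n.
have FE n : (\int[mu]_(t in P n) (invsqrt t)%:E <= 2%:E)%E.
  have cw : continuous_on n.+1%:R^-1 1 invsqrt.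
    by move=> t /andP[t0 _]; apply: continuous_invsqrt; exact: lt_le_trans t0.
  have dS (t : R) : n.+1%:R^-1 <= t <= 1 ->
      is_derive t 1 (2 *: @Num.sqrt R) (invsqrt t).
    move=> /andP[t0 _]; have {}t0 : 0 < t by exact: lt_le_trans t0.
    have h := is_derive1_sqrt t0.
    apply: (is_derive_eq (is_deriveZ 2 h)); rewrite -[_ *: _]/(2 * _) /invsqrt.
    by rewrite invfM mulrA mulfV// mul1r.
  have := Rintegral_derivative (n1 n) dS cw; rewrite /Rintegral => H.
  rewrite -(@fineK _ (\int[mu]_(t in P n) _)%E); last first.
    apply: integrable_fin_num => //; first exact: measurable_itv.
    exact: (continuous_on_integrable cw).
  rewrite lee_fin H [leLHS](_ : _ = 2 * Num.sqrt 1 - 2 * Num.sqrt n.+1%:R^-1)//.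
  rewrite sqrtr1 mulr1 gerBl.
  by rewrite mulr_ge0// sqrtr_ge0.
have nd : nondecreasing_seq P.
  move=> n m nm; apply/subsetPset => t; rewrite /P /= !in_itv/= => /andP[nt ->].
  by rewrite andbT; apply: le_trans nt; rewrite lef_pV2 ?posrE// ler_nat ltnS.
have mP n : measurable (P n) by exact: measurable_itv.
have mw n : measurable_fun (P n) (EFin \o invsqrt).
  apply: (@measurable_funS _ _ _ _ I); first exact: measurable_itv.
    by rewrite -shrinking_cover; exact: bigcup_sup.
  by apply/measurable_EFinP; apply: open_measurable_I; exact: continuous_invsqrt.
have w0 n t : P n t -> (0 <= (EFin \o invsqrt) t)%E.
  by move=> _; rewrite lee_fin invsqrt_ge0.
have cv : (\int[mu]_(t in P n) (invsqrt t)%:E)%E @[n --> \oo] -->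
    (\int[mu]_(t in \bigcup_n P n) (invsqrt t)%:E)%E.
  exact: (@ge0_nondecreasing_set_cvg_integral _ (measurableTypeR R) R P
    (EFin \o invsqrt) (@lebesgue_measure R) nd mP mw w0).
rewrite -shrinking_cover; apply: (cvge_to_le cv); exact: nearW.
Qed.

Lemma integrable_invsqrt : mu.-integrable I (EFin \o invsqrt).
Proof.
apply/integrableP; split.
  by apply/measurable_EFinP; apply: open_measurable_I; exact: continuous_invsqrt.
under eq_integral do rewrite /= (ger0_norm (invsqrt_ge0 _)).
exact: le_lt_trans integral_invsqrt (ltry _).
Qed.

Lemma integrableZI (k : R) (g : R -> R) : mu.-integrable I (EFin \o g) ->
  mu.-integrable I (fun t => (k * g t)%:E).
Proof.
move=> ig; apply: (integrableZl _ k ig); exact: measurable_itv.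
Qed.

Lemma integrableDI (g h : R -> R) : mu.-integrable I (EFin \o g) ->
  mu.-integrable I (EFin \o h) -> mu.-integrable I (fun t => (g t + h t)%:E).
Proof.
move=> ig ih; apply: (integrableD _ ig ih); exact: measurable_itv.
Qed.

Lemma RintegralDI (g h : R -> R) : mu.-integrable I (EFin \o g) ->
  mu.-integrable I (EFin \o h) ->
  (\int[mu]_(t in I) (g t + h t) = \int[mu]_(t in I) g t + \int[mu]_(t in I) h t)%R.
Proof. by move=> ig ih; apply: (RintegralD _ ig ih); exact: measurable_itv. Qed.

Lemma RintegralBI (g h : R -> R) : mu.-integrable I (EFin \o g) ->
  mu.-integrable I (EFin \o h) ->
  (\int[mu]_(t in I) (g t - h t) = \int[mu]_(t in I) g t - \int[mu]_(t in I) h t)%R.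
Proof. by move=> ig ih; apply: (RintegralB _ ig ih); exact: measurable_itv. Qed.

Lemma le_integrableI (g h : R -> R) : measurable_fun I g ->
  (forall t, 0 < t -> t <= 1 -> `|g t| <= h t) ->
  mu.-integrable I (EFin \o h) -> mu.-integrable I (EFin \o g).
Proof.
move=> mg gh ih; apply: (le_integrable _ _ _ ih).
- exact: measurable_itv.
- exact/measurable_EFinP.
- move=> t /=; rewrite in_itv/= => /andP[t0 t1]; rewrite lee_fin.
  exact: le_trans (gh t t0 t1) (ler_norm _).
Qed.

End UnitInterval.

Section DilateAverage.
Variable R : realType.
Local Notation C := R[i].
Local Notation mu := (@lebesgue_measure R).
Local Notation Re := (@complex.Re R).
Local Notation Im := (@complex.Im R).
Local Notation I := [set` `](0 : R)%R, 1%R]].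
Implicit Types (f g : C -> C) (M : R) (z w : C).

Lemma hardy_pointwise f M x y : hardy f M -> 0 < y ->
  rl f y x ^+ 2 + il f y x ^+ 2 <= 2 * M / y.
Proof.
move=> hf y0; have h0 : 0 < y / 2 by rewrite divr_gt0.
have pi0 := @pi_gt0 R; have pi2 := @pi_ge2 R.
have bound (g : C -> C) : hardy g M ->
    (pi * rl g y x) ^+ 2 <= ip (rl g (y / 2)) (rl g (y / 2)) * (pi / (y / 2)).
  move=> hg; have := poisson_formula x hg h0 h0.
  have -> : y / 2 + y / 2 = y by field.
  move=> <-; apply: (le_trans (ip_CS (L2_rl hg h0) (L2_poisson x h0))).
  by rewrite ler_wpM2l ?ip_ge0// ip_poisson.
have b1 := bound _ hf; have := bound _ (hardy_mulNi hf).
have E : rl (fun w => - 'i * f w) (y / 2) = il f (y / 2).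
  by apply/funext => t; exact: rl_mulNi.
rewrite E rl_mulNi => b2.
have en := energy_le hf h0; rewrite /energy in en.
have py : 0 < pi / (y / 2) by rewrite divr_gt0.
have en2 := ler_wpM2r (ltW py) en.
have M0 := hardy_ge0 hf.
have s0 : 0 <= rl f y x ^+ 2 + il f y x ^+ 2 by rewrite addr_ge0 ?sqr_ge0.
have key : pi * (rl f y x ^+ 2 + il f y x ^+ 2) <= 2 * M / y.
  rewrite -(ler_pM2l pi0).
  have -> : pi * (2 * M / y) = M * (pi / (y / 2)) by field; rewrite gt_eqF.
  by move: b1 b2 en2; rewrite !exprMn; lra.
by apply: le_trans key; rewrite ler_peMl//; lra.
Qed.

Lemma scaleE (s : R) z : s%:C * z = (s * Re z) +i* (s * Im z).
Proof. by apply: complexeqP; rewrite !ReImE /=; ring. Qed.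

Definition dilate f (s : R) : C -> C := fun w => f (s%:C * w).

Lemma rl_dilate f s y x : rl (dilate f s) y x = rl f (s * y) (s * x).
Proof. by rewrite /rl /dilate scaleE. Qed.

Lemma il_dilate f s y x : il (dilate f s) y x = il f (s * y) (s * x).
Proof. by rewrite /il /dilate scaleE. Qed.

Lemma energy_scale f M s y : hardy f M -> 0 < s -> 0 < y ->
  (\int[mu]_x (normc (f ((s * x) +i* (s * y))) ^+ 2)%:E <= (M / s)%:E)%E.
Proof.
move=> hf s0 y0; have sy : 0 < s * y by rewrite mulr_gt0.
pose g x := normc (f (x +i* (s * y))) ^+ 2.
have cg : continuous g.
  have h := continuous_normc_line hf sy.
  by move=> x; exact: (cvgM (h x) (h x)).
have g0 x : 0 <= g x by exact: sqr_ge0.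
have := integral_affineT 0 s0 cg g0.
rewrite -/(horizontal_energy f (s * y)) => H; have := hf.2 _ sy; rewrite H.
have -> : (\int[mu]_x (g (0 + s * x))%:E =
    \int[mu]_x (normc (f ((s * x) +i* (s * y))) ^+ 2)%:E)%E.
  by apply: eq_integral => x _; rewrite add0r.
have sV : (0 <= (s^-1)%:E)%E by rewrite lee_fin invr_ge0 ltW.
move=> /(lee_wpmul2l sV); rewrite muleA -EFinM mulVf ?gt_eqF// mul1e -EFinM.
by rewrite [s^-1 * M]mulrC.
Qed.

Lemma hardy_dilate f M s : hardy f M -> 0 < s -> hardy (dilate f s) (M / s).
Proof.
move=> hf s0; split=> [z z0|y y0].
  have [|l dl] := hf.1 (s%:C * z); first by rewrite scaleE /= mulr_gt0.
  by exists (s%:C * l); exact: cderiv_scale.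
rewrite /horizontal_energy; under eq_integral do rewrite /dilate scaleE /=.
exact: energy_scale.
Qed.

Lemma pairing_le f g Mf Mg s y : hardy f Mf -> hardy g Mg -> 0 < s -> 0 < y ->
  `|pairing (dilate f s) g y| <= (Num.sqrt s)^-1 * ((Mf + Mg) / 2).
Proof.
move=> hf hg s0 y0; have hd := hardy_dilate hf s0.
have q0 : 0 < Num.sqrt s by rewrite sqrtr_gt0.
rewrite /pairing; apply: (le_trans (ler_normD _ _)).
have h1 := ip_ineq q0 (L2_rl hd y0) (L2_rl hg y0).
have h2 := ip_ineq q0 (L2_il hd y0) (L2_il hg y0).
apply: (le_trans (lerD h1 h2)).
have e1 := energy_le hd y0; have e2 := energy_le hg y0.
rewrite /energy in e1 e2.
have qV : 0 < (Num.sqrt s)^-1 by rewrite invr_gt0.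
have f1 := ler_wpM2l (ltW q0) e1; have f2 := ler_wpM2l (ltW qV) e2.
have sE : Num.sqrt s * (Mf / s) = (Num.sqrt s)^-1 * Mf.
  rewrite -{2}(sqr_sqrtr (ltW s0)); field; rewrite gt_eqF//.
by move: f1 f2; rewrite sE; lra.
Qed.

Variables sigma kappa : R -> R.

(** The last relation makes [kappa t * |f (sigma t * z)|] comparable to
    [t ^ (-1/2)]; it holds both for [sigma = id], [kappa = 1] and for
    [sigma = kappa = 1 / t]. *)
Definition admissible := forall t : R, 0 < t ->
  [/\ 0 < sigma t, 0 < kappa t, {for t, continuous sigma},
      {for t, continuous kappa} & t * kappa t ^+ 2 = sigma t].

Definition dilate_average f z : C :=
  (\int[mu]_(t in I) (kappa t * rl f (sigma t * Im z) (sigma t * Re z)))%R +i*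
  (\int[mu]_(t in I) (kappa t * il f (sigma t * Im z) (sigma t * Re z)))%R.

Lemma rl_average f y x : rl (dilate_average f) y x =
  (\int[mu]_(t in I) (kappa t * rl f (sigma t * y) (sigma t * x)))%R.
Proof. by []. Qed.

Lemma il_average f y x : il (dilate_average f) y x =
  rl (dilate_average (fun w => - 'i * f w)) y x.
Proof. by rewrite rl_average; apply: eq_Rintegral => t _; rewrite rl_mulNi. Qed.

Let I0 (t : R) : I t -> 0 < t. Proof. by rewrite /= in_itv/= => /andP[]. Qed.

Hypothesis adm : admissible.

Let sigma_gt0 (t : R) : 0 < t -> 0 < sigma t. Proof. by case/adm. Qed.
Let kappa_gt0 (t : R) : 0 < t -> 0 < kappa t. Proof. by case/adm. Qed.
Let sigma_cont (t : R) : 0 < t -> {for t, continuous sigma}. Proof. by case/adm. Qed.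
Let kappa_cont (t : R) : 0 < t -> {for t, continuous kappa}. Proof. by case/adm. Qed.
Let sigma_kappa (t : R) : 0 < t -> t * kappa t ^+ 2 = sigma t. Proof. by case/adm. Qed.

Lemma continuous_dilate_path f M (x y : R) : hardy f M -> 0 < y ->
  forall t : R, 0 < t -> f ((sigma s * x) +i* (sigma s * y)) @[s --> t] -->
    f ((sigma t * x) +i* (sigma t * y)).
Proof.
move=> hf y0 t t0; apply: (@cvg_ccont _ _ (nbhs t)).
  by apply: hardy_ccont hf _ => /=; rewrite mulr_gt0// sigma_gt0.
have cs := sigma_cont t0.
apply: cvg_complex.
- by apply: cvgM; [exact: cs|exact: cvg_cst].
- by apply: cvgM; [exact: cs|exact: cvg_cst].
Qed.

Lemma kappaE t : 0 < t -> kappa t ^+ 2 / sigma t = t^-1.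
Proof.
move=> t0; rewrite -(sigma_kappa t0) invfM mulrCA mulfV ?mulr1//.
by rewrite gt_eqF// exprn_gt0// kappa_gt0.
Qed.

Lemma dilate_sqr_le f M x y t : hardy f M -> 0 < y -> 0 < t ->
  kappa t ^+ 2 * (rl f (sigma t * y) (sigma t * x) ^+ 2 +
    il f (sigma t * y) (sigma t * x) ^+ 2) <= 2 * M / y * t^-1.
Proof.
move=> hf y0 t0; have s0 := sigma_gt0 t0; have sy : 0 < sigma t * y by rewrite mulr_gt0.
apply: (le_trans (ler_wpM2l (sqr_ge0 _) (hardy_pointwise _ hf sy))).
rewrite -(kappaE t0) invfM.
by rewrite le_eqVlt; apply/orP; left; apply/eqP; ring.
Qed.

Lemma dilate_bound f M x y t : hardy f M -> 0 < y -> 0 < t ->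
  `|kappa t * rl f (sigma t * y) (sigma t * x)| <= Num.sqrt (2 * M / y) * invsqrt t.
Proof.
move=> hf y0 t0; have M0 := hardy_ge0 hf.
have c0 : 0 <= 2 * M / y by rewrite divr_ge0 ?mulr_ge0// ltW.
rewrite -(@ler_pXn2r _ 2)// ?nnegrE ?mulr_ge0 ?sqrtr_ge0 ?invsqrt_ge0//.
rewrite -normrX ger0_norm ?sqr_ge0// [leRHS]exprMn sqr_sqrtr// /invsqrt exprVn.
rewrite sqr_sqrtr ?(ltW t0)// exprMn; apply: le_trans (dilate_sqr_le x hf y0 t0).
by rewrite ler_wpM2l ?sqr_ge0// lerDl sqr_ge0.
Qed.

Lemma measurable_dilate f M x y : hardy f M -> 0 < y ->
  measurable_fun I (fun t => kappa t * rl f (sigma t * y) (sigma t * x)).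
Proof.
move=> hf y0; apply: open_measurable_I => t t0.
apply: cvgM; first exact: kappa_cont.
by apply: cvg_Re; exact: continuous_dilate_path hf y0 t t0.
Qed.

Lemma integrable_dilate f M x y : hardy f M -> 0 < y ->
  mu.-integrable I (fun t => (kappa t * rl f (sigma t * y) (sigma t * x))%:E).
Proof.
move=> hf y0.
have iw := integrableZI (Num.sqrt (2 * M / y)) (integrable_invsqrt R).
apply: le_integrableI iw; first exact: measurable_dilate hf y0.
by move=> t t0 _; exact: (dilate_bound x hf y0 t0).
Qed.

Definition weight f x y t :=
  Num.sqrt t * (kappa t ^+ 2 * normc (f ((sigma t * x) +i* (sigma t * y))) ^+ 2).

Lemma weight_ge0 f x y t : 0 <= weight f x y t.
Proof. by rewrite mulr_ge0 ?sqrtr_ge0// mulr_ge0 ?sqr_ge0. Qed.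

Lemma weightE f x y t : weight f x y t =
  Num.sqrt t * (kappa t ^+ 2 * rl f (sigma t * y) (sigma t * x) ^+ 2) +
  Num.sqrt t * (kappa t ^+ 2 * il f (sigma t * y) (sigma t * x) ^+ 2).
Proof. by rewrite /weight normc_sqr -!mulrDr. Qed.

Lemma sqrt_div (t : R) : 0 < t -> Num.sqrt t * t^-1 = invsqrt t.
Proof.
move=> t0; rewrite -{2}(sqr_sqrtr (ltW t0)) /invsqrt.
by field; rewrite gt_eqF// sqrtr_gt0.
Qed.

Lemma integrable_weight f M x y : hardy f M -> 0 < y -> mu.-integrable I (fun t =>
  (Num.sqrt t * (kappa t ^+ 2 * rl f (sigma t * y) (sigma t * x) ^+ 2))%:E).
Proof.
move=> hf y0.
have iw := integrableZI (2 * M / y) (integrable_invsqrt R).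
apply: le_integrableI iw.
  apply: open_measurable_I => t t0; apply: cvgM; first exact: sqrt_continuous.
  have ck := kappa_cont t0.
  have cr : {for t, continuous (fun t => rl f (sigma t * y) (sigma t * x))}.
    by apply: cvg_Re; exact: continuous_dilate_path hf y0 t t0.
  exact: (cvgM (cvgM ck ck) (cvgM cr cr)).
move=> t t0 _.
rewrite ger0_norm; last by rewrite mulr_ge0 ?sqrtr_ge0// mulr_ge0 ?sqr_ge0.
rewrite -(sqrt_div t0) [leRHS]mulrCA.
rewrite ler_wpM2l ?sqrtr_ge0//; apply: le_trans (dilate_sqr_le x hf y0 t0).
by rewrite ler_wpM2l ?sqr_ge0// lerDl sqr_ge0.
Qed.

(** The Cauchy-Schwarz inequality with the weight [t ^ (-1/2)], whose integral
    is 2, in the form of the arithmetic-geometric inequality with an optimal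
    parameter. *)
Lemma dilate_average_sqr f M x y : hardy f M -> 0 < y ->
  ((\int[mu]_(t in I) (kappa t * rl f (sigma t * y) (sigma t * x))) ^+ 2 <=
  2 * \int[mu]_(t in I)
     (Num.sqrt t * (kappa t ^+ 2 * rl f (sigma t * y) (sigma t * x) ^+ 2)))%R.
Proof.
move=> hf y0.
have i1 := integrable_dilate x hf y0; have i2 := integrable_weight x hf y0.
set A := (\int[mu]_(t in I) _)%R; set S := (\int[mu]_(t in I) _)%R in |- *.
have S0 : 0 <= S.
  by apply: Rintegral_ge0 => t _; rewrite mulr_ge0 ?sqrtr_ge0// mulr_ge0 ?sqr_ge0.
have iw := integrable_invsqrt R.
have W2 : (\int[mu]_(t in I) invsqrt t)%R <= 2.
  rewrite -lee_fin /Rintegral fineK; first exact: integral_invsqrt.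
  exact: integrable_fin_num.
have key (l : R) : 0 < l -> 2 * `|A| <= 2 * l + l^-1 * S.
  move=> l0; have lV : 0 < l^-1 by rewrite invr_gt0.
  have i3 : mu.-integrable I (fun t => (l * invsqrt t)%:E).
    exact: integrableZI.
  have i4 := integrableZI l^-1 i2.
  have i5 : mu.-integrable I (fun t => (l * invsqrt t + l^-1 *
     (Num.sqrt t * (kappa t ^+ 2 * rl f (sigma t * y) (sigma t * x) ^+ 2)))%:E).
    exact: integrableDI.
  apply: (@le_trans _ _ (\int[mu]_(t in I) (l * invsqrt t + l^-1 *
     (Num.sqrt t * (kappa t ^+ 2 * rl f (sigma t * y) (sigma t * x) ^+ 2))))%R).
    apply: (@le_trans _ _ (2 * \int[mu]_(t in I)
       `|kappa t * rl f (sigma t * y) (sigma t * x)|)%R).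
      by rewrite ler_wpM2l// le_normr_Rintegral.
    have i6 := integrable_norm i1.
    rewrite -RintegralZl//; apply: le_Rintegral => //.
      exact: (integrableZI 2 i6).
    move=> t /I0 t0; rewrite -exprMn.
    have q0 : 0 < Num.sqrt t by rewrite sqrtr_gt0.
    move: (kappa t * _) => a; rewrite /invsqrt.
    have a2 : a ^+ 2 = `|a| ^+ 2 by rewrite -normrX ger0_norm ?sqr_ge0.
    rewrite a2; move: (Num.sqrt t) q0 (normr_ge0 a) => q q0; move: `|a| => b b0.
    have lq : 0 < l * q by rewrite mulr_gt0.
    rewrite -subr_ge0.
    have -> : l / q + l^-1 * (q * b ^+ 2) - 2 * b = (l * q)^-1 * (l - q * b) ^+ 2.
      by field; rewrite !gt_eqF.
    by rewrite mulr_ge0 ?sqr_ge0// invr_ge0 ltW.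
  rewrite RintegralD// !RintegralZl//.
  by rewrite -/S lerD2r [leRHS]mulrC ler_wpM2l// ltW.
have [->|A0] := eqVneq A 0; first by rewrite expr0n mulr_ge0.
have a0 : 0 < `|A| by rewrite normr_gt0.
rewrite -[A ^+ 2]ger0_norm ?sqr_ge0// normrX.
have := ler_wpM2r (ltW a0) (key (`|A| / 2) (divr_gt0 a0 (ltr0Sn _ _))).
have -> : (2 * (`|A| / 2) + (`|A| / 2)^-1 * S) * `|A| = `|A| ^+ 2 + 2 * S.
  by field; rewrite gt_eqF.
by rewrite -mulrA -expr2 [leLHS]mulr_natl mulr2n lerD2l.
Qed.

Let halfU : set (R * R) := [set p | 0 < p.2].

Let halfU_open : box_open halfU.
Proof. by move=> p p0; exists p.2 => // q _; rewrite ltr_norml /halfU /= => ?; lra. Qed.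

Let halfU_I : [set: R] `*` I `<=` halfU.
Proof. by move=> [x t] [_] /= /I0. Qed.

Let measurable_integral_line (h : R * R -> R) : box_continuous halfU h ->
  (forall p, 0 <= h p) -> measurable_fun I (fun t => \int[mu]_x (h (x, t))%:E)%E.
Proof.
move=> ch h0; pose V := [set p : R * R | 0 < p.1].
have oV : box_open V.
  move=> [s x] /(halfU_open (p := (x, s)))[d d0 H].
  by exists d => // q q1 q2; exact: (H (q.2, q.1)).
have cV : box_continuous V (fun p => h (p.2, p.1)).
  move=> [s x] s0 e e0; have [d d0 H] := ch (x, s) s0 e e0.
  by exists d => // q q1 q2; exact: (H (q.2, q.1)).
apply: (@measurable_integral1 _ V (fun p => h (p.2, p.1)) I setT) => //.
by move=> [s x] [/I0].
Qed.

Let cvg_snd_at (k : R -> R) (p : R * R) : {for p.2, continuous k} ->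
  {for p, continuous (fun q : R * R => k q.2)}.
Proof.
move=> ck; have c2 : snd q @[q --> p] --> p.2 by exact: cvg_snd.
exact: (@cvg_comp _ _ _ snd k _ _ _ c2 ck).
Qed.

Lemma continuous_dilate2 f M y p : hardy f M -> 0 < y -> 0 < p.2 ->
  {for p, continuous (fun q : R * R => f ((sigma q.2 * q.1) +i* (sigma q.2 * y)))}.
Proof.
move=> hf y0 p0; have cs := cvg_snd_at (sigma_cont p0).
apply: (@cvg_ccont _ _ (nbhs p)).
  by apply: hardy_ccont hf _ => /=; rewrite mulr_gt0// sigma_gt0.
apply: cvg_complex.
- by apply: cvgM; [exact: cs|exact: cvg_fst].
- by apply: cvgM; [exact: cs|exact: cvg_cst].
Qed.

Lemma continuous_weight f M y p : hardy f M -> 0 < y -> 0 < p.2 ->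
  {for p, continuous (fun q : R * R => weight f q.1 y q.2)}.
Proof.
move=> hf y0 p0; have ck := cvg_snd_at (kappa_cont p0).
have cn := cvg_normc (continuous_dilate2 hf y0 p0).
have cs := cvg_snd_at (@sqrt_continuous R p.2).
exact: (cvgM cs (cvgM (cvgM ck ck) (cvgM cn cn))).
Qed.

Lemma integral_weight_le f M y t : hardy f M -> 0 < y -> 0 < t ->
  (\int[mu]_x (weight f x y t)%:E <= (M * invsqrt t)%:E)%E.
Proof.
move=> hf y0 t0; have s0 := sigma_gt0 t0.
have c0 : (0 <= (Num.sqrt t * kappa t ^+ 2)%:E)%E by rewrite lee_fin mulr_ge0 ?sqrtr_ge0 ?sqr_ge0.
under eq_integral do rewrite /weight mulrA EFinM.
rewrite ge0_integralZl//; last 2 first.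
- apply/measurable_EFinP; have hd := hardy_dilate hf s0.
  have := measurable_energy_density hd y0.
  by congr measurable_fun; apply/funext => x; rewrite /dilate scaleE.
- by move=> x _; rewrite lee_fin sqr_ge0.
apply: (le_trans (lee_wpmul2l c0 (energy_scale hf s0 y0))).
rewrite -EFinM lee_fin le_eqVlt; apply/orP; left; apply/eqP.
by rewrite -(sqrt_div t0) -(kappaE t0); ring.
Qed.

Lemma dilate_average_energy f M (y : R) : hardy f M -> 0 < y ->
  measurable_fun setT (fun x : R => normc (dilate_average f (x +i* y)) ^+ 2) ->
  (horizontal_energy (dilate_average f) y <= (4 * M)%:E)%E.
Proof.
move=> hf y0 mT; have M0 := hardy_ge0 hf; have iw := integrable_invsqrt R.
have cw : box_continuous halfU (fun p => weight f p.1 y p.2).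
  by apply: continuous_box => p p0; exact: continuous_weight hf y0 p0.
have w0 p : 0 <= weight f p.1 y p.2 by exact: weight_ge0.
have mI : measurable I by exact: measurable_itv.
pose W x := (\int[mu]_(t in I) (weight f x y t)%:E)%E.
have mW : measurable_fun setT W.
  exact: (@measurable_integral1 _ halfU (fun p => weight f p.1 y p.2) setT I).
have W0 x : (0 <= W x)%E by apply: integral_ge0 => t _; rewrite lee_fin weight_ge0.
have i2 := integrable_weight.
have mMw : measurable_fun I (fun t => (M * invsqrt t)%:E).
  by have /integrableP[] := integrableZI M iw.
apply: (@le_trans _ _ (\int[mu]_x (2%:E * W x))%E).
  apply: ge0_le_integral => //.
  - by move=> x _; rewrite lee_fin sqr_ge0.
  - exact/measurable_EFinP.
  - exact: measurable_funeM.
  - move=> x _; rewrite normc_sqr /dilate_average /=.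
    have hf' := hardy_mulNi hf.
    have r1 := dilate_average_sqr x hf y0; have j1 := i2 _ _ x _ hf y0.
    have r2 := dilate_average_sqr x hf' y0; have j2 := i2 _ _ x _ hf' y0.
    have -> : W x = ((\int[mu]_(t in I) (Num.sqrt t * (kappa t ^+ 2 *
          rl f (sigma t * y) (sigma t * x) ^+ 2)))%R +
        (\int[mu]_(t in I) (Num.sqrt t * (kappa t ^+ 2 *
          rl (fun w => - 'i * f w) (sigma t * y) (sigma t * x) ^+ 2)))%R)%:E.
      rewrite EFinD /Rintegral !fineK ?integrable_fin_num// -integralD//.
      by apply: eq_integral => t _; rewrite -EFinD rl_mulNi -weightE.
    rewrite -EFinM lee_fin mulrDr; apply: lerD r1 _; apply: le_trans r2.
    rewrite le_eqVlt; apply/orP; left; apply/eqP; congr (_ ^+ 2).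
    by apply: eq_Rintegral => t _; rewrite rl_mulNi.
rewrite ge0_integralZl//.
have -> : (\int[mu]_x W x = \int[mu]_(t in I) \int[mu]_x (weight f x y t)%:E)%E.
  exact: (@tonelli_box _ halfU (fun p => weight f p.1 y p.2) setT I).
apply: (@le_trans _ _ (2%:E * \int[mu]_(t in I) (M * invsqrt t)%:E)%E).
  apply: lee_wpmul2l; first by rewrite lee_fin.
  apply: ge0_le_integral => //.
  - by move=> t _; apply: integral_ge0 => x _; rewrite lee_fin weight_ge0.
  - exact: (measurable_integral_line (h := fun p => weight f p.1 y p.2)).
  - by move=> t /I0 t0; exact: integral_weight_le.
under eq_integral do rewrite EFinM.
rewrite ge0_integralZl//; last 2 first.
- by apply: (measurable_int mu); exact: iw.
- by move=> t _; rewrite lee_fin invsqrt_ge0.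
rewrite muleA -EFinM (le_trans (lee_wpmul2l _ (integral_invsqrt R)))//.
  by rewrite lee_fin mulr_ge0.
by rewrite -EFinM lee_fin; lra.
Qed.

Lemma ip_dilate_le f g M N y t : hardy f M -> hardy g N -> 0 < y -> 0 < t ->
  `|kappa t * ip (rl (dilate f (sigma t)) y) (rl g y)| <= (M + N) / 2 * invsqrt t.
Proof.
move=> hf hg y0 t0; have s0 := sigma_gt0 t0; have k0 := kappa_gt0 t0.
have hd := hardy_dilate hf s0; have q0 : 0 < Num.sqrt t by rewrite sqrtr_gt0.
rewrite normrM gtr0_norm//.
have kq : 0 < kappa t * Num.sqrt t by rewrite mulr_gt0.
have kqV : 0 < (kappa t * Num.sqrt t)^-1 by rewrite invr_gt0.
have := ip_ineq kq (L2_rl hd y0) (L2_rl hg y0).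
have e1 := ler_wpM2l (ltW kq) (ip_rl_le hd y0).
have e2 := ler_wpM2l (ltW kqV) (ip_rl_le hg y0).
have ks : kappa t * (kappa t * Num.sqrt t * (M / sigma t)) = M * invsqrt t.
  by rewrite -(sqrt_div t0) -(kappaE t0); ring.
have kg : kappa t * ((kappa t * Num.sqrt t)^-1 * N) = N * invsqrt t.
  by rewrite /invsqrt; field; rewrite !gt_eqF.
move=> h; have {}h : `|ip (rl (dilate f (sigma t)) y) (rl g y)| <=
    (kappa t * Num.sqrt t * (M / sigma t) + (kappa t * Num.sqrt t)^-1 * N) / 2 by lra.
apply: (le_trans (ler_wpM2l (ltW k0) h)).
have -> : kappa t * ((kappa t * Num.sqrt t * (M / sigma t) +
    (kappa t * Num.sqrt t)^-1 * N) / 2) = (M * invsqrt t + N * invsqrt t) / 2.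
  by rewrite -ks -kg; ring.
by rewrite -mulrDl mulrAC.
Qed.

Let cvg_fst_at (k : R -> R) (p : R * R) : {for p.1, continuous k} ->
  {for p, continuous (fun q : R * R => k q.1)}.
Proof.
move=> ck; have c1 : fst q @[q --> p] --> p.1 by exact: cvg_fst.
exact: (@cvg_comp _ _ _ fst k _ _ _ c1 ck).
Qed.

Lemma integral_dilate_product_le f g (M N y t : R) :
  hardy f M -> hardy g N -> 0 < y -> 0 < t ->
  (\int[mu]_x `|kappa t * rl f (sigma t * y) (sigma t * x) * rl g y x|%:E <=
   ((M + N) / 2 * invsqrt t)%:E)%E.
Proof.
move=> hf hg y0 t0; have s0 := sigma_gt0 t0; have hd := hardy_dilate hf s0.
have q0 : 0 < Num.sqrt t by rewrite sqrtr_gt0.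
have v0 : 0 <= 2^-1 * invsqrt t by rewrite mulr_ge0 ?invsqrt_ge0.
have mw : measurable_fun setT (fun x : R => weight f x y t).
  apply: measurable_funM => //; apply: measurable_funM => //.
  have := measurable_energy_density hd y0.
  by congr measurable_fun; apply/funext => x; rewrite /dilate scaleE.
have mg := measurable_energy_density hg y0.
pose b (x : R) := 2^-1 * weight f x y t + (2^-1 * invsqrt t) * normc (g (x +i* y)) ^+ 2.
apply: (@le_trans _ _ (\int[mu]_x (b x)%:E)%E).
  apply: ge0_le_integral => //.
  - apply/measurable_EFinP; apply: measurableT_comp => //.
    apply: measurable_funM; last exact: (L2_measurable (L2_rl hg y0)).
    apply: measurable_funM => //; have := L2_measurable (L2_rl hd y0).
    by congr measurable_fun; apply/funext => x; rewrite rl_dilate.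
  - by apply/measurable_EFinP; apply: measurable_funD; apply: measurable_funM.
  - move=> x _; rewrite lee_fin /b /weight !normc_sqr.
    rewrite -[rl f _ _]/(Re (f ((sigma t * x) +i* (sigma t * y)))).
    rewrite -[rl g _ _]/(Re (g (x +i* y))) !normrM.
    move: (Re (f _)) (Im (f _)) (Re (g _)) (Im (g _)) => u u' v v'.
    rewrite /invsqrt; move: (Num.sqrt t) (kappa t) q0 => q k q0.
    rewrite -(real_normK (num_real k)) -(real_normK (num_real u)) -(real_normK (num_real v)).
    move: `|k| `|u| `|v| => k1 u1 v1; rewrite -subr_ge0.
    have -> : 2^-1 * (q * (k1 ^+ 2 * (u1 ^+ 2 + u' ^+ 2))) +
        2^-1 * q^-1 * (v1 ^+ 2 + v' ^+ 2) - k1 * u1 * v1 =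
        2^-1 * (q^-1 * ((q * k1 * u1 - v1) ^+ 2 + v' ^+ 2) + q * (k1 * u') ^+ 2).
      by field; rewrite gt_eqF.
    rewrite mulr_ge0// addr_ge0// mulr_ge0 ?addr_ge0 ?sqr_ge0 ?invr_ge0//; exact: ltW.
have w0 (x : R) : 0 <= weight f x y t by exact: weight_ge0.
have mw' : measurable_fun setT (fun x => (weight f x y t)%:E) by exact/measurable_EFinP.
have mg' : measurable_fun setT (fun x : R => (normc (g (x +i* y)) ^+ 2)%:E).
  exact/measurable_EFinP.
have bE x : (b x)%:E = ((2^-1)%:E * (weight f x y t)%:E +
    (2^-1 * invsqrt t)%:E * (normc (g (x +i* y)) ^+ 2)%:E)%E.
  by rewrite /b EFinD !EFinM.
under eq_integral do rewrite bE.
rewrite ge0_integralD//; last 4 first.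
- by move=> x _; rewrite mule_ge0// lee_fin.
- exact: measurable_funeM.
- by move=> x _; rewrite mule_ge0// lee_fin// sqr_ge0.
- exact: measurable_funeM.
rewrite !ge0_integralZl//; try by move=> x _; rewrite lee_fin// sqr_ge0.
have h0 : (0 <= (2^-1 : R)%:E)%E by rewrite lee_fin.
have h1 := lee_wpmul2l h0 (integral_weight_le hf y0 t0).
have v0' : (0 <= (2^-1 * invsqrt t)%:E)%E by rewrite lee_fin.
apply: (le_trans (leeD h1 (lee_wpmul2l v0' (hg.2 y y0)))).
by rewrite -!EFinM -EFinD lee_fin; lra.
Qed.

Lemma ip_dilate_average f g (M N y : R) : hardy f M -> hardy g N -> 0 < y ->
  mu.-integrable I (fun t => (kappa t * ip (rl (dilate f (sigma t)) y) (rl g y))%:E) /\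
  ip (rl (dilate_average f) y) (rl g y) =
    (\int[mu]_(t in I) (kappa t * ip (rl (dilate f (sigma t)) y) (rl g y)))%R.
Proof.
move=> hf hg y0; have iw := integrable_invsqrt R.
have mI : measurable I by exact: measurable_itv.
pose h (p : R * R) := kappa p.2 * rl f (sigma p.2 * y) (sigma p.2 * p.1) * rl g y p.1.
have ch : box_continuous halfU h.
  apply: continuous_box => p p0; have ck := cvg_snd_at (kappa_cont p0).
  have cf := cvg_Re (continuous_dilate2 hf y0 p0).
  have cg := cvg_fst_at (continuous_rl hg y0 (x := p.1)).
  exact: (cvgM (cvgM ck cf) cg).
have cha : box_continuous halfU (fun p => `|h p|).
  move=> p p0 e e0; have [d d0 H] := ch p p0 e e0; exists d => // q q1 q2.
  by apply: le_lt_trans (H q q1 q2); rewrite ler_dist_dist.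
have hE t : 0 < t -> (\int[mu]_x (h (x, t))%:E)%E =
    (kappa t * ip (rl (dilate f (sigma t)) y) (rl g y))%:E.
  move=> t0; have hd := hardy_dilate hf (sigma_gt0 t0).
  have i1 := L2_mul_integrable (L2_rl hd y0) (L2_rl hg y0).
  rewrite /ip EFinM /Rintegral fineK ?integrable_fin_num// -integralZl//.
  by apply: eq_integral => x _; rewrite /h /= rl_dilate -EFinM mulrA.
have hle t : 0 < t -> (\int[mu]_x `|h (x, t)|%:E <= ((M + N) / 2 * invsqrt t)%:E)%E.
  exact: integral_dilate_product_le.
have MN : (\int[mu]_(t in I) ((M + N) / 2 * invsqrt t)%:E < +oo)%E.
  suff : (\int[mu]_(t in I) ((M + N) / 2 * invsqrt t)%:E)%E \is a fin_num.
    by rewrite fin_numElt => /andP[].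
  by apply: integrable_fin_num; [exact: measurable_itv|exact: integrableZI].
have hoo : (\int[mu]_(x in setT) \int[mu]_(t in I) `|h (x, t)|%:E < +oo)%E.
  rewrite (@tonelli_box _ halfU (fun p => `|h p|) setT I halfU_open cha measurableT mI halfU_I)//.
  apply: le_lt_trans MN; apply: ge0_le_integral => //.
  - by move=> t _; apply: integral_ge0 => x _; rewrite lee_fin.
  - exact: (measurable_integral_line (h := fun p => `|h p|)).
  - by have /integrableP[] := integrableZI ((M + N) / 2) iw.
  - by move=> t /I0; exact: hle.
have mh := measurable_integral2 halfU_open ch measurableT mI halfU_I hoo.
have P : mu.-integrable I (fun t => (kappa t * ip (rl (dilate f (sigma t)) y) (rl g y))%:E).
  apply: le_integrableI (integrableZI ((M + N) / 2) iw).
    apply/measurable_EFinP; apply: eq_measurable_fun mh => t /[!inE] /I0 t0.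
    exact: hE.
  by move=> t t0 _; exact: (ip_dilate_le hf hg y0 t0).
split=> //.
have := fubini_box halfU_open ch measurableT mI halfU_I hoo.
rewrite /ip /Rintegral => H; congr fine; move: H; rewrite /h /=.
have -> : (\int[mu]_(t in I) \int[mu]_x (h (x, t))%:E =
    \int[mu]_(t in I) (kappa t * ip (rl (dilate f (sigma t)) y) (rl g y))%:E)%E.
  by apply: eq_integral => t /[!inE] /I0; exact: hE.
move=> <-; apply: eq_integral => x _.
rewrite rl_average /Rintegral EFinM fineK; last first.
  by apply: integrable_fin_num => //; exact: integrable_dilate hf y0.
rewrite -integralZr//; last exact: integrable_dilate hf y0.
Qed.

End DilateAverage.

(** * Holomorphy of the averages *)

Section AverageHolomorphy.
Variable R : realType.
Local Notation C := R[i].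
Local Notation mu := (@lebesgue_measure R).
Local Notation Re := (@complex.Re R).
Local Notation Im := (@complex.Im R).
Local Notation I := [set` `](0 : R)%R, 1%R]].
Implicit Types (f : C -> C) (M : R) (z w : C).

Lemma primitive_exists f : (forall z, 0 < Im z -> exists l, cderiv f z l) ->
  exists Q, forall z, 0 < Im z -> cderiv Q z (f z).
Proof.
move=> df; exists (segment_integral f 'i) => z z0.
apply: (@cderiv_segment_integral _ f 0 (Num.max 1 (Im z) + 1)).
- by move=> w /andP[w0 _]; exact: df.
- by rewrite /strip /= ltr01 ltr_pwDr// le_max lexx.
- by rewrite /strip /= z0 ltr_pwDr// le_max lexx orbT.
Qed.

Lemma Re_increment_le (Q q : C -> C) z w (s L m : R) :
  (forall z, 0 < Im z -> cderiv Q z (q z)) -> 0 < s -> 0 < m ->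
  m <= Im z -> m <= Im w ->
  (forall u, m <= Im u -> s * normc (q (s%:C * u)) <= L) ->
  `|Re (Q (s%:C * z)) - Re (Q (s%:C * w))| <= normc (z - w) * L.
Proof.
move=> dQ s0 m0 mz mw qL.
pose a : C := s%:C * w; pose b : C := s%:C * (z - w).
have pE (t : R) : a + b * t%:C = s%:C * (w + (z - w) * t%:C) by rewrite /a /b; ring.
have mt (t : R) : 0 <= t <= 1 -> m <= Im (w + (z - w) * t%:C).
  by rewrite Im_seg => /andP[t0 t1]; nra.
have dU (t : R) : 0 <= t <= 1 -> is_derive t 1 (fun t : R => Re (Q (a + b * t%:C)))
    (Re (q (a + b * t%:C) * b)).
  move=> t01; apply: is_derive_Re_line; apply: dQ; rewrite pE scaleE /= mulr_gt0//.
  exact: lt_le_trans m0 (mt t t01).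
have [t /[!in_itv]/= t01 ] : exists2 t : R, t \in `[0, 1] &
    Re (Q (a + b * 1%:C)) - Re (Q (a + b * 0%:C)) = Re (q (a + b * t%:C) * b) * (1 - 0).
  apply: (@MVT_segment _ (fun t : R => Re (Q (a + b * t%:C)))
     (fun t : R => Re (q (a + b * t%:C) * b)) 0 1) => //.
    by move=> t /[!in_itv]/= /andP[t0 t1]; apply: dU; rewrite !ltW.
  by apply: continuous_on_within => t t01; apply: is_derive_continuous (dU t t01).
have -> : a + b * 1%:C = s%:C * z by rewrite /a /b; ring.
have -> : a + b * 0%:C = s%:C * w by rewrite /a /b; ring.
rewrite subr0 mulr1 => ->; apply: (le_trans (Re_le_normc _)).
rewrite pE normcM normcM normc_real gtr0_norm//.
rewrite mulrA [leLHS]mulrC ler_wpM2l ?normc_ge0// [leLHS]mulrC.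
exact/qL/mt.
Qed.

Section Primitive.
Variables sigma kappa dsigma : R -> R.
Hypothesis adm : admissible sigma kappa.
Hypothesis sigma1 : sigma 1 = 1.
Hypothesis dsigmaP : forall t : R, 0 < t -> is_derive t 1 sigma (dsigma t).
Local Notation T := (dilate_average sigma kappa).

(** The derivative of [Q (sigma t * z)] in [t] is the integrand, up to the
    factor [c z], so the integral over [[e, 1]] is an increment of [Q]; the
    end point with [t = e] contributes a constant in the limit, because two
    such end points for different [z] have close values of [Q]. *)
Lemma Re_average_primitive f M (Q q c : C -> C) : hardy f M ->
  (forall z, 0 < Im z -> cderiv Q z (q z)) ->
  (forall z (t : R), 0 < Im z -> 0 < t -> q ((sigma t)%:C * z) * z * (dsigma t)%:C =
     c z * ((kappa t)%:C * f ((sigma t)%:C * z))) ->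
  (forall m : R, 0 < m -> exists K, forall t : R, 0 < t -> t <= 1 -> forall u, m <= Im u ->
     sigma t * normc (q ((sigma t)%:C * u)) <= K * Num.sqrt t) ->
  exists k : R, forall z, 0 < Im z -> Re (c z * T f z) = Re (Q z) - k.
Proof.
move=> hf dQ qc qK.
pose e (n : nat) : R := n.+1%:R^-1.
have e0 n : 0 < e n by rewrite invr_gt0.
have e1 n : e n <= 1 by rewrite invf_le1// ler1n.
have s0 (t : R) : 0 < t -> 0 < sigma t by case/adm.
pose E z n : R := Re (Q ((sigma (e n))%:C * z)).
have lim z : 0 < Im z -> E z n @[n --> \oo] --> Re (Q z) - Re (c z * T f z).
  move=> z0.
  pose g (t : R) := Re (c z) * (kappa t * rl f (sigma t * Im z) (sigma t * Re z)) +
    (- Im (c z)) * (kappa t * il f (sigma t * Im z) (sigma t * Re z)).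
  have i1 := integrable_dilate adm (Re z) hf z0.
  have i2 : mu.-integrable I (fun t => (kappa t * il f (sigma t * Im z) (sigma t * Re z))%:E).
    have := integrable_dilate adm (Re z) (hardy_mulNi hf) z0.
    by congr integrable; apply/funext => t; rewrite rl_mulNi.
  have ig : mu.-integrable I (EFin \o g).
    by apply: integrableDI; apply: integrableZI.
  have gE : (\int[mu]_(t in I) g t)%R = Re (c z * T f z).
    rewrite RintegralD//; try exact: integrableZI.
    rewrite !RintegralZl//.
    by rewrite ReM mulNr.
  have dE (t : R) : 0 < t -> is_derive t 1 (fun t => Re (Q ((sigma t)%:C * z))) (g t).
    move=> t0; have /dsigmaP ds := t0.
    have st : 0 < Im ((sigma t)%:C * z) by rewrite scaleE /= mulr_gt0// s0.
    have dl : is_derive (sigma t) 1 (fun s : R => Re (Q (0 + z * s%:C)))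
        (Re (q ((sigma t)%:C * z) * z)).
      apply: is_derive_Re_line; rewrite add0r mulrC; exact: dQ.
    have := is_derive1_comp dl ds.
    have -> : Re (q ((sigma t)%:C * z) * z) * dsigma t = g t.
      transitivity (Re (q ((sigma t)%:C * z) * z * (dsigma t)%:C)).
        by rewrite !ReM /= mulr0 subr0.
      by rewrite qc// /g /rl /il !scaleE ReM /=; ring.
    by congr is_derive; apply/funext => s /=; rewrite add0r mulrC.
  have cg n : continuous_on (e n) 1 g.
    move=> t /andP[t0 _]; have {}t0 : 0 < t by exact: lt_le_trans t0.
    have [_ _ cs ck _] := adm t0.
    have cf := continuous_dilate_path adm (x := Re z) hf z0 t0.
    apply: cvgD; apply: cvgM; try exact: cvg_cst.
    - by apply: cvgM; [exact: ck|exact: cvg_Re cf].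
    - by apply: cvgM; [exact: ck|exact: cvg_Im cf].
  have incr n : (\int[mu]_(t in `[e n, 1]) g t)%R = Re (Q z) - E z n.
    have dE' (t : R) : e n <= t <= 1 -> is_derive t 1 (fun t => Re (Q ((sigma t)%:C * z))) (g t).
      by move=> /andP[t0 _]; apply: dE; exact: lt_le_trans t0.
    have := Rintegral_derivative (e1 n) dE' (cg n).
    by rewrite sigma1 mul1r.
  have := Rintegral_shrink ig; rewrite gE => H.
  have -> : E z = (fun n => Re (Q z) - (\int[mu]_(t in `[n.+1%:R^-1, 1]) g t)%R).
    by apply/funext => n; rewrite -/(e n) incr; ring.
  by apply: cvgB; [exact: cvg_cst|exact: H].
have dif z w : 0 < Im z -> 0 < Im w -> E z n - E w n @[n --> \oo] --> (0 : R).
  move=> z0 w0; pose m := Num.min (Im z) (Im w).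
  have m0 : 0 < m by rewrite lt_min z0.
  have [K HK] := qK m m0.
  have cz : normc (z - w) * (K * Num.sqrt (e n)) @[n --> \oo] --> (0 : R).
    rewrite [X in _ --> X](_ : _ = normc (z - w) * (K * Num.sqrt 0)); last first.
      by rewrite sqrtr0 !mulr0.
    apply: cvgM; first exact: cvg_cst.
    apply: cvgM; first exact: cvg_cst.
    apply: (@cvg_comp _ _ _ e (@Num.sqrt R)); last exact: sqrt_continuous.
    exact: cvg_harmonic.
  apply/cvgr0Pnorm_lt => d d0; move/cvgr0Pnorm_lt : cz => /(_ _ d0).
  apply: filterS => n; apply: le_lt_trans.
  apply: le_trans (ler_norm _).
  apply: (Re_increment_le dQ (s0 _ (e0 n)) m0); rewrite ?ge_min ?lexx ?orbT//.
  by move=> u mu_; exact: HK.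
pose p : C := 0 +i* 1; have p0 : 0 < Im p by exact: ltr01.
exists (Re (Q p) - Re (c p * T f p)) => z z0.
have h2 : E z n - E p n @[n --> \oo] -->
    Re (Q z) - Re (c z * T f z) - (Re (Q p) - Re (c p * T f p)).
  by apply: cvgB; exact: lim.
have h : 0 = Re (Q z) - Re (c z * T f z) - (Re (Q p) - Re (c p * T f p)) :> R.
  exact: cvg_unique _ (dif z p z0 p0) h2.
move: h; move: (Re (Q z)) (Re (c z * _)) (Re (Q p)) (Re (c p * _)) => a b a' b' h.
by lra.
Qed.

Lemma average_primitive f M (Q q c : C -> C) : hardy f M ->
  (forall z, 0 < Im z -> cderiv Q z (q z)) ->
  (forall z (t : R), 0 < Im z -> 0 < t -> q ((sigma t)%:C * z) * z * (dsigma t)%:C =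
     c z * ((kappa t)%:C * f ((sigma t)%:C * z))) ->
  (forall m : R, 0 < m -> exists K, forall t : R, 0 < t -> t <= 1 -> forall u, m <= Im u ->
     sigma t * normc (q ((sigma t)%:C * u)) <= K * Num.sqrt t) ->
  exists k : C, forall z, 0 < Im z -> c z * T f z = Q z - k.
Proof.
move=> hf dQ qc qK.
have [k1 H1] := Re_average_primitive hf dQ qc qK.
have [||m m0|k2 H2] := @Re_average_primitive f M (fun z => - 'i * Q z)
    (fun z => - 'i * q z) (fun z => - 'i * c z) hf.
- by move=> z /dQ; exact: cderivZ.
- by move=> z t z0 t0; rewrite -!mulrA -(qc z t z0 t0) -!mulrA.
- have [K HK] := qK m m0; exists K => t t0 t1 u um.
  have i1 : normc (- 'i : C) = 1 by rewrite normcN /= expr0n expr1n add0r sqrtr1.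
  by rewrite normcM i1 mul1r HK.
exists (k1 +i* k2) => z z0; have := H1 z z0; have := H2 z z0.
move: (T f z) (Q z) (c z) => t p d h2 h1.
apply: complexeqP; first by rewrite h1 !ReImE.
by move: h2; rewrite !ReImE /=; lra.
Qed.

End Primitive.

Lemma hardy_average sigma kappa f M : admissible sigma kappa -> hardy f M ->
  (forall z, 0 < Im z -> exists l, cderiv (dilate_average sigma kappa f) z l) ->
  hardy (dilate_average sigma kappa f) (4 * M).
Proof.
move=> adm hf dT; split=> // y y0; apply: (dilate_average_energy adm hf y0).
apply: measurable_funX; apply: continuous_measurable_fun => x.
apply: cvg_normc; apply: continuous_at_horizontal.
by have [l] := dT (x +i* y) y0; exact: cderiv_ccont.
Qed.

(** On a function of the Hardy class, the values are the integrals of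
    [f (t z)] and of [f (z / t) / t] over [0 < t <= 1]. The second operator is
    the adjoint of the first one. *)
Definition inner_average : (C -> C) -> C -> C := dilate_average (fun t => t) (fun=> 1).
Definition outer_average : (C -> C) -> C -> C :=
  dilate_average (fun t => t^-1) (fun t => t^-1).

Lemma inner_admissible : admissible (fun t : R => t) (fun=> 1).
Proof.
move=> t t0; split=> //; last by rewrite expr1n mulr1.
exact: cvg_cst.
Qed.

Lemma outer_admissible : admissible (fun t : R => t^-1) (fun t => t^-1).
Proof.
move=> t t0; have tn : t != 0 by rewrite gt_eqF.
split; rewrite ?invr_gt0//; try exact: inv_continuous.
by rewrite expr2 mulrA mulfV// mul1r.
Qed.

Lemma upper_neq0 z : 0 < Im z -> z != 0.
Proof. by apply: contraTneq => ->; rewrite ltxx. Qed.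

Lemma normc_upper_le z : Im z <= normc z.
Proof. exact: le_trans (ler_norm _) (Im_le_normc z). Qed.

Lemma normc_pointwise f M z (m : R) : hardy f M -> 0 < m -> m <= Im z ->
  normc (f z) <= Num.sqrt (2 * M / m).
Proof.
move=> hf m0 mz; have z0 : 0 < Im z by exact: lt_le_trans mz.
have M0 := hardy_ge0 hf.
have c0 : 0 <= 2 * M / m by rewrite divr_ge0 ?mulr_ge0// ltW.
rewrite -(@ler_pXn2r _ 2) ?nnegrE ?normc_ge0 ?sqrtr_ge0// sqr_sqrtr//.
have := hardy_pointwise (Re z) hf z0; rewrite /rl /il -normc_sqr.
case: z mz z0 => a b /= mb b0 /le_trans; apply.
by rewrite ler_wpM2l ?mulr_ge0// lef_pV2// posrE.
Qed.

Lemma cderiv_inner_average f M z : hardy f M -> 0 < Im z ->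
  cderiv (inner_average f) z ((f z - inner_average f z) / z).
Proof.
move=> hf z0; have [Q dQ] := primitive_exists hf.1.
have ds (t : R) : 0 < t -> is_derive t 1 (fun t : R => t) (1 : R) by move=> _; exact: is_derive_id.
have [|m m0|k Hk] := @average_primitive _ _ _ inner_admissible erefl ds
    f M Q f (fun z => z) hf dQ.
- by move=> w t _ _; rewrite mulr1 mul1r mulrC.
- exists (Num.sqrt (2 * M / m)) => t t0 t1 u um.
  have := normc_pointwise hf (mulr_gt0 t0 m0) (_ : t * m <= Im (t%:C * u)).
  rewrite scaleE /= ler_wpM2l ?(ltW t0)// => /(_ isT) h.
  apply: (le_trans (ler_wpM2l (ltW t0) h)).
  have -> : 2 * M / (t * m) = 2 * M / m * t^-1 by rewrite invfM; ring.
  have c0 : 0 <= 2 * M / m by rewrite divr_ge0 ?mulr_ge0 ?(hardy_ge0 hf)// ltW.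
  rewrite (sqrtrM _ c0) (sqrtrV (ltW t0)) [leLHS]mulrCA ler_wpM2l ?sqrtr_ge0//.
  rewrite -{1}(sqr_sqrtr (ltW t0)) -[_ ^+ 2]/(_ * _).
  by rewrite mulfK// gt_eqF// sqrtr_gt0.
apply: cderiv_eq (_ : cderiv _ _ ((Q z - k) * (- z^-1 ^+ 2) + z^-1 * (f z - 0))) _.
  apply: (@cderiv_near _ (fun w => (Q w - k) * w^-1) _ _ _ (Im z)) => //.
    move=> w wz; have w0 : 0 < Im w.
      have := le_lt_trans (Im_le_normc _) wz; rewrite !ReImE ltr_norml; lra.
    by rewrite -Hk// mulrC mulKf// upper_neq0.
  apply: cderivM; last exact: cderivV (upper_neq0 z0).
  by apply: cderivB; [exact: dQ|exact: cderiv_cst].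
rewrite -Hk// /inner_average; field; exact: upper_neq0.
Qed.

Lemma cderiv_outer_average f M z : hardy f M -> 0 < Im z ->
  cderiv (outer_average f) z (- (f z / z)).
Proof.
move=> hf z0.
have [|Q dQ] := @primitive_exists (fun z => f z / z).
  move=> w w0; have [l dl] := hf.1 w w0.
  by eexists; apply: cderivM dl (cderivV (upper_neq0 w0)).
have ds (t : R) : 0 < t -> is_derive t 1 (fun t : R => t^-1) (- t^-1 ^+ 2).
  move=> t0; have tn : t != 0 by rewrite gt_eqF.
  apply: is_derive_eq (is_deriveV tn (is_derive_id t 1)) _.
  by rewrite -[_ *: _]/(_ * _) mulr1 exprVn.
have [|m m0|k Hk] := @average_primitive _ _ _ outer_admissible (invr1 _) ds
    f M Q (fun z => f z / z) (fun z => - 1) hf dQ.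
- move=> w t w0 t0; have tC : t%:C != 0 :> C by rewrite (inj_eq (@complexI R)) gt_eqF.
  have wn := upper_neq0 w0.
  have -> : (- t^-1 ^+ 2)%:C = - (t%:C)^-1 ^+ 2 :> C by rewrite rmorphN rmorphXn fmorphV.
  have -> : (t^-1)%:C = (t%:C)^-1 :> C by rewrite fmorphV.
  by field; apply/andP.
- exists (Num.sqrt (2 * M / m) / m) => t t0 t1 u um.
  have tV : 0 < t^-1 by rewrite invr_gt0.
  have um' : t^-1 * m <= Im ((t^-1)%:C * u) by rewrite scaleE /= ler_wpM2l// ltW.
  have h := normc_pointwise hf (mulr_gt0 tV m0) um'.
  have mu_ : m <= normc u by apply: le_trans um (normc_upper_le u).
  have u0 : 0 < normc u by exact: lt_le_trans mu_.
  rewrite normcM normcV normcM normc_real (gtr0_norm tV) invfM invrK.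
  rewrite [leLHS](_ : _ = normc (f ((t^-1)%:C * u)) / normc u); last first.
    by field; rewrite !gt_eqF.
  have E : 2 * M / (t^-1 * m) = 2 * M / m * t by rewrite invfM invrK; ring.
  have c0 : 0 <= 2 * M / m by rewrite divr_ge0 ?mulr_ge0 ?(hardy_ge0 hf)// ltW.
  move: h; rewrite E (sqrtrM _ c0) => h.
  rewrite mulrAC; apply: ler_pM => //; rewrite ?normc_ge0 ?invr_ge0 ?normc_ge0//.
  by rewrite lef_pV2.
apply: cderiv_eq (_ : cderiv _ _ (- (f z / z - 0))) _; last by rewrite subr0.
apply: (@cderiv_near _ (fun w => - (Q w - k)) _ _ _ (Im z)) => //.
  move=> w wz; have w0 : 0 < Im w.
    have := le_lt_trans (Im_le_normc _) wz; rewrite !ReImE ltr_norml; lra.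
  by rewrite -Hk// mulN1r opprK.
have := cderivZ (-1) (cderivB (dQ z z0) (cderiv_cst k z)).
by rewrite mulN1r; under eq_fun do rewrite mulN1r.
Qed.

End AverageHolomorphy.

(** * The two averages compose to their sum *)

Section Composition.
Variable R : realType.
Local Notation C := R[i].
Local Notation Re := (@complex.Re R).
Local Notation Im := (@complex.Im R).
Implicit Types (f : C -> C) (M : R) (z w : C).

Lemma cderiv0_constant (Q : C -> C) z w : (forall z, 0 < Im z -> cderiv Q z 0) ->
  0 < Im z -> 0 < Im w -> Q z = Q w.
Proof.
move=> dQ z0 w0; have m0 : 0 < Num.min (Im z) (Im w) by rewrite lt_min z0.
have ReE (P : C -> C) : (forall z, 0 < Im z -> cderiv P z 0) -> Re (P z) = Re (P w).
  move=> dP; have mz : Num.min (Im z) (Im w) <= Im z by rewrite ge_min lexx.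
  have mw : Num.min (Im z) (Im w) <= Im w by rewrite ge_min lexx orbT.
  have H : `|Re (P (1%:C * z)) - Re (P (1%:C * w))| <= normc (z - w) * 0.
    apply: (Re_increment_le dP ltr01 m0 mz mw) => u _.
    by rewrite normc0 mulr0.
  by move: H; rewrite !mul1r mulr0 normr_le0 subr_eq0 => /eqP.
apply: complexeqP; first exact: ReE.
have := ReE (fun z => - 'i * Q z); rewrite !ReM /= !oppr0 !mul0r !sub0r !mulN1r !opprK.
by apply=> u u0; have := cderivZ (- 'i) (dQ u u0); rewrite mulr0.
Qed.

Lemma hardy_inner f M : hardy f M -> hardy (inner_average f) (4 * M).
Proof.
move=> hf; apply: (hardy_average (@inner_admissible R) hf) => z z0.
by eexists; exact: (cderiv_inner_average hf z0).
Qed.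

Lemma hardy_outer f M : hardy f M -> hardy (outer_average f) (4 * M).
Proof.
move=> hf; apply: (hardy_average (@outer_admissible R) hf) => z z0.
by eexists; exact: (cderiv_outer_average hf z0).
Qed.

Lemma normc_axis_le f M (q : R) : hardy f M -> 0 < q ->
  normc (f (0 +i* (q^-1 ^+ 2))) <= Num.sqrt (2 * M) * q.
Proof.
move=> hf q0; have s0 : 0 < q^-1 ^+ 2 by rewrite exprn_gt0// invr_gt0.
apply: (le_trans (@normc_pointwise _ _ _ (0 +i* (q^-1 ^+ 2)) _ hf s0 (lexx _))).
rewrite exprVn invrK sqrtrM ?mulr_ge0 ?(hardy_ge0 hf)//.
by rewrite sqrtr_sqr gtr0_norm.
Qed.

Lemma le_scale_eq0 (a c : R) : 0 <= a -> 0 <= c -> (forall q, 0 < q -> a <= c * q) -> a = 0.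
Proof.
move=> a0 c0 H; apply/eqP; rewrite eq_le a0 andbT leNgt; apply/negP => ap.
have c1 : 0 < 2 * (c + 1) by lra.
have := H (a / (2 * (c + 1))) (divr_gt0 ap c1); rewrite mulrA ler_pdivlMr//; nra.
Qed.

(** For the difference [D] of the two sides, [z * D z] has derivative 0; it
    tends to 0 with [z] along the imaginary axis, as [D z] is at most of order
    [(Im z) ^ (-1/2)]. *)
Lemma inner_outer f M z : hardy f M -> 0 < Im z ->
  inner_average (outer_average f) z = inner_average f z + outer_average f z.
Proof.
move=> hf; have hA := hardy_inner hf; have hB := hardy_outer hf.
have hAB := hardy_inner hB.
pose D w := inner_average (outer_average f) w - (inner_average f w + outer_average f w).
have dD w : 0 < Im w -> cderiv (fun w => w * D w) w 0.
  move=> w0; have := cderivM (cderiv_id w) (cderivB (cderiv_inner_average hB w0)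
    (cderivD (cderiv_inner_average hf w0) (cderiv_outer_average hf w0))).
  by move=> h; apply: cderiv_eq h _; rewrite /D; field; exact: upper_neq0.
have axis (q : R) : 0 < q -> 0 < Im (0 +i* (q^-1 ^+ 2) : C).
  by move=> q0; rewrite /= exprn_gt0// invr_gt0.
pose c := Num.sqrt (2 * (4 * (4 * M))) + (Num.sqrt (2 * (4 * M)) + Num.sqrt (2 * (4 * M))).
have c0 : 0 <= c by rewrite !addr_ge0 ?sqrtr_ge0.
move=> z0; have k0 : normc (z * D z) = 0.
  apply: (le_scale_eq0 (normc_ge0 _) c0) => q q0; have qV : 0 < q^-1 by rewrite invr_gt0.
  rewrite (cderiv0_constant dD z0 (axis _ qV)) normcM.
  have -> : normc (0 +i* (q^-1^-1 ^+ 2) : C) = q ^+ 2.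
    by rewrite /= expr0n add0r invrK sqrtr_sqr ger0_norm// sqr_ge0.
  have h : normc (D (0 +i* q^-1^-1 ^+ 2)) <= c * q^-1.
    rewrite /c [leRHS]mulrDl [X in _ + X]mulrDl; apply: (le_trans (normc_le_add _ _)).
    apply: lerD; first exact: (normc_axis_le hAB qV).
    rewrite normcN; apply: (le_trans (normc_le_add _ _)).
    by apply: lerD; [exact: (normc_axis_le hA qV)|exact: (normc_axis_le hB qV)].
  apply: (le_trans (ler_wpM2l (sqr_ge0 q) h)).
  by rewrite mulrCA expr2 mulfK// gt_eqF.
have := eq0_normc k0; move/eqP; rewrite mulf_eq0 (negbTE (upper_neq0 z0)) /=.
by rewrite subr_eq0 => /eqP.
Qed.

(** The difference [D] of the two sides has derivative 0 and tends to 0 at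
    infinity along the imaginary axis. *)
Lemma outer_inner f M z : hardy f M -> 0 < Im z ->
  outer_average (inner_average f) z = inner_average f z + outer_average f z.
Proof.
move=> hf; have hA := hardy_inner hf; have hB := hardy_outer hf.
have hBA := hardy_outer hA.
pose D w := outer_average (inner_average f) w - (inner_average f w + outer_average f w).
have dD w : 0 < Im w -> cderiv D w 0.
  move=> w0; have := cderivB (cderiv_outer_average hA w0)
    (cderivD (cderiv_inner_average hf w0) (cderiv_outer_average hf w0)).
  by move=> h; apply: cderiv_eq h _; field; exact: upper_neq0.
pose c := Num.sqrt (2 * (4 * (4 * M))) + (Num.sqrt (2 * (4 * M)) + Num.sqrt (2 * (4 * M))).
have c0 : 0 <= c by rewrite !addr_ge0 ?sqrtr_ge0.
move=> z0; have k0 : normc (D z) = 0.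
  apply: (le_scale_eq0 (normc_ge0 _) c0) => q q0.
  have axis : 0 < Im (0 +i* (q^-1 ^+ 2) : C) by rewrite /= exprn_gt0// invr_gt0.
  rewrite (cderiv0_constant dD z0 axis) /c [leRHS]mulrDl [X in _ + X]mulrDl; apply: (le_trans (normc_le_add _ _)).
  apply: lerD; first exact: (normc_axis_le hBA q0).
  rewrite normcN; apply: (le_trans (normc_le_add _ _)).
  by apply: lerD; [exact: (normc_axis_le hA q0)|exact: (normc_axis_le hB q0)].
by have := eq0_normc k0; move/eqP; rewrite subr_eq0 => /eqP.
Qed.

End Composition.

(** * Duality of the two averages *)

Section Duality.
Variable R : realType.
Local Notation C := R[i].
Local Notation mu := (@lebesgue_measure R).
Local Notation Re := (@complex.Re R).
Local Notation Im := (@complex.Im R).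
Local Notation I := [set` `](0 : R)%R, 1%R]].
Implicit Types (f g : C -> C) (M N : R) (z w : C) (u v : R -> R).

Lemma ip_scale_sqr u (k : R) : 0 < k -> continuous u -> L2 u ->
  L2 (fun x => u (k * x)) -> ip u u = k * ip (fun x => u (k * x)) (fun x => u (k * x)).
Proof.
move=> k0 cu Lu Lk; apply: EFin_inj; rewrite EFinM -(ip_sqrE Lu) -(ip_sqrE Lk).
rewrite (@integral_affineT _ k 0 (fun x => u x ^+ 2) k0); last 2 first.
- by move=> x; exact: (cvgM (cu x) (cu x)).
- by move=> x; exact: sqr_ge0.
by congr (_ * _)%E; apply: eq_integral => x _; rewrite add0r.
Qed.

Lemma ip_polarization u v : L2 u -> L2 v ->
  4 * ip u v = ip (fun x => u x + v x) (fun x => u x + v x) -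
    ip (fun x => u x - v x) (fun x => u x - v x).
Proof.
move=> Lu Lv; rewrite (ipB_sqr Lu Lv) (ipDl Lu Lv (L2D Lu Lv)) (ipDr Lu Lv Lu) (ipDr Lu Lv Lv).
by rewrite (ipC v u); ring.
Qed.

(** Polarization reduces the change of variables to nonnegative integrands. *)
Lemma ip_scale u v (k : R) : 0 < k -> continuous u -> continuous v -> L2 u -> L2 v ->
  L2 (fun x => u (k * x)) -> L2 (fun x => v (k * x)) ->
  ip u v = k * ip (fun x => u (k * x)) (fun x => v (k * x)).
Proof.
move=> k0 cu cv Lu Lv Lku Lkv.
have four : (4 : R) != 0 by rewrite pnatr_eq0.
apply: (mulfI four); rewrite mulrCA !ip_polarization// mulrBr.
congr (_ - _); apply: (@ip_scale_sqr (fun x => _)) => //.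
- by move=> x; exact: cvgD (cu x) (cv x).
- exact: L2D.
- exact: (L2D Lku Lkv).
- by move=> x; exact: cvgB (cu x) (cv x).
- exact: L2B.
- exact: (L2B Lku Lkv).
Qed.

Lemma pairingC f g y : pairing f g y = pairing g f y.
Proof. by rewrite /pairing (ipC (rl f y)) (ipC (il f y)). Qed.

Lemma ip_rl_scale f g M N (t y : R) : hardy f M -> hardy g N -> 0 < t -> 0 < y ->
  ip (rl (dilate f t) y) (rl g y) = t^-1 * ip (rl f (t * y)) (rl (dilate g t^-1) (t * y)).
Proof.
move=> hf hg t0 y0; have tV : 0 < t^-1 by rewrite invr_gt0.
have ty : 0 < t * y by rewrite mulr_gt0.
have hdf := hardy_dilate hf t0; have hdg := hardy_dilate hg tV.
have fE : (fun x => rl f (t * y) (t * x)) = rl (dilate f t) y.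
  by apply/funext => x; rewrite rl_dilate.
have gE : (fun x => rl (dilate g t^-1) (t * y) (t * x)) = rl g y.
  by apply/funext => x; rewrite rl_dilate !mulKf// gt_eqF.
rewrite (ip_scale t0 (continuous_rl hf ty) (continuous_rl hdg ty)).
- by rewrite fE gE mulKf// gt_eqF.
- exact: L2_rl hf ty.
- exact: L2_rl hdg ty.
- by rewrite fE; exact: L2_rl hdf y0.
- by rewrite gE; exact: L2_rl hg y0.
Qed.

Lemma pairing_rl f g y :
  pairing f g y = ip (rl f y) (rl g y) + ip (rl (fun w => - 'i * f w) y) (rl (fun w => - 'i * g w) y).
Proof.
have E h : il h y = rl (fun w => - 'i * h w) y by apply/funext => x; rewrite rl_mulNi.
by rewrite /pairing !E.
Qed.

Lemma pairing_scale f g M N (t y : R) : hardy f M -> hardy g N -> 0 < t -> 0 < y ->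
  pairing (dilate f t) g y = t^-1 * pairing (dilate g t^-1) f (t * y).
Proof.
move=> hf hg t0 y0; rewrite [in RHS]pairingC !pairing_rl mulrDr.
rewrite -(ip_rl_scale hf hg t0 y0).
by rewrite -(ip_rl_scale (hardy_mulNi hf) (hardy_mulNi hg) t0 y0).
Qed.

Section Averages.
Variables sigma kappa : R -> R.
Hypothesis adm : admissible sigma kappa.

Lemma pairing_dilate_le f g M N (y t : R) : hardy f M -> hardy g N -> 0 < y -> 0 < t ->
  `|kappa t * pairing (dilate f (sigma t)) g y| <= (M + N) * invsqrt t.
Proof.
move=> hf hg y0 t0; rewrite pairing_rl mulrDr.
apply: (le_trans (ler_normD _ _)).
have h1 := ip_dilate_le adm hf hg y0 t0.
have h2 := ip_dilate_le adm (hardy_mulNi hf) (hardy_mulNi hg) y0 t0.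
by apply: (le_trans (lerD h1 h2)); lra.
Qed.

Lemma pairing_average f g M N (y : R) : hardy f M -> hardy g N -> 0 < y ->
  mu.-integrable I (fun t => (kappa t * pairing (dilate f (sigma t)) g y)%:E) /\
  pairing (dilate_average sigma kappa f) g y =
    (\int[mu]_(t in I) (kappa t * pairing (dilate f (sigma t)) g y))%R.
Proof.
move=> hf hg y0; have [i1 e1] := ip_dilate_average adm hf hg y0.
have [i2 e2] := ip_dilate_average adm (hardy_mulNi hf) (hardy_mulNi hg) y0.
have pE (t : R) : kappa t * pairing (dilate f (sigma t)) g y =
    kappa t * ip (rl (dilate f (sigma t)) y) (rl g y) +
    kappa t * ip (rl (dilate (fun w => - 'i * f w) (sigma t)) y) (rl (fun w => - 'i * g w) y).
  by rewrite pairing_rl mulrDr.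
split; first by have := integrableDI i1 i2; congr integrable; apply/funext => t; rewrite pE.
have -> : pairing (dilate_average sigma kappa f) g y =
    ip (rl (dilate_average sigma kappa f) y) (rl g y) +
    ip (rl (dilate_average sigma kappa (fun w => - 'i * f w)) y)
       (rl (fun w => - 'i * g w) y).
  have H1 : il (dilate_average sigma kappa f) y =
      rl (dilate_average sigma kappa (fun w => - 'i * f w)) y.
    by apply/funext => x; exact: il_average.
  have H2 : il g y = rl (fun w => - 'i * g w) y by apply/funext => x; rewrite rl_mulNi.
  by rewrite /pairing H1 H2.
rewrite e1 e2 -(RintegralDI i1 i2).
by apply: eq_Rintegral => t _; rewrite -pE.
Qed.

End Averages.

(** After the change of variables the two pairings are the integrals over [t]
    of the same function of the height, taken at the heights [t * y] and [y];
    both tend to its boundary limit. *)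
Lemma adjoint_limit f g M N (y : nat -> R) : hardy f M -> hardy g N ->
  (forall n, 0 < y n) -> y n @[n --> \oo] --> (0 : R) ->
  pairing (inner_average f) g (y n) - pairing f (outer_average g) (y n)
    @[n --> \oo] --> (0 : R).
Proof.
move=> hf hg y0 cy.
pose p (t h : R) := t^-1 * pairing (dilate g t^-1) f h.
have aI := @inner_admissible R; have aO := @outer_admissible R.
have It0 (t : R) : I t -> 0 < t by rewrite /= in_itv/= => /andP[].
have innerE n : mu.-integrable I (fun t => (p t (t * y n))%:E) /\
    pairing (inner_average f) g (y n) = (\int[mu]_(t in I) p t (t * y n))%R.
  have [i1 ->] := pairing_average aI hf hg (y0 n).
  have E (t : R) : I t -> 1 * pairing (dilate f t) g (y n) = p t (t * y n).
    by move=> /It0 t0; rewrite mul1r (pairing_scale hf hg t0).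
  split; last by apply: eq_Rintegral => t /[!inE]; exact: E.
  apply: eq_integrable i1; first exact: measurable_itv.
  by move=> t /[!inE] /E ->.
have outerE n : mu.-integrable I (fun t => (p t (y n))%:E) /\
    pairing f (outer_average g) (y n) = (\int[mu]_(t in I) p t (y n))%R.
  by rewrite pairingC; exact: (pairing_average aO hg hf (y0 n)).
pose d n (t : R) := p t (t * y n) - p t (y n).
have id n : mu.-integrable I (EFin \o d n).
  by apply: (integrableB _ (innerE n).1 (outerE n).1); exact: measurable_itv.
have dE n : pairing (inner_average f) g (y n) - pairing f (outer_average g) (y n) =
    (\int[mu]_(t in I) d n t)%R.
  have [i1 ->] := innerE n; have [i2 ->] := outerE n.
  by rewrite -(RintegralBI i1 i2).
have p_le (t h : R) : 0 < t -> 0 < h -> `|p t h| <= (N + M) * invsqrt t.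
  by move=> t0 h0; exact: (pairing_dilate_le aO hg hf h0 t0).
have d0 (t : R) : 0 < t -> d n t @[n --> \oo] --> (0 : R).
  move=> t0; have tV : 0 < t^-1 by rewrite invr_gt0.
  have hd := hardy_dilate hg tV.
  have [a [b bd]] := boundary_exists hd; have [a' [b' bf]] := boundary_exists hf.
  have c1 := pairing_cvg hd hf bd bf y0 cy.
  have ty n : 0 < t * y n by rewrite mulr_gt0.
  have cty : t * y n @[n --> \oo] --> (0 : R).
    by rewrite -[X in _ --> X](mulr0 t); apply: cvgM; [exact: cvg_cst|exact: cy].
  have c2 := pairing_cvg hd hf bd bf ty cty.
  rewrite -[X in _ --> X](subrr (t^-1 * (ip a a' + ip b b'))).
  by apply: cvgB; (apply: cvgM; [exact: cvg_cst|]).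
have mI : measurable I by exact: measurable_itv.
have md n : measurable_fun I (EFin \o d n) by have /integrableP[] := id n.
have ib : mu.-integrable I (fun t => (2 * (N + M) * invsqrt t)%:E).
  exact: integrableZI (integrable_invsqrt R).
have cd : {ae mu, forall t, I t -> (EFin \o d n) t @[n --> \oo] --> 0%E}.
  apply: aeW => t /It0 t0; apply: cvg_EFin; last exact: d0.
  by apply: nearW.
have dd : {ae mu, forall t n, I t -> (`|(EFin \o d n) t| <= (2 * (N + M) * invsqrt t)%:E)%E}.
  apply: aeW => t n /It0 t0; rewrite lee_fin; apply: (le_trans (ler_normB _ _)).
  have ty : 0 < t * y n by rewrite mulr_gt0.
  by have := p_le t _ t0 ty; have := p_le t _ t0 (y0 n); lra.
have [_ _ H] := @dominated_convergence _ _ R mu I mI (fun n => EFin \o d n) _ _ md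
  (measurable_cst _) cd ib dd.
under eq_fun do rewrite dE.
apply: fine_cvg; move: H; rewrite integral0.
exact.
Qed.

End Duality.

(** * The operators on the Hardy space *)

Section FunctionLevel.
Variable R : realType.
Local Notation C := R[i].
Local Notation mu := (@lebesgue_measure R).
Local Notation Re := (@complex.Re R).
Local Notation Im := (@complex.Im R).
Local Notation I := [set` `](0 : R)%R, 1%R]].
Implicit Types (f g : C -> C) (M N : R) (z w : C).

Lemma RintegralZI (k : R) (g : R -> R) : mu.-integrable I (EFin \o g) ->
  (\int[mu]_(t in I) (k * g t) = k * \int[mu]_(t in I) g t)%R.
Proof. by move=> ig; apply: RintegralZl => //; exact: measurable_itv. Qed.

Lemma integrable_dilate_il (sigma kappa : R -> R) f M (x y : R) : admissible sigma kappa ->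
  hardy f M -> 0 < y ->
  mu.-integrable I (fun t => (kappa t * il f (sigma t * y) (sigma t * x))%:E).
Proof.
move=> adm hf y0; have := integrable_dilate adm x (hardy_mulNi hf) y0.
by congr integrable; apply/funext => t; rewrite rl_mulNi.
Qed.

Lemma dilate_averageZ (sigma kappa : R -> R) (a : C) f M z : admissible sigma kappa ->
  hardy f M -> 0 < Im z ->
  dilate_average sigma kappa (fun w => a * f w) z = a * dilate_average sigma kappa f z.
Proof.
move=> adm hf z0.
have i1 := integrable_dilate adm (Re z) hf z0.
have i2 := integrable_dilate_il (Re z) adm hf z0.
have comb (p q : R) : (\int[mu]_(t in I)
     (p * (kappa t * rl f (sigma t * Im z) (sigma t * Re z)) +
      q * (kappa t * il f (sigma t * Im z) (sigma t * Re z))))%R =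
    p * Re (dilate_average sigma kappa f z) + q * Im (dilate_average sigma kappa f z).
  by rewrite (RintegralDI (integrableZI p i1) (integrableZI q i2)) !RintegralZl.
apply: complexeqP.
  rewrite ReM -mulNr -comb; apply: eq_Rintegral => t _.
  by rewrite /rl /il ReM; ring.
rewrite ImM addrC -comb; apply: eq_Rintegral => t _.
by rewrite /rl /il ImM; ring.
Qed.

Lemma dilate_averageD (sigma kappa : R -> R) f g M N z : admissible sigma kappa ->
  hardy f M -> hardy g N -> 0 < Im z ->
  dilate_average sigma kappa (fun w => f w + g w) z =
  dilate_average sigma kappa f z + dilate_average sigma kappa g z.
Proof.
move=> adm hf hg z0.
have i1 := integrable_dilate adm (Re z) hf z0.
have i2 := integrable_dilate_il (Re z) adm hf z0.
have j1 := integrable_dilate adm (Re z) hg z0.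
have j2 := integrable_dilate_il (Re z) adm hg z0.
apply: complexeqP.
  rewrite ReD -(RintegralDI i1 j1); apply: eq_Rintegral => t _.
  by rewrite /rl ReD; ring.
rewrite ImD -(RintegralDI i2 j2); apply: eq_Rintegral => t _.
by rewrite /il ImD; ring.
Qed.

Lemma eq_dilate_average (sigma kappa : R -> R) f g z : admissible sigma kappa ->
  (forall w, 0 < Im w -> f w = g w) -> 0 < Im z ->
  dilate_average sigma kappa f z = dilate_average sigma kappa g z.
Proof.
move=> adm fg z0.
have E (t : R) : I t -> f ((sigma t * Re z) +i* (sigma t * Im z)) =
    g ((sigma t * Re z) +i* (sigma t * Im z)).
  rewrite /= in_itv/= => /andP[/adm[s0 _ _ _ _] _]; apply: fg.
  by rewrite /= mulr_gt0.
by congr Complex; apply: eq_Rintegral => t /[!inE] /E h; rewrite /rl /il h.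
Qed.

Lemma segment_integral0E f M z : hardy f M -> 0 < Im z ->
  segment_integral f 0 z = z * inner_average f z.
Proof.
move=> hf z0.
have ReE (g : C -> C) : hardy g M -> segRe g 0 z = Re (z * inner_average g z).
  move=> hg; have i1 := integrable_dilate (@inner_admissible R) (Re z) hg z0.
  have i2 := integrable_dilate_il (Re z) (@inner_admissible R) hg z0.
  have j1 := integrableZI (Re z) i1; have j2 := integrableZI (Im z) i2.
  have E (t : R) : Re (g (0 + (z - 0) * t%:C) * (z - 0)) =
      Re z * (1 * rl g (t * Im z) (t * Re z)) - Im z * (1 * il g (t * Im z) (t * Re z)).
    have -> : 0 + (z - 0) * t%:C = t%:C * z by ring.
    by rewrite subr0 scaleE ReM !mul1r /rl /il; ring.
  rewrite /segRe; under eq_Rintegral => t _ do rewrite E.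
  rewrite -Rintegral_itv_obnd_cbnd; last first.
    by apply: (integrableB _ j1 j2); exact: measurable_itv.
  by rewrite (RintegralBI j1 j2) (RintegralZI _ i1) (RintegralZI _ i2) ReM.
apply: complexeqP; first exact: ReE.
rewrite Im_segment_integral ReE; last exact: hardy_mulNi.
rewrite /inner_average (dilate_averageZ _ (@inner_admissible R) hf z0).
by rewrite -/(inner_average f z) !ReImE /=; ring.
Qed.

Lemma eq_hardy f g M : (forall z, 0 < Im z -> f z = g z) -> hardy f M -> hardy g M.
Proof.
move=> fg [df Ef]; split=> [z z0|y y0].
  have [l dl] := df z z0; exists l; apply: (cderiv_near z0 _ dl) => w wz; apply: fg.
  by have := le_lt_trans (Im_le_normc _) wz; rewrite !ReImE ltr_norml; lra.
have := Ef y y0; congr (_ <= _)%E; apply: eq_integral => x _.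
by rewrite fg.
Qed.

Lemma energyB_le f g M N y : hardy f M -> hardy g N -> 0 < y ->
  energy (fun w => f w - g w) y <= 2 * energy f y + 2 * energy g y.
Proof.
move=> hf hg y0.
have sub (u v : R -> R) : L2 u -> L2 v ->
    ip (fun x => u x - v x) (fun x => u x - v x) <= 2 * ip u u + 2 * ip v v.
  move=> Lu Lv; have := ip_ge0 (fun x => u x + v x).
  rewrite (ipDl Lu Lv (L2D Lu Lv)) (ipDr Lu Lv Lu) (ipDr Lu Lv Lv) (ipB_sqr Lu Lv).
  by rewrite (ipC v u); lra.
have h1 := sub _ _ (L2_rl hf y0) (L2_rl hg y0).
have h2 := sub _ _ (L2_il hf y0) (L2_il hg y0).
rewrite /energy.
have -> : rl (fun w => f w - g w) y = (fun x => rl f y x - rl g y x).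
  by apply/funext => x; rewrite /rl ReD ReN.
have -> : il (fun w => f w - g w) y = (fun x => il f y x - il g y x).
  by apply/funext => x; rewrite /il ImD ImN.
by lra.
Qed.

End FunctionLevel.

Section Operators.
Variable R : realType.
Local Notation C := R[i].
Local Notation mu := (@lebesgue_measure R).
Local Notation Re := (@complex.Re R).
Local Notation Im := (@complex.Im R).
Implicit Types (F G X Y : H2 R) (f g : C -> C) (M N : R).

Definition sqnorm F : R := fine (H2_energy F).

Lemma H2_valP F : H2_set F.
Proof. by have := valP F; rewrite /H2_pred inE. Qed.

Lemma H2_energy_ge0 f : (0 <= H2_energy f)%E.
Proof.
apply: (@le_trans _ _ (horizontal_energy f 1)).
  by apply: integral_ge0 => x _; rewrite lee_fin sqr_ge0.
by apply: ereal_sup_ubound; exists 1 => //=; exact: ltr01.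
Qed.

Lemma sqnormE F : H2_energy F = (sqnorm F)%:E.
Proof.
have [_ _ Foo] := H2_valP F; rewrite fineK// ge0_fin_numE//; exact: H2_energy_ge0.
Qed.

Lemma H2_hardy F : hardy F (sqnorm F).
Proof.
have [dF _ _] := H2_valP F; split=> [z z0|y y0].
  by have /derivable_cderivP := dF z z0.
by rewrite -sqnormE; apply: ereal_sup_ubound; exists y.
Qed.

Lemma sqnorm_le F M : hardy F M -> sqnorm F <= M.
Proof.
move=> hF; rewrite -lee_fin -sqnormE; apply: ge_ereal_sup => _ [y y0 <-].
exact: hF.2.
Qed.

Lemma restrict_H2 f M : hardy f M -> (f \_ (@upper_half_plane R)) \in @H2_pred R.
Proof.
move=> hf; have hr : hardy (f \_ (@upper_half_plane R)) M.
  by apply: eq_hardy hf => z z0; rewrite patchE mem_set.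
rewrite /H2_pred inE; split.
- by move=> z z0; apply/derivable_cderivP; exact: hr.1.
- by move=> z z0; rewrite patchE memNset.
- by apply: le_lt_trans (ltry M); apply: ge_ereal_sup => _ [y y0 <-]; exact: hr.2.
Qed.

Lemma H2_eq F G : (forall z, 0 < Im z -> F z = G z) -> F = G.
Proof.
move=> FG; apply/val_inj/funext => z /=; have [/FG //|z0] := boolP (0 < Im z).
have [_ F0 _] := H2_valP F; have [_ G0 _] := H2_valP G.
by rewrite (F0 z (negP z0)) (G0 z (negP z0)).
Qed.

Lemma linearBP (T : H2 R -> H2 R) F G : linear T -> T (F - G) = T F - T G.
Proof. by move=> lT; rewrite -[F - G]addrC -scaleN1r lT scaleN1r addrC. Qed.

Lemma bounded_operatorP (T : H2 R -> H2 R) (K : R) : linear T ->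
  (forall F, sqnorm (T F) <= K * sqnorm F) -> 0 <= K -> bounded_operator T.
Proof.
move=> lT TK K0; split=> //; exists (Num.sqrt K) => F.
by rewrite /H2_norm -sqrtrM// ler_wsqrtr//; exact: TK.
Qed.

Lemma sqnormB_le F G : sqnorm (F - G) <= 2 * sqnorm F + 2 * sqnorm G.
Proof.
apply: sqnorm_le; have hF := H2_hardy F; have hG := H2_hardy G.
have hFG := H2_hardy (F - G); split; first exact: hFG.1.
move=> y y0; rewrite (energyE hFG y0) lee_fin; apply: (le_trans (energyB_le hF hG y0)).
by have := energy_le hF y0; have := energy_le hG y0; lra.
Qed.

Lemma bounded_operatorB_id (T : H2 R -> H2 R) (K : R) : linear T -> 0 <= K ->
  (forall F, sqnorm (T F) <= K * sqnorm F) -> bounded_operator (fun F => T F - F).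
Proof.
move=> lT K0 TK; apply: (@bounded_operatorP _ (2 * K + 2)); last by lra.
  by move=> a F G; rewrite lT scalerBr; rewrite opprD addrACA.
move=> F; apply: (le_trans (sqnormB_le _ _)); have := TK F.
by move: (sqnorm _) (sqnorm _) => a b; lra.
Qed.

(** The limit at height 0 of the pairings determines the inner product. *)
Lemma inner_eq_limit X Y X' Y' :
  (forall y : nat -> R, (forall n, 0 < y n) -> y n @[n --> \oo] --> (0 : R) ->
    pairing X Y (y n) - pairing X' Y' (y n) @[n --> \oo] --> (0 : R) /\
    pairing (fun w => - 'i * X w) Y (y n) - pairing (fun w => - 'i * X' w) Y' (y n)
      @[n --> \oo] --> (0 : R)) ->
  inner X Y = inner X' Y'.
Proof.
move=> H; pose y (n : nat) : R := n.+1%:R^-1.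
have y0 n : 0 < y n by rewrite invr_gt0.
have cy : y n @[n --> \oo] --> (0 : R) by exact: cvg_harmonic.
have [c1 c2] := H y y0 cy.
have hX := H2_hardy X; have hY := H2_hardy Y.
have hX' := H2_hardy X'; have hY' := H2_hardy Y'.
have [p [q bX]] := boundary_exists hX; have [r [s bY]] := boundary_exists hY.
have [p' [q' bX']] := boundary_exists hX'; have [r' [s' bY']] := boundary_exists hY'.
rewrite (innerE hX hY bX bY) (innerE hX' hY' bX' bY').
have d1 : pairing X Y (y n) - pairing X' Y' (y n) @[n --> \oo] -->
    (ip p r + ip q s) - (ip p' r' + ip q' s').
  by apply: cvgB; [exact: (pairing_cvg hX hY bX bY y0 cy)|exact: (pairing_cvg hX' hY' bX' bY' y0 cy)].
have d2 : pairing (fun w => - 'i * X w) Y (y n) - pairing (fun w => - 'i * X' w) Y' (y n)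
    @[n --> \oo] --> (ip q r - ip p s) - (ip q' r' - ip p' s').
  by apply: cvgB; [exact: (pairing_mulNi_cvg hX hY bX bY y0 cy)|exact: (pairing_mulNi_cvg hX' hY' bX' bY' y0 cy)].
have e1 : (ip p r + ip q s) - (ip p' r' + ip q' s') = 0 :> R.
  exact: cvg_unique _ d1 c1.
have e2 : (ip q r - ip p s) - (ip q' r' - ip p' s') = 0 :> R.
  exact: cvg_unique _ d2 c2.
by rewrite (subr0_eq e1) (subr0_eq e2).
Qed.

Section Lift.
Variable T : (C -> C) -> C -> C.
Hypothesis hT : forall f M, hardy f M -> hardy (T f) (4 * M).

Definition lift_op F : H2 R := MkH2 (restrict_H2 (hT (H2_hardy F))).

Lemma lift_opE F z : 0 < Im z -> lift_op F z = T F z.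
Proof. by move=> z0; rewrite /= patchE mem_set. Qed.

Lemma lift_op_sqnorm F : sqnorm (lift_op F) <= 4 * sqnorm F.
Proof.
apply: sqnorm_le; apply: eq_hardy (hT (H2_hardy F)) => z z0; exact/esym/lift_opE.
Qed.

End Lift.

Lemma lift_average_linear (sigma kappa : R -> R) (adm : admissible sigma kappa)
  (hT : forall f M, hardy f M -> hardy (dilate_average sigma kappa f) (4 * M)) :
  linear (lift_op hT).
Proof.
move=> a F G; apply: H2_eq => z z0.
have hF := H2_hardy F; have hG := H2_hardy G; have hZ := H2_hardy (a *: F).
rewrite lift_opE//.
transitivity (a * dilate_average sigma kappa F z + dilate_average sigma kappa G z).
  rewrite -(dilate_averageZ a adm hF z0).
  exact: (dilate_averageD adm hZ hG z0).
by rewrite -!lift_opE.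
Qed.

Definition cesaro : H2 R -> H2 R := lift_op (@hardy_inner R).
Definition cesaro_adjoint : H2 R -> H2 R := lift_op (@hardy_outer R).

Lemma cesaro_linear : linear cesaro.
Proof. exact: lift_average_linear (@inner_admissible R) _. Qed.

Lemma cesaro_adjoint_linear : linear cesaro_adjoint.
Proof. exact: lift_average_linear (@outer_admissible R) _. Qed.

Lemma cesaro_comp F : cesaro (cesaro_adjoint F) = cesaro F + cesaro_adjoint F.
Proof.
have hF := H2_hardy F; apply: H2_eq => z z0.
transitivity (inner_average (outer_average F) z).
  rewrite lift_opE//; apply: (eq_dilate_average (@inner_admissible R)) z0 => w w0.
  exact: lift_opE.
rewrite (inner_outer hF z0) -[RHS]/(cesaro F z + cesaro_adjoint F z).
by rewrite /cesaro /cesaro_adjoint !lift_opE.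
Qed.

Lemma cesaro_adjoint_comp F : cesaro_adjoint (cesaro F) = cesaro F + cesaro_adjoint F.
Proof.
have hF := H2_hardy F; apply: H2_eq => z z0.
transitivity (outer_average (inner_average F) z).
  rewrite lift_opE//; apply: (eq_dilate_average (@outer_admissible R)) z0 => w w0.
  exact: lift_opE.
rewrite (outer_inner hF z0) -[RHS]/(cesaro F z + cesaro_adjoint F z).
by rewrite /cesaro /cesaro_adjoint !lift_opE.
Qed.

Lemma eq_pairing f f' g g' (y : R) : 0 < y -> (forall z, 0 < Im z -> f z = f' z) ->
  (forall z, 0 < Im z -> g z = g' z) -> pairing f g y = pairing f' g' y.
Proof.
move=> y0 ff gg.
have E (h h' : C -> C) : (forall z, 0 < Im z -> h z = h' z) -> rl h y = rl h' y /\ il h y = il h' y.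
  by move=> hh; split; apply/funext => x; rewrite /rl /il hh.
have [r1 i1] := E _ _ ff; have [r2 i2] := E _ _ gg.
by rewrite /pairing r1 i1 r2 i2.
Qed.

Lemma pairingBl f g h M N K (y : R) : hardy f M -> hardy g N -> hardy h K -> 0 < y ->
  pairing (fun w => f w - g w) h y = pairing f h y - pairing g h y.
Proof.
move=> hf hg hh y0.
have r : rl (fun w => f w - g w) y = (fun x => rl f y x - rl g y x).
  by apply/funext => x; rewrite /rl ReD ReN.
have i : il (fun w => f w - g w) y = (fun x => il f y x - il g y x).
  by apply/funext => x; rewrite /il ImD ImN.
rewrite /pairing r i (ipBl (L2_rl hf y0) (L2_rl hg y0) (L2_rl hh y0)).
by rewrite (ipBl (L2_il hf y0) (L2_il hg y0) (L2_il hh y0)); ring.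
Qed.

Lemma cesaro_mulNi F z : 0 < Im z ->
  - 'i * cesaro F z = inner_average (fun w => - 'i * F w) z.
Proof.
move=> z0; rewrite /cesaro lift_opE// /inner_average.
by rewrite (dilate_averageZ _ (@inner_admissible R) (H2_hardy F) z0).
Qed.

Section Limits.
Variables (f : C -> C) (M : R) (G : H2 R) (y : nat -> R).
Hypothesis hf : hardy f M.
Hypothesis y0 : forall n, 0 < y n.
Hypothesis cy : y n @[n --> \oo] --> (0 : R).

Lemma pairing_cesaro : pairing (inner_average f) G (y n) -
  pairing f (cesaro_adjoint G) (y n) @[n --> \oo] --> (0 : R).
Proof.
have E n : pairing f (cesaro_adjoint G) (y n) = pairing f (outer_average G) (y n).
  by apply: eq_pairing => // z z0; rewrite /cesaro_adjoint lift_opE.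
by under eq_fun do rewrite E; exact: adjoint_limit hf (H2_hardy G) y0 cy.
Qed.

Lemma pairing_cesaro_sub : pairing (fun w => inner_average f w - f w) G (y n) -
  pairing f (cesaro_adjoint G - G) (y n) @[n --> \oo] --> (0 : R).
Proof.
have E n : pairing (fun w => inner_average f w - f w) G (y n) -
    pairing f (cesaro_adjoint G - G) (y n) =
    pairing (inner_average f) G (y n) - pairing f (cesaro_adjoint G) (y n).
  have hG := H2_hardy G.
  rewrite (pairingBl (hardy_inner hf) hf hG (y0 n)).
  rewrite [pairing f (_ - _) _]pairingC [pairing f (cesaro_adjoint G) _]pairingC.
  have H : pairing (cesaro_adjoint G - G) f (y n) =
      pairing (cesaro_adjoint G) f (y n) - pairing G f (y n).
    exact: pairingBl (H2_hardy (cesaro_adjoint G)) hG hf (y0 n).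
  by rewrite H (pairingC G f); ring.
by under eq_fun do rewrite E; exact: pairing_cesaro.
Qed.

End Limits.

Lemma inner_cesaro F G : inner (cesaro F) G = inner F (cesaro_adjoint G).
Proof.
have hF := H2_hardy F; apply: inner_eq_limit => y y0 cy; split.
  have E n : pairing (cesaro F) G (y n) = pairing (inner_average F) G (y n).
    by apply: eq_pairing => // z z0; rewrite /cesaro lift_opE.
  by under eq_fun do rewrite E; exact: (pairing_cesaro G hF y0 cy).
have E n : pairing (fun w => - 'i * cesaro F w) G (y n) =
    pairing (inner_average (fun w => - 'i * F w)) G (y n).
  by apply: eq_pairing => // z z0; exact: cesaro_mulNi.
by under eq_fun do rewrite E; exact: (pairing_cesaro G (hardy_mulNi hF) y0 cy).
Qed.

Lemma inner_cesaro_sub F G :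
  inner (cesaro F - F) G = inner F (cesaro_adjoint G - G).
Proof.
have hF := H2_hardy F; apply: inner_eq_limit => y y0 cy; split.
  have E n : pairing (cesaro F - F) G (y n) =
      pairing (fun w => inner_average F w - F w) G (y n).
    apply: eq_pairing => // z z0.
    by rewrite -[LHS]/(cesaro F z - F z) /cesaro lift_opE.
  by under eq_fun do rewrite E; exact: (pairing_cesaro_sub G hF y0 cy).
have E n : pairing (fun w => - 'i * (cesaro F - F) w) G (y n) =
    pairing (fun w => inner_average (fun w => - 'i * F w) w - (- 'i * F w)) G (y n).
  apply: eq_pairing => // z z0.
  by rewrite -[(cesaro F - F) z]/(cesaro F z - F z) mulrBr cesaro_mulNi.
by under eq_fun do rewrite E; exact: (pairing_cesaro_sub G (hardy_mulNi hF) y0 cy).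
Qed.

Lemma cesaroE F : H2_val (cesaro F) = cesaro_average (H2_val F).
Proof.
apply/funext => z; rewrite /cesaro_average patchE; case: ifPn => [/set_mem z0|/negP zn].
  rewrite (segment_integral0E (H2_hardy F) z0) mulKf ?upper_neq0//.
  exact: lift_opE.
have [_ -> //] := H2_valP (cesaro F).
by move=> z0; apply: zn; rewrite inE.
Qed.

Lemma bounded_lift (T : (C -> C) -> C -> C)
  (hT : forall f M, hardy f M -> hardy (T f) (4 * M)) :
  linear (lift_op hT) ->
  bounded_operator (lift_op hT) /\ bounded_operator (fun F => lift_op hT F - F).
Proof.
move=> lT; split.
  by apply: (bounded_operatorP lT (lift_op_sqnorm hT)).
by apply: (bounded_operatorB_id lT _ (lift_op_sqnorm hT)).
Qed.

End Operators.

Theorem theorem2 (R : realType) :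
  exists C : H2 R -> H2 R,
    [/\ (forall f : H2 R, H2_val (C f) = cesaro_average (H2_val f)),
        (exists2 U : H2 R -> H2 R, unitary_operator U & C = (id \+ U)) &
        normal_operator C].
Proof.
have [bC bU] := bounded_lift (@cesaro_linear R).
have [bC' bU'] := bounded_lift (@cesaro_adjoint_linear R).
exists (@cesaro R); split; first exact: cesaroE.
- exists (fun F => cesaro F - F); last by apply/funext => F /=; rewrite addrC subrK.
  split; first exact: bU.
  exists (fun F => cesaro_adjoint F - F); split.
  + by split; [exact: bU'|exact: inner_cesaro_sub].
  + apply/funext => F /=; rewrite (linearBP _ _ (@cesaro_adjoint_linear R)).
    by rewrite cesaro_adjoint_comp addrK opprB addrC subrK.
  + apply/funext => F /=; rewrite (linearBP _ _ (@cesaro_linear R)).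
    by rewrite cesaro_comp (addrC (cesaro F)) addrK opprB addrC subrK.
split; first exact: bC.
exists (@cesaro_adjoint R).
  by split; [exact: bC'|exact: inner_cesaro].
by apply/funext => F /=; rewrite cesaro_comp cesaro_adjoint_comp.
Qed.
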